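(* Let $F$ be a cyclic cubic field. Then the function $h^0$ on the Arakelov class group $\mathrm{Pic}^0_F$ has its unique global maximum at the class of the trivial divisor $D_0=(O_F,(1,1,1))$.
   Context: $F$ is a cyclic cubic number field (Galois over $\mathbb{Q}$ with cyclic Galois group $G=\langle\sigma\rangle$ of order 3); it is totally real, and we fix $F\subset\mathbb{R}$. $O_F$ is its ring of integers. Let $\Phi:F\to\mathbb{R}^3$, $\Phi(f)=(f,\sigma(f),\sigma^2(f))$. For $u=(u_0,u_1,u_2)\in\mathbb{R}^3$ put $N(u)=u_0u_1u_2$. An Arakelov divisor of $F$ is a pair $D=(I,u)$ with $I$ a fractional ideal of $F$ and $u\in(\mathbb{R}_{>0})^3$; these form a group under $(I,u)+(J,v)=(IJ,(u_iv_i)_i)$. Its degree is $\deg D=\log(N(u)N(I))$. For $f\in F^\times$ the principal divisor is $(f)=(f^{-1}O_F,(|\sigma^i(f)|)_{0\le i\le 2})$, which has degree 0. $\mathrm{Pic}^0_F$ is the group of degree-0 Arakelov divisors modulo principal divisors. For $D=(I,u)$ and $f\in I$ write $\|uf\|^2=\sum_{i=0}^2u_i^2\,\sigma^i(f)^2$, set $k^0(D)=\sum_{f\in I}e^{-\pi\|uf\|^2}$ and $h^0(D)=\log k^0(D)$; $h^0$ is well defined on $\mathrm{Pic}^0_F$. *)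

(* Defs.v *)
From HB Require Import structures.
From mathcomp Require Import all_boot all_order all_algebra all_fingroup.
From mathcomp Require Import all_solvable all_field.
From mathcomp Require Import finmap generic_quotient.
From mathcomp Require Import all_classical all_reals all_analysis.

Set Implicit Arguments.
Unset Strict Implicit.
Unset Printing Implicit Defensive.

Import Order.TTheory GRing.Theory Num.Theory.

Local Open Scope classical_set_scope.
Local Open Scope ring_scope.
Local Open Scope quotient_scope.

Section Ideals.
Variable F : fieldExtType rat.
Implicit Types I J : set F.

Definition ring_of_integers : set F :=
  [set x | integralOver (intr : int -> F) x].
Local Notation OF := ring_of_integers.

Definition fractional_ideal I : Prop :=
  [/\ forall x y, I x -> I y -> I (x + y),
      forall a x, OF a -> I x -> I (a * x),
      exists2 x, I x & x != 0
    & exists d, [/\ OF d, d != 0 & forall x, I x -> OF (d * x)]].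

Definition ideal_mul I J : set F :=
  [set z | exists2 s : seq (F * F),
     forall p, p \in s -> I p.1 /\ J p.2 & z = \sum_(p <- s) p.1 * p.2].

Definition principal_ideal (f : F) : set F := [set f * a | a in OF].

(* [A : B] for additive subgroups B `<=` A of F: the number of cosets a + B
   with a in A (0 by convention if there are infinitely many) *)
Definition subgroup_index (A B : set F) : nat :=
  #|` fset_set [set [set a + b | b in B] | a in A]|.

(* The generalized index [O_F : I] = [O_F : O_F n I] / [I : O_F n I]; it is
   the cardinal of O_F / I when I is an integral ideal, and it coincides with
   [O_F : d I] / |N_{F/Q}(d)| for any nonzero d in O_F such that d I is
   integral. *)
Definition ideal_norm I : rat :=
  (subgroup_index OF (OF `&` I))%:R / (subgroup_index I (OF `&` I))%:R.

Lemma OF0 : OF 0. Proof. exact: (@mxpoly.integral0 _ _ intr). Qed.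
Lemma OF1 : OF 1. Proof. exact: (@mxpoly.integral1 _ _ intr). Qed.
Lemma OFD x y : OF x -> OF y -> OF (x + y). Proof. exact: (@mxpoly.integral_add _ _ intr). Qed.
Lemma OFM x y : OF x -> OF y -> OF (x * y). Proof. exact: (@mxpoly.integral_mul _ _ intr). Qed.
Lemma OFN x : OF x -> OF (- x). Proof. exact: (@mxpoly.integral_opp _ _ intr). Qed.

Lemma fractional_ideal0 I : fractional_ideal I -> I 0.
Proof. by case=> _ IM [x Ix _] _; rewrite -(mul0r x); apply: IM Ix; exact: OF0. Qed.

Lemma fractional_ideal_mul I J :
  fractional_ideal I -> fractional_ideal J -> fractional_ideal (ideal_mul I J).
Proof.
move=> [ID IM [x Ix xn0] [d [Od dn0 dI]]] [JD JM [y Jy yn0] [e [Oe en0 eJ]]].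
split.
- move=> _ _ [s sP ->] [t tP ->]; exists (s ++ t); last by rewrite big_cat.
  by move=> p; rewrite mem_cat => /orP[/sP|/tP].
- move=> a _ Oa [s sP ->]; exists [seq (a * p.1, p.2) | p <- s].
    by move=> _ /mapP[p /sP[Ip Jp] ->]; split=> //; apply: IM.
  by rewrite big_map mulr_sumr; apply: eq_bigr => p _; rewrite mulrA.
- exists (x * y); last by rewrite mulf_neq0.
  exists [:: (x, y)]; last by rewrite big_seq1.
  by move=> p; rewrite inE => /eqP ->.
- exists (d * e); split; [exact: OFM | by rewrite mulf_neq0 |].
  move=> _ [s sP ->]; rewrite mulr_sumr big_seq.
  elim/big_rec: _ => [|p z /sP[Ip Jp] Oz]; first exact: OF0.
  by apply: OFD => //; rewrite mulrACA; apply: OFM; [apply: dI | apply: eJ].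
Qed.

Lemma OF_denominator (f : F) : exists d, [/\ OF d, d != 0 & OF (d * f)].
Proof.
have [q q0 qf] : exists2 q : {poly int}, q != 0 & root (map_poly intr q) f.
  have /polyOver1P[p pE] := minPolyOver 1%AS f.
  have p0 : p != 0.
    by rewrite -(map_poly_eq0 (in_alg F)) -pE monic_neq0 // monic_minPoly.
  have [q [a a0 pq]] := rat_poly_scale p.
  exists q; first by apply: contraNneq p0 => q0; rewrite pq q0 rmorph0 scaler0.
  have := root_minPoly 1%AS f; rewrite pE pq map_polyZ rootZ; last first.
    by rewrite fmorph_eq0 invr_eq0 intr_eq0.
  rewrite -map_poly_comp; congr (root _ f).
  by apply: eq_map_poly => z; exact: (rmorph_int (in_alg F)).
pose c := lead_coef q; have c0 : c != 0 by rewrite lead_coef_eq0.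
have cF0 : c%:~R != 0 :> F.
  by rewrite -(rmorph_int (in_alg F)) fmorph_eq0 intr_eq0.
exists c%:~R; split => //; first exact: (@mxpoly.integral_id _ _ intr c).
case En : (size q) => [|[|n]].
- by move/eqP: En; rewrite size_poly_eq0 (negPf q0).
- move: qf; rewrite /root horner_coef size_map_poly_id0; last exact: cF0.
  rewrite En big_ord1 expr0 mulr1 coef_map /= => qf.
  by case/negP: cF0; rewrite /c lead_coefE En.
exists ('X^(n.+1) + \poly_(i < n.+1) (q`_i * c ^+ (n - i))).
  by rewrite monicE lead_coefDl ?lead_coefXn // size_polyXn ltnS size_poly.
rewrite /root rmorphD /= map_polyXn hornerD hornerXn.
rewrite (horner_coef_wide _ (n := n.+1)); last first.
  by apply: leq_trans (size_poly _ _) (size_poly _ _).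
move: qf; rewrite /root horner_coef size_map_poly_id0; last exact: cF0.
rewrite En big_ord_recr /= => /eqP qf.
suff -> : (c%:~R * f) ^+ n.+1 + \sum_(i < n.+1)
    (map_poly intr (\poly_(i < n.+1) (q`_i * c ^+ (n - i))))`_i *
      (c%:~R * f) ^+ i =
  c%:~R ^+ n * (\sum_(i < n.+1) (map_poly intr q)`_i * f ^+ i
     + (map_poly intr q)`_n.+1 * f ^+ n.+1) :> F by rewrite qf mulr0.
rewrite mulrDr addrC mulr_sumr; congr (_ + _).
  apply: eq_bigr => i _; rewrite !coef_map coef_poly ltn_ord /= rmorphM rmorphXn /=.
  have -> : c%:~R ^+ n = c%:~R ^+ (n - i) * c%:~R ^+ i :> F.
    by rewrite -exprD subnK // -ltnS.
  by rewrite exprMn -!mulrA mulrCA; congr (_ * _); rewrite mulrCA.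
by rewrite coef_map /= exprMn exprSr -mulrA /c lead_coefE En.
Qed.

Lemma fractional_ideal_principal (f : F) :
  f != 0 -> fractional_ideal (principal_ideal f).
Proof.
move=> f0; split.
- by move=> _ _ [a Oa <-] [b Ob <-]; exists (a + b); rewrite ?mulrDr //; apply: OFD.
- by move=> a _ Oa [b Ob <-]; exists (a * b); [apply: OFM | rewrite mulrCA].
- by exists f => //; exists 1; [apply: OF1 | rewrite mulr1].
- have [d [Od d0 Odf]] := OF_denominator f; exists d; split => //.
  by move=> _ [a Oa <-]; rewrite mulrA; apply: OFM.
Qed.

Lemma ideal_mul_principal I (f : F) : fractional_ideal I ->
  ideal_mul I (principal_ideal f) = [set f * x | x in I].
Proof.
move=> fI; have [ID IM _ _] := fI; apply/seteqP; split => z /=.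
  case=> s sP ->; exists (\sum_(p <- s) f^-1 * (p.1 * p.2)).
  - rewrite big_seq; elim/big_rec: _ => [|p x /sP[Ip [a Oa <-]] Ix].
      exact: fractional_ideal0.
    apply: ID => //; have [->|f0] := eqVneq f 0.
      by rewrite invr0 mul0r; apply: fractional_ideal0.
    by rewrite mulrCA mulKf // mulrC; apply: IM.
  - rewrite mulr_sumr big_seq [RHS]big_seq; apply: eq_bigr => p /sP[_ [a _ <-]].
    have [->|f0] := eqVneq f 0; first by rewrite !mul0r mulr0.
    by rewrite mulVKf.
case=> x Ix <-; exists [:: (x, f)]; last by rewrite big_seq1 mulrC.
move=> p; rewrite inE => /eqP ->; split => //.
by exists 1; [exact: OF1 | rewrite mulr1].
Qed.

Lemma fractional_ideal_OF : fractional_ideal OF.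
Proof.
split; [exact: OFD | exact: OFM | by exists 1; [exact: OF1 | exact: oner_neq0] |].
by exists 1; split; [exact: OF1 | exact: oner_neq0 | move=> x; rewrite mul1r].
Qed.

Lemma ideal_norm_OF : ideal_norm OF = 1.
Proof.
rewrite /ideal_norm setIid /subgroup_index.
suff -> : [set [set a + b | b in OF] | a in OF] = [set OF].
  by rewrite fset_set1 cardfs1 divr1.
have aE a : OF a -> [set a + b | b in OF] = OF.
  move=> Oa; apply/seteqP; split => [_ [b Ob <-]|b Ob]; first exact: OFD.
  by exists (b - a); [apply: OFD => //; apply: OFN | rewrite addrC subrK].
apply/seteqP; split => [_ [a Oa <-]|_ ->]; first exact: aE.
by exists 0; [exact: OF0 | apply: aE; exact: OF0].
Qed.

End Ideals.

Section ArakelovDivisors.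
Variables (R : realType) (F : splittingFieldType rat).
Variables (sigma : gal_of {:F}) (iota : {rmorphism F -> R}).
Local Notation OF := (@ring_of_integers F).

Definition Phi (f : F) : 'rV[R]_3 := \row_i iota ((sigma ^+ i)%g f).

Definition vec_norm (u : 'rV[R]_3) : R := \prod_i u 0 i.

Record divisor := Divisor {
  div_ideal : set F;
  div_vec : 'rV[R]_3;
  div_idealP : fractional_ideal div_ideal;
  div_vecP : forall i, 0 < div_vec 0 i }.

HB.instance Definition _ := gen_eqMixin divisor.
HB.instance Definition _ := gen_choiceMixin divisor.

Lemma divisor_eq (D E : divisor) :
  div_ideal D = div_ideal E -> div_vec D = div_vec E -> D = E.
Proof.
case: D => I u fI pu; case: E => J v fJ pv /= EI Eu.
by subst J v; congr Divisor; exact: Prop_irrelevance.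
Qed.

Lemma div_add_vecP (D E : divisor) i :
  0 < (\row_j (div_vec D 0 j * div_vec E 0 j)) 0 i.
Proof. by rewrite mxE mulr_gt0 ?div_vecP. Qed.

Definition div_add (D E : divisor) : divisor :=
  Divisor (fractional_ideal_mul (div_idealP D) (div_idealP E))
          (div_add_vecP D E).

Definition degree (D : divisor) : R :=
  ln (vec_norm (div_vec D) * ratr (ideal_norm (div_ideal D))).

Lemma principal_vecP (f : F) : f != 0 ->
  forall i, 0 < (\row_j `|Phi f 0 j|) 0 i :> R.
Proof. by move=> f0 i; rewrite !mxE normr_gt0 !fmorph_eq0. Qed.

Lemma invf_neq0 (f : F) : f != 0 -> f^-1 != 0. Proof. by rewrite invr_eq0. Qed.

Definition principal_divisor (f : F) (f0 : f != 0) : divisor :=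
  Divisor (fractional_ideal_principal (invf_neq0 f0)) (principal_vecP f0).

Lemma trivial_vecP : forall i, 0 < (const_mx 1 : 'rV[R]_3) 0 i.
Proof. by move=> i; rewrite mxE ltr01. Qed.

Definition trivial_divisor : divisor :=
  Divisor (@fractional_ideal_OF F) trivial_vecP.

Definition normsq (u : 'rV[R]_3) (f : F) : R :=
  \sum_i u 0 i ^+ 2 * Phi f 0 i ^+ 2.

(* The terms are positive and the series converges, so that fine only casts a
   finite extended real to R. *)
Definition k0 (D : divisor) : R :=
  fine (\esum_(f in div_ideal D) (expR (- pi * normsq (div_vec D) f))%:E).

Definition h0 (D : divisor) : R := ln (k0 D).

Definition divisor0 := {D : divisor | degree D == 0}.

Definition pic_rel (D E : divisor0) : bool :=
  `[< exists f (f0 : f != 0),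
        val E = div_add (val D) (principal_divisor f0) >].

Lemma div_add_principalP (D E : divisor) f (f0 : f != 0) :
  E = div_add D (principal_divisor f0) <->
  div_ideal E = [set f^-1 * x | x in div_ideal D] /\
  div_vec E = \row_j (div_vec D 0 j * `|Phi f 0 j|).
Proof.
have IE := ideal_mul_principal f^-1 (div_idealP D).
have vE : \row_j (div_vec D 0 j * (\row_j `|Phi f 0 j|) 0 j) =
          \row_j (div_vec D 0 j * `|Phi f 0 j|) :> 'rV[R]_3.
  by apply/rowP => j; rewrite !mxE.
split=> [-> /=|[EI Eu]]; first by rewrite IE vE.
by apply: divisor_eq => /=; rewrite ?IE ?vE.
Qed.

Lemma PhiM f g i : Phi (f * g) 0 i = Phi f 0 i * Phi g 0 i.
Proof. by rewrite !mxE !rmorphM. Qed.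

Lemma Phi1 i : Phi 1 0 i = 1.
Proof. by rewrite !mxE !rmorph1. Qed.

Lemma pic_rel_refl : reflexive pic_rel.
Proof.
move=> D; apply/asboolP; exists 1, (oner_neq0 F); apply/div_add_principalP; split.
  by rewrite invr1 (eq_imagel (fun x _ => mul1r x)) image_id.
by apply/rowP => j; rewrite !mxE !rmorph1 normr1 mulr1.
Qed.

Lemma pic_rel_trans : transitive pic_rel.
Proof.
move=> E D G /asboolP[f [f0 /div_add_principalP[EI Ev]]].
move=> /asboolP[g [g0 /div_add_principalP[GI Gv]]].
apply/asboolP; exists (f * g), (mulf_neq0 f0 g0); apply/div_add_principalP; split.
  rewrite GI EI image_comp; apply: eq_imagel => x _ /=.
  by rewrite invfM mulrCA mulrA.
by rewrite Gv Ev; apply/rowP => j; rewrite !mxE !rmorphM normrM mulrA.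
Qed.

Lemma pic_rel_symW D E : pic_rel D E -> pic_rel E D.
Proof.
move=> /asboolP[f [f0 /div_add_principalP[EI Ev]]].
apply/asboolP; exists f^-1, (invf_neq0 f0); apply/div_add_principalP; split.
  rewrite EI image_comp invrK -[LHS]image_id; apply: eq_imagel => x _ /=.
  by rewrite mulVKf.
rewrite Ev; apply/rowP => j; rewrite !mxE -mulrA -normrM -!rmorphM mulfV //.
by rewrite !rmorph1 normr1 mulr1.
Qed.

Lemma pic_rel_sym : symmetric pic_rel.
Proof. by move=> D E; apply/idP/idP; exact: pic_rel_symW. Qed.

Canonical pic_equiv := EquivRel pic_rel pic_rel_refl pic_rel_sym pic_rel_trans.

Definition Pic0 := {eq_quot pic_equiv}.

Definition pic_class (D : divisor0) : Pic0 := \pi_{eq_quot pic_equiv} D.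

Lemma degree_trivial_divisor : degree trivial_divisor == 0.
Proof.
rewrite /degree /= ideal_norm_OF rmorph1 mulr1 /vec_norm big1 ?ln1 // => i _.
by rewrite mxE.
Qed.

Definition D0 : divisor0 := exist _ trivial_divisor degree_trivial_divisor.

Definition h0_Pic0 (c : Pic0) : R := h0 (val (repr c)).

Lemma pic_classP (D E : divisor0) :
  pic_class D = pic_class E <-> exists f (f0 : f != 0),
    val E = div_add (val D) (principal_divisor f0).
Proof.
split=> [/eqmodP/asboolP //|DE].
by apply/eqmodP/asboolP.
Qed.

Lemma h0_Pic0E (D : divisor0) : h0_Pic0 (pic_class D) = h0 (val D).
Proof.
rewrite /h0_Pic0; set E := repr _.
have /pic_classP[f [f0]] : pic_class D = pic_class E by rewrite /pic_class reprK.
move=> /div_add_principalP[EI Ev]; rewrite /h0 /k0 EI Ev; congr (ln (fine _)).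
rewrite (reindex_esum (div_ideal (val D)) _ (fun x => f^-1 * x)); last first.
  split; [by move=> x Dx; exists x | | by []].
  by move=> x y _ _; apply: mulfI; rewrite invr_eq0.
apply: eq_esum => x _; congr (expR (- pi * _))%:E; apply: eq_bigr => i _.
rewrite mxE exprMn real_normK ?num_real // -mulrA -exprMn -PhiM.
by rewrite mulVKf.
Qed.

End ArakelovDivisors.

(* Main.v *)
Require Import Defs.
From mathcomp Require Import all_boot all_order all_algebra all_fingroup.
From mathcomp Require Import all_solvable all_field.
From mathcomp Require Import finmap generic_quotient.
From mathcomp Require Import all_classical all_reals all_analysis.
From mathcomp Require Import ring lra zify.

(** Write [q = e^{-pi}], and [Q(f)] for the squared norm of [f] in the lattice
    attached to a divisor [(I, u)] of degree 0.  As [N(u) |N(f)| = [I : f O_F]],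
    the inequality of the means gives [Q(f)^3 >= 27 [I : f O_F]^2] for nonzero
    [f] in [I].  Hence all vectors have [Q >= 3], each half-open unit cube
    contains at most one of them, and the theta series converges with explicit
    tails.  If no nonzero vector has [Q < 4.74], these tails stay below the
    contribution [2 q^3] of [1] and [-1] for the trivial divisor.  Otherwise the
    ideal is generated by a shortest vector, and the divisor may be replaced by
    [(O_F, u)] with [1] shortest, of squared norm [lambda = 3 + mu]; [mu = 0] only
    for the trivial class.

    The integers other than rational ones have [Tr f^2 >= 5] (the discriminant
    of [f] is a nonzero square), so the inequality of the means, applied to
    [t lambda + Q(f)] and to [Q(f) + Q(sigma f)], keeps their vectors long.  Two
    short vectors congruent modulo [2 O_F] are equal up to sign, which leaves at
    most six pairs of them.  For [mu >= 0.02] the total is less than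
    [2 q^3 - 2 q^lambda].  For [mu <= 0.02] the series is compared with that of
    the trivial divisor orbit by orbit under the Galois group: the first order
    terms cancel in each orbit, and the second order terms are smaller than the
    loss in the terms [1] and [-1]. *)

Set Implicit Arguments.
Unset Strict Implicit.
Unset Printing Implicit Defensive.

Import Order.TTheory GRing.Theory Num.Theory.
Import numFieldNormedType.Exports.

Local Open Scope classical_set_scope.
Local Open Scope ring_scope.

(** * The exponential function and bounds on pi *)

(** Both sides agree at [mu = 0], so crude tail bounds cannot settle a neighbourhood of the trivial
    class: the gain there is only linear in [mu], and the loss must be shown to be linear as well,
    with a smaller constant. The squared weights differ among themselves by as much as a multiple of
    [sqrt mu], so their first order effect on a single vector may exceed any multiple of [mu].
    Summed over a Galois orbit it becomes [mu T2] with the favourable sign, and the second order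
    effect is of the size of [mu]. Away from the trivial class an element is controlled only by its
    norm, [T2] and the second symmetric function [T2d] of its squared conjugates. The parameter [t]
    balances them: [t = 0] sees only the norm, a larger [t] gives more weight to [T2] but costs
    [t lambda]. The choices [t = 3], [t = 2] and the trivial bound [Q f >= lambda] take over from
    one another as [mu] grows. In the tail estimates one tenth of the exponent is reserved for
    convergence and nine tenths provide smallness. *)

Section ExpPi.
Variable R : realType.
Implicit Types x y X : R.

Lemma series_exp_le x n : 0 <= x -> \sum_(i < n) x ^+ i / i`!%:R <= expR x.
Proof.
move=> x0; rewrite -(big_mkord xpredT (fun i => x ^+ i / i`!%:R)).
apply: (@nondecreasing_cvgn_le _ (series (exp_coeff x)) _ (is_cvg_series_exp_coeff x) n).
apply/nondecreasing_seqP => k; rewrite /series /= big_nat_recr //= lerDl.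
exact: exp_coeff_ge0.
Qed.

Lemma series_exp_split x n : \sum_(i < n.+2) x ^+ i / i`!%:R =
  1 + x + \sum_(i < n) x ^+ i.+2 / i.+2`!%:R.
Proof.
by rewrite !big_ord_recl /= expr0 divr1 expr1 divr1 addrA.
Qed.

Lemma expR_le_of_series x B :
  (forall n, 1 + x + \sum_(i < n) x ^+ i.+2 / i.+2`!%:R <= B) -> expR x <= B.
Proof.
move=> h; apply: limr_le; first exact: is_cvg_series_exp_coeff.
near=> n; have := h n.-2; rewrite -series_exp_split -subn2 -addn2 subnK; last first.
  by near: n; exact: nbhs_infty_ge.
by rewrite -(big_mkord xpredT (fun i => x ^+ i / i`!%:R)).
Unshelve. all: by end_near. Qed.

Lemma expR_ge_quad x : 0 <= x -> 1 + x + x ^+ 2 / 2 <= expR x.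
Proof.
move=> x0; have := series_exp_le 3 x0; rewrite series_exp_split big_ord1 /=.
by rewrite (_ : 2`! = 2)%N.
Qed.

(** The lower bound for [e^{-x}] is inverted, using [(1 - x + x^2/2) (1 + x + x^2/2) = 1 + x^4/4 >=
    1]. *)
Lemma expR_le_quad_le0 x : x <= 0 -> expR x <= 1 + x + x ^+ 2 / 2.
Proof.
move=> x0; have y0 : 0 <= - x by rewrite oppr_ge0.
have h := expR_ge_quad y0; have e := expRxMexpNx_1 x.
have p := expR_gt0 x; set a := expR x in e p *; set b := expR (- x) in e h.
have b0 : 1 <= b * (1 + x + x ^+ 2 / 2).
  have k : 0 < 1 + x + x ^+ 2 / 2 by nra.
  have : (1 + - x + (- x) ^+ 2 / 2) * (1 + x + x ^+ 2 / 2) <= b * (1 + x + x ^+ 2 / 2).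
    by rewrite ler_wpM2r // ltW.
  apply: le_trans; have : 0 <= x ^+ 4 by rewrite exprn_even_ge0.
  lra.
have : a * 1 <= a * (b * (1 + x + x ^+ 2 / 2)) by rewrite ler_wpM2l // ltW.
by rewrite mulr1 mulrA e mul1r.
Qed.

(* [(e^x - 1 - x) / x^2] is nondecreasing. *)
Lemma expR_le_quad_scaled x X : 0 <= x <= X -> 0 < X ->
  expR x <= 1 + x + (expR X - 1 - X) / X ^+ 2 * x ^+ 2.
Proof.
move=> /andP[x0 xX] X0; apply: expR_le_of_series => n; rewrite lerD2l.
have h : \sum_(i < n) X ^+ i.+2 / i.+2`!%:R <= expR X - 1 - X.
  by have := series_exp_le n.+2 (ltW X0); rewrite series_exp_split; lra.
apply: (@le_trans _ _ ((\sum_(i < n) X ^+ i.+2 / i.+2`!%:R) / X ^+ 2 * x ^+ 2)).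
  rewrite !mulr_suml; apply: ler_sum => i _.
  have -> : X ^+ i.+2 / (i.+2)`!%:R / X ^+ 2 * x ^+ 2 =
    (i.+2)`!%:R^-1 * (X ^+ i * x ^+ 2).
    have f0 : (i.+2)`!%:R != 0 :> R by rewrite pnatr_eq0 -lt0n fact_gt0.
    have X0' : X != 0 by rewrite gt_eqF.
    rewrite -[in X ^+ _]addn2 exprD; set m := (i.+2)`!%:R in f0 *; field.
    by rewrite X0' f0.
  rewrite mulrC.
  rewrite ler_wpM2l ?invr_ge0 ?ler0n // -addn2 exprD ler_wpM2r ?sqr_ge0 //.
  by rewrite lerXn2r // ?nnegrE // (le_trans x0).
by rewrite -!mulrA ler_wpM2r // mulr_ge0 ?sqr_ge0 // invr_ge0 sqr_ge0.
Qed.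

(** A single numerical check at [X] gives a quadratic bound on the whole half-line below [X]: the
    coefficient [1/2] suffices for [x <= 0], and the scaled remainder is monotone for [x >= 0]. *)
Lemma expR_le_quad x X k : x <= X -> 0 < X -> 1 / 2 <= k ->
  expR X <= 1 + X + k * X ^+ 2 -> expR x <= 1 + x + k * x ^+ 2.
Proof.
move=> xX X0 k2 eX; case: (leP x 0) => x0.
  by apply: le_trans (expR_le_quad_le0 x0) _; rewrite lerD2l; nra.
have := expR_le_quad_scaled (x := x) (X := X); rewrite (ltW x0) xX => /(_ isT X0).
move/le_trans; apply; rewrite lerD2l ler_wpM2r ?sqr_ge0 //.
by rewrite ler_pdivrMr ?exprn_gt0 //; lra.
Qed.

(** Since [(i+2)! >= 2 i!], the remainder of the series at [X] is at most [e^X X^2 / 2]. This serves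
    when [X] is not a numeral. *)
Lemma expR_le_quad_expR x X : x <= X -> 0 < X ->
  expR x <= 1 + x + expR X / 2 * x ^+ 2.
Proof.
move=> xX X0; apply: (expR_le_quad xX X0).
  by have := expR_ge1Dx X; lra.
apply: expR_le_of_series => n; rewrite lerD2l.
apply: (@le_trans _ _ ((\sum_(i < n) X ^+ i / i`!%:R) / 2 * X ^+ 2)); last first.
  by rewrite ler_wpM2r ?sqr_ge0 // ler_pM2r ?invr_gt0 // series_exp_le // ltW.
rewrite !mulr_suml; apply: ler_sum => i _.
rewrite -[i.+2]addn2 exprD -!mulrA ler_wpM2l ?exprn_ge0 ?(ltW X0) //.
rewrite mulrA -expr2 [leRHS]mulrA [leRHS]mulrC ler_wpM2l ?sqr_ge0 //.
rewrite -invfM lef_pV2 ?posrE ?mulr_gt0 ?ltr0n ?fact_gt0 //.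
rewrite addn2 !factS mulnA -natrM ler_nat mulnC leq_mul2r.
by apply/orP; right; case: (i : nat).
Qed.

Lemma cos_half x : cos x = 1 - 2 * sin (x / 2) ^+ 2.
Proof.
rewrite -[in LHS](_ : (x / 2) *+ 2 = x); last by rewrite -mulr_natr divfK.
by rewrite cos_mulr2n cos2sin2 -mulr_natr; ring.
Qed.

(** The mean value theorem is used twice: with [|cos| <= 1] it bounds [sin], the half-angle formula
    then gives [cos c >= 1 - c^2/2], and this is put back into [sin x = x cos c]. *)
Lemma sin_bounds x : 0 <= x -> x <= 1 -> x * (1 - x ^+ 2 / 2) <= sin x <= x.
Proof.
move=> x0 x1.
have mvt y : 0 <= y -> exists2 c, 0 <= c <= y & sin y = cos c * y.
  move=> y0; have [c] := MVT_segment y0 (fun z _ => is_derive_sin z)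
    (continuous_subspaceT (@continuous_sin R)).
  by rewrite in_itv /= => cy; rewrite sin0 !subr0 => e; exists c.
have sle y : 0 <= y -> y <= 1 -> - y <= sin y <= y.
  move=> y0 _; have [c _ ->] := mvt y y0.
  have := cos_le1 c; have := cos_geN1 c; nra.
have cge y : 0 <= y -> y <= 1 -> 1 - y ^+ 2 / 2 <= cos y.
  move=> y0 y1; rewrite cos_half.
  by have /andP[a b] := sle (y / 2) ltac:(lra) ltac:(lra); nra.
apply/andP; split; last by case/andP: (sle x x0 x1).
have [c /andP[c0 cx] ->] := mvt x x0.
rewrite mulrC ler_wpM2r //; have := cge c c0 ltac:(lra); nra.
Qed.

Lemma cos_double x y : y = 2 * x -> cos y = 2 * cos x ^+ 2 - 1.
Proof. by move=> ->; rewrite mulr_natl cos_mulr2n -mulr_natl. Qed.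

Lemma cos_double_ge x y a b : y = 2 * x -> 0 <= a -> a <= cos x ->
  b <= 2 * a ^+ 2 - 1 -> b <= cos y.
Proof. move=> /cos_double -> a0 ax; nra. Qed.

Lemma cos_double_le x y a b : y = 2 * x -> 0 <= cos x -> cos x <= a ->
  2 * a ^+ 2 - 1 <= b -> cos y <= b.
Proof. move=> /cos_double -> a0 ax; nra. Qed.

(** It suffices that [cos 1.565 > 0]. The angle is halved four times, to where [sin_bounds] is
    sharp, and the duplication formula leads back. *)
Lemma pi_ge : 313 / 100 <= pi :> R.
Proof.
have c0 : 1 - 479 / (100 * 1000) <= cos (1565 / 1000 / 16 : R).
  rewrite cos_half.
  by have /andP[] := @sin_bounds (1565 / 1000 / 16 / 2 : R) ltac:(lra) ltac:(lra); nra.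
have c1 : 1 - 1912 / (100 * 1000) <= cos (1565 / 1000 / 8 : R).
  by apply: cos_double_ge c0 _; lra.
have {c0} c2 : 9242 / 10000 <= cos (1565 / 1000 / 4 : R).
  by apply: cos_double_ge c1 _; lra.
have {c1} c3 : 7082 / 10000 <= cos (1565 / 1000 / 2 : R).
  by apply: cos_double_ge c2 _; lra.
have {c2} c4 : 3 / 1000 <= cos (1565 / 1000 : R).
  by apply: cos_double_ge c3 _; lra.
rewrite leNgt; apply/negP => hpi; have pg := @pi_ge2 R.
suff key (h : R) : 0 <= h -> h <= pi -> 0 < cos h -> h < pi / 2.
  have {c3 c4} c5 : 0 < cos (1565 / 1000 : R) by clear -c4; lra.
  have {c5} := key _ _ _ c5; clear key.
  by move=> /(_ ltac:(clear; lra) ltac:(clear -pg; lra)); clear -hpi; lra.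
move=> h0 hp c; have := @ltr_cos R h (pi / 2).
rewrite !in_itv /= cos_pihalf c h0 hp; clear -pg => k.
by rewrite -k //; lra.
Qed.

(** If [pi > 3.2], cosines are nonnegative up to [1.6], whereas the duplication formula makes
    [cos 1.6] negative. *)
Lemma pi_le : pi <= 32 / 10 :> R.
Proof.
rewrite leNgt; apply/negP => hpi.
have p x : 0 <= x <= 16 / 10 -> 0 <= cos x.
  by move=> hx; apply: cos_ge0_pihalf; clear -hx hpi; lra.
have c0 : cos (2 / 10 : R) <= 9802 / 10000.
  rewrite cos_half; have := @sin_bounds (2 / 10 / 2 : R).
  by move=> /(_ ltac:(clear; lra) ltac:(clear; lra)) /andP[]; clear; nra.
have {c0} c1 : cos (4 / 10 : R) <= 9216 / 10000.
  by apply: cos_double_le c0 _; [clear; lra | apply: p; clear; lra | clear; lra].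
have {c1} c2 : cos (8 / 10 : R) <= 699 / 1000.
  by apply: cos_double_le c1 _; [clear; lra | apply: p; clear; lra | clear; lra].
have {c2} c3 : cos (16 / 10 : R) <= - 1 / 100.
  by apply: cos_double_le c2 _; [clear; lra | apply: p; clear; lra | clear; lra].
have : 0 <= cos (16 / 10 : R) by apply: p; clear; lra.
clear p hpi; lra.
Qed.

End ExpPi.

(** * Integers of a cyclic cubic field *)

(** Here [e1], [e2], [e3] are the symmetric functions of the conjugates and [d] is a square root of
    the discriminant. The last two hypotheses (Cauchy-Schwarz and the inequality of the means) leave
    [T = 3] or [4], [e3 = 1] or [-1], [|e1| <= 3]. In these cases the discriminant is [5] or
    nonpositive, never a nonzero square. *)
Lemma cubic_T2_ge5 (e1 e2 e3 d : int) :
  d * d = e1 * e1 * e2 * e2 - 4 * e2 * e2 * e2 - 4 * e1 * e1 * e1 * e3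
          + 18 * e1 * e2 * e3 - 27 * e3 * e3 ->
  d != 0 -> e3 != 0 -> e1 * e1 <= 3 * (e1 * e1 - 2 * e2) ->
  27 * (e3 * e3) <= (e1 * e1 - 2 * e2) * (e1 * e1 - 2 * e2) * (e1 * e1 - 2 * e2) ->
  5 <= e1 * e1 - 2 * e2.
Proof.
move=> hd d0 e30 h1 h2; rewrite leNgt; apply/negP => h5.
have e31 : 1 <= e3 * e3 by clear -e30; nia.
have [T hT] : exists T, T = e1 * e1 - 2 * e2 by exists (e1 * e1 - 2 * e2).
rewrite -!hT in h1 h2 h5.
have T0 : 0 <= T by clear -h1; nia.
have T3 : 3 <= T.
  rewrite leNgt; apply/negP => T3; have : T = 0 \/ T = 1 \/ T = 2 by clear -T0 T3; lia.
  by case=> [E|[E|E]]; rewrite E in h2; clear -h2 e31; lia.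
have TT : T = 3 \/ T = 4 by clear -T3 h5; lia.
have e3E : e3 = 1 \/ e3 = -1.
  have : e3 * e3 <= 2 by clear -TT h2; case: TT h2 => ->; lia.
  by clear -e30; nia.
have d5 : d * d = 5 -> False.
  clear; have : d <= -3 \/ d = -2 \/ d = -1 \/ d = 0 \/ d = 1 \/ d = 2 \/ 3 <= d by lia.
  by case=> [?|[->|[->|[->|[->|[->|?]]]]]]; try lia; nia.
have dp : 0 < d * d by clear -d0; nia.
have e1b : (e1 <= 3) && (-3 <= e1) by clear -h1 h5; nia.
have e2E : 2 * e2 = e1 * e1 - T by clear -hT; lia.
have e1E : e1 = -3 \/ e1 = -2 \/ e1 = -1 \/ e1 = 0 \/ e1 = 1 \/ e1 = 2 \/ e1 = 3.
  by clear -e1b; lia.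
clear hT h1 h2 h5 T0 T3 e1b e30 e31 d0.
have fin : d * d = 5 \/ d * d <= 0 by
  case: TT e2E => -> e2E; case: e3E hd => -> hd;
  case: e1E e2E hd => [->|[->|[->|[->|[->|[->|->]]]]]] e2E hd; clear d5 dp;
  try (exfalso; clear hd; lia);
  first [ have E : e2 = 3 by clear hd; lia | have E : e2 = 2 by clear hd; lia
        | have E : e2 = 1 by clear hd; lia
        | have E : e2 = 0 by clear hd; lia | have E : e2 = -1 by clear hd; lia
        | have E : e2 = -2 by clear hd; lia]; rewrite {}E in hd; clear e2E; lia.
by case: fin => [/d5|] //; clear -dp; lia.
Qed.

Lemma AGM3 (R : realFieldType) (x y z : R) : 0 <= x -> 0 <= y -> 0 <= z ->
  27 * (x * y * z) <= (x + y + z) ^+ 3.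
Proof.
move=> x0 y0 z0.
have h a b c : 0 <= c -> 0 <= c * (a - b) ^+ 2 :> R by move=> c0; rewrite mulr_ge0 ?sqr_ge0.
have := h y z x x0; have := h x z y y0; have := h x y z z0.
have := h x y x x0; have := h x y y y0; have := h x z x x0; have := h x z z z0.
have := h y z y y0; have := h y z z z0; lra.
Qed.

Lemma sqr_sum3_le (R : realFieldType) (a b c : R) :
  (a + b + c) * (a + b + c) <= 3 * (a ^+ 2 + b ^+ 2 + c ^+ 2).
Proof.
have := sqr_ge0 (a - b); have := sqr_ge0 (b - c); have := sqr_ge0 (c - a); nra.
Qed.

Section CyclicCubic.
Variables (R : realType) (F : splittingFieldType rat).
Variables (sigma : gal_of {:F}) (iota : {rmorphism F -> R}).
Hypothesis galF : galois 1 {:F}.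
Hypothesis genF : 'Gal({:F} / 1)%g = <[sigma]>%g.
Hypothesis ordF : #|'Gal({:F} / 1)%g| = 3%N.
Local Notation OF := (@ring_of_integers F).
Local Notation s := (fun f : F => sigma f).
Implicit Types f g : F.

Lemma galois_expE n f : (sigma ^+ n)%g f = iter n sigma f.
Proof.
elim: n => [|n IH]; first by rewrite expg0 gal_id.
by rewrite expgSr galM ?memvf // IH.
Qed.

Lemma sigma3 f : sigma (sigma (sigma f)) = f.
Proof.
have := galois_expE 3 f; rewrite -ordF genF -orderE expg_order gal_id.
by rewrite orderE -genF ordF.
Qed.

Lemma sigma_fixed_rat f : sigma f = f -> exists r : rat, f = r%:A.
Proof.
move=> sf; have : f \in fixedField 'Gal({:F} / 1)%g.
  apply/fixedFieldP; first exact: memvf.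
  move=> x; rewrite genF => /cycleP[i ->]; rewrite galois_expE.
  by elim: i => //= i ->.
by rewrite (galois_fixedField galF) => /vlineP[k ->]; exists k.
Qed.

Lemma rat_OF_int (r : rat) : OF (r%:A : F) -> exists n : int, r = n%:~R.
Proof.
case=> p mp rp.
have rp' : root (map_poly (intr : int -> rat) p) r.
  rewrite -(fmorph_root (in_alg F)) -map_poly_comp.
  move: rp; congr (root _ _); apply: eq_map_poly => z /=.
  by rewrite scaler_int.
(* The root is moved to [algC], where a rational algebraic integer is known to be an integer. *)
have rC : root (map_poly (intr : int -> algC) p) (ratr r).
  rewrite -(fmorph_root (ratr : rat -> algC)) -map_poly_comp in rp'.
  move: rp'; congr (root _ _); apply: eq_map_poly => z /=.
  by rewrite rmorph_int.
have : ratr r \in (Num.int : {pred algC}).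
  apply: Cint_rat_Aint; first by apply/CratP; exists r.
  apply: (root_monic_Aint rC); first exact: monic_map.
  by apply/polyOverP => i; rewrite coef_map /= rpred_int.
move=> /intrP[n rn]; exists n; apply: (fmorph_inj (ratr : {rmorphism rat -> algC})).
by rewrite /= rn rmorph_int.
Qed.

Lemma OF_sigma f : OF f -> OF (sigma f).
Proof.
case=> p mp rp; exists p => //.
rewrite -(fmorph_root sigma) -map_poly_comp in rp.
move: rp; congr (root _ _); apply: eq_map_poly => z /=.
by rewrite rmorph_int.
Qed.

Lemma OF_int (n : int) : OF (n%:~R : F).
Proof. exact: (@mxpoly.integral_id _ _ intr n). Qed.

Lemma OFB f g : OF f -> OF g -> OF (f - g).
Proof. by move=> Of Og; apply: OFD => //; apply: OFN. Qed.

Lemma OF_fixed_int f : OF f -> sigma f = f -> exists n : int, f = n%:~R.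
Proof.
move=> Of /sigma_fixed_rat[r fr]; rewrite fr in Of *.
have [n ->] := rat_OF_int Of.
by exists n; rewrite scaler_int.
Qed.


Definition conj3 f : R * R * R := (iota f, iota (sigma f), iota (sigma (sigma f))).

Lemma iota_fixedP f : sigma f != f -> [/\ iota f != iota (sigma f),
  iota (sigma f) != iota (sigma (sigma f)) & iota (sigma (sigma f)) != iota f].
Proof.
move=> sf; split; rewrite (inj_eq (fmorph_inj iota)).
- by rewrite eq_sym.
- by rewrite eq_sym (inj_eq (fmorph_inj sigma)).
- apply: contra sf => /eqP sf.
  by have := sigma3 f; rewrite sf => ->.
Qed.

Lemma OF_fixed_iota f : OF f -> sigma f = f -> exists n : int, iota f = n%:~R.
Proof. by move=> Of /(OF_fixed_int Of)[n ->]; exists n; rewrite rmorph_int. Qed.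

(** All four expressions are fixed by [sigma]. For the product of differences this uses that [sigma]
    permutes the conjugates cyclically, hence evenly; this is where the cyclic group makes the
    discriminant a square. *)
Lemma OF_symmetric f : OF f -> let: (a, b, c) := conj3 f in
  exists e1 e2 e3 d : int,
  [/\ a + b + c = e1%:~R, a * b + b * c + c * a = e2%:~R, a * b * c = e3%:~R
    & (a - b) * (b - c) * (c - a) = d%:~R].
Proof.
move=> Of; rewrite /conj3; have Of1 := OF_sigma Of; have Of2 := OF_sigma Of1.
have [||e1 h1] := @OF_fixed_iota (f + sigma f + sigma (sigma f)).
- by do !apply: OFD.
- by rewrite !rmorphD /= sigma3; ring.
have [||e2 h2] := @OF_fixed_iota (f * sigma f + sigma f * sigma (sigma f) + sigma (sigma f) * f).
- by do !apply: OFD; apply: OFM.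
- by rewrite !(rmorphD, rmorphM) /= sigma3; ring.
have [||e3 h3] := @OF_fixed_iota (f * sigma f * sigma (sigma f)).
- by do !apply: OFM.
- by rewrite !rmorphM /= sigma3; ring.
have [||d hd] := @OF_fixed_iota ((f - sigma f) * (sigma f - sigma (sigma f)) * (sigma (sigma f) - f)).
- by do !apply: OFM; apply: OFB.
- by rewrite !(rmorphB, rmorphM) /= !sigma3; ring.
exists e1, e2, e3, d; split.
- by rewrite -h1 !rmorphD.
- by rewrite -h2 !(rmorphD, rmorphM).
- by rewrite -h3 !rmorphM.
- by rewrite -hd !(rmorphM, rmorphB).
Qed.

Definition sumsq f : R := iota f ^+ 2 + iota (sigma f) ^+ 2 + iota (sigma (sigma f)) ^+ 2.

Local Notation T2 := sumsq.

Lemma T2_int f : OF f -> exists n : int, T2 f = n%:~R.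
Proof.
move=> /OF_symmetric[e1 [e2 [e3 [d [h1 h2 _ _]]]]]; exists (e1 * e1 - 2 * e2).
by rewrite rmorphB !rmorphM /= -h1 -h2 /sumsq; ring.
Qed.

Lemma T2_ge5 f : OF f -> sigma f != f -> 5 <= T2 f.
Proof.
move=> Of sf; have [e1 [e2 [e3 [d [h1 h2 h3 hd]]]]] := OF_symmetric Of.
have [ab bc ca] := iota_fixedP sf.
have f0 : f != 0 by apply: contraNneq sf => ->; rewrite rmorph0.
have a0 : iota f != 0 by rewrite fmorph_eq0.
have b0 : iota (sigma f) != 0 by rewrite !fmorph_eq0.
have c0 : iota (sigma (sigma f)) != 0 by rewrite !fmorph_eq0.
have TE : T2 f = (e1 * e1 - 2 * e2)%:~R.
  by rewrite rmorphB !rmorphM /= -h1 -h2 /sumsq; ring.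
rewrite TE -[5]/(5%:~R) ler_int.
move: TE h1 h2 h3 hd a0 b0 c0 ab bc ca; rewrite /sumsq.
set a := iota f; set b := iota (sigma f); set c := iota (sigma (sigma f)).
move=> TE h1 h2 h3 hd a0 b0 c0 ab bc ca.
apply: (@cubic_T2_ge5 _ _ e3 d).
- apply: (@intr_inj R); rewrite rmorphB rmorphD !rmorphB !rmorphM /= -h1 -h2 -h3 -hd; ring.
- by rewrite -(@intr_eq0 R) -hd !mulf_neq0 // subr_eq0.
- by rewrite -(@intr_eq0 R) -h3 !mulf_neq0.
- rewrite -(@ler_int R) [X in _ <= X]rmorphM /= -TE !rmorphM /= -h1.
  exact: sqr_sum3_le.
- rewrite -(@ler_int R) !rmorphM /= -TE -h3.
  have := AGM3 (sqr_ge0 a) (sqr_ge0 b) (sqr_ge0 c); rewrite !expr2 !exprS expr0; lra.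
Qed.

(** The second symmetric function of the squared conjugates, written as [T2] of an integer so that
    the bound [5] carries over. *)
Definition sumsq_dual f : R := T2 (sigma f * sigma (sigma f)).
Definition sqnorm f : R := (iota f * iota (sigma f) * iota (sigma (sigma f))) ^+ 2.

Local Notation T2d := sumsq_dual.
Local Notation N2 := sqnorm.

Lemma T2dE f : T2d f = (iota f * iota (sigma f)) ^+ 2 +
  (iota (sigma f) * iota (sigma (sigma f))) ^+ 2 + (iota (sigma (sigma f)) * iota f) ^+ 2.
Proof. by rewrite /sumsq_dual /sumsq !rmorphM /= !sigma3; ring. Qed.

Lemma T2d_ge5 f : OF f -> sigma f != f -> 5 <= T2d f.
Proof.
move=> Of sf; apply: T2_ge5; first by apply: OFM; do ?apply: OF_sigma.
have f0 : f != 0 by apply: contraNneq sf => ->; rewrite rmorph0.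
apply: contraNneq sf; rewrite rmorphM /= sigma3 mulrC => e.
have ss0 : sigma (sigma f) != 0 by rewrite !fmorph_eq0.
by rewrite -(mulIf ss0 e).
Qed.

(** A parity argument: [e1^2 = 5 + 2 e2] and [|e1| <= 3] force [e2 = 2] or [-2], so
    [T2d f = e2^2 - 2 e1 e3] is even and cannot be [5]. *)
Lemma T2d_ge6 f : OF f -> sigma f != f -> T2 f < 6 -> 6 <= T2d f.
Proof.
move=> Of sf T6; have T5 := T2_ge5 Of sf; have Td5 := T2d_ge5 Of sf.
have [e1 [e2 [e3 [d [h1 h2 h3 hd]]]]] := OF_symmetric Of.
have TE : T2 f = (e1 * e1 - 2 * e2)%:~R.
  by rewrite rmorphB !rmorphM /= -h1 -h2 /sumsq; ring.
have TdE : T2d f = (e2 * e2 - 2 * e1 * e3)%:~R.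
  by rewrite rmorphB !rmorphM /= -h1 -h2 -h3 T2dE; ring.
have hb : (e1 * e1 <= 3 * (e1 * e1 - 2 * e2)).
  rewrite -(@ler_int R) [X in _ <= X]rmorphM /= -TE !rmorphM /= -h1 /sumsq.
  set a := iota f; set b := iota (sigma f); set c := iota (sigma (sigma f)).
  exact: sqr_sum3_le.
move: T6 T5 Td5; rewrite TE TdE -[6]/(6%:~R) -[5]/(5%:~R) !ler_int !ltr_int.
clear -hb => T6 T5 Td5.
have e12 : e1 * e1 = 5 + 2 * e2 by clear -T6 T5; lia.
have eb : -3 <= e1 <= 3 by clear -hb e12 T6; nia.
have [k e2k] : exists k, e2 = 2 * k.
  have : e1 = -3 \/ e1 = -2 \/ e1 = -1 \/ e1 = 0 \/ e1 = 1 \/ e1 = 2 \/ e1 = 3.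
    by clear -eb; lia.
  clear -e12; case=> [E|[E|[E|[E|[E|[E|E]]]]]]; rewrite E in e12;
    (try (exfalso; lia)); first [by exists 1; lia | by exists (-1); lia].
by rewrite e2k in Td5 *; clear -Td5; lia.
Qed.

Lemma N2_ge1 f : OF f -> f != 0 -> exists2 n : int, 1 <= n & N2 f = (n * n)%:~R.
Proof.
move=> Of f0; have [_ [_ [e3 [_ [_ _ h3 _]]]]] := OF_symmetric Of.
have e30 : e3 != 0 by rewrite -(@intr_eq0 R) -h3 !mulf_neq0 // !fmorph_eq0.
exists `|e3|; first by clear -e30; lia.
by rewrite -expr2 real_normK ?num_real // /sqnorm h3 rmorphXn.
Qed.

End CyclicCubic.

(** * An integral basis [1, al, sigma al] *)

(** On differences of consecutive conjugates [sigma] acts as [(p, q) -> (q, - p - q)], which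
    preserves the form. The point [(p, q)] and its image span a hexagonal lattice, and rounding both
    coordinates leaves at most [3/4] of the form at [(p, q)], as in Euclidean division of Eisenstein
    integers. *)
Lemma plane_round (R : realType) (p q v w : R) : 0 < p ^+ 2 + p * q + q ^+ 2 ->
  exists x y : int, let v' := v - x%:~R * p - y%:~R * q in
    let w' := w - x%:~R * q + y%:~R * (p + q) in
    v' ^+ 2 + v' * w' + w' ^+ 2 < p ^+ 2 + p * q + q ^+ 2.
Proof.
set m := p ^+ 2 + p * q + q ^+ 2 => m0.
have round (z : R) : exists n : int, - (1 / 2) <= z - n%:~R <= 1 / 2.
  exists (Num.floor (z + 1 / 2)); have := floor_itv (z + 1 / 2).
  rewrite intrD => /andP[]; set n := _%:~R; lra.
pose xs := (v * (p + q) + w * q) / m; pose ys := (v * q - w * p) / m.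
have hv : v = xs * p + ys * q by rewrite /xs /ys /m; field; rewrite gt_eqF.
have hw : w = xs * q - ys * (p + q) by rewrite /xs /ys /m; field; rewrite gt_eqF.
have [x hx] := round xs; have [y hy] := round ys; exists x, y => /=.
have -> : v - x%:~R * p - y%:~R * q = (xs - x%:~R) * p + (ys - y%:~R) * q.
  by rewrite {1}hv; ring.
have -> : w - x%:~R * q + y%:~R * (p + q) = (xs - x%:~R) * q - (ys - y%:~R) * (p + q).
  by rewrite {1}hw; ring.
move: hx hy; set xi := xs - _; set et := ys - _ => hx hy.
have -> : (xi * p + et * q) ^+ 2 + (xi * p + et * q) * (xi * q - et * (p + q)) +
   (xi * q - et * (p + q)) ^+ 2 = m * (xi ^+ 2 - xi * et + et ^+ 2).
  by rewrite /m; ring.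
rewrite -[ltRHS]mulr1 ltr_pM2l //.
clear -hx hy; nra.
Qed.

Lemma planar_form_ge0 (R : realType) (p q : R) : 0 <= p ^+ 2 + p * q + q ^+ 2.
Proof. have := sqr_ge0 (p / 2 + q); have := sqr_ge0 p; nra. Qed.

Section Basis.
Variables (R : realType) (F : splittingFieldType rat).
Variables (sigma : gal_of {:F}) (iota : {rmorphism F -> R}).
Hypothesis galF : galois 1 {:F}.
Hypothesis genF : 'Gal({:F} / 1)%g = <[sigma]>%g.
Hypothesis ordF : #|'Gal({:F} / 1)%g| = 3%N.
Local Notation OF := (@ring_of_integers F).
Implicit Types f g : F.

(** This is [3/2] times the squared length of the projection of [f] orthogonal to [(1, 1, 1)], so it
    ignores rational summands. *)
Definition planar f : R := (iota f - iota (sigma f)) ^+ 2 +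
  (iota f - iota (sigma f)) * (iota (sigma f) - iota (sigma (sigma f))) +
  (iota (sigma f) - iota (sigma (sigma f))) ^+ 2.

Lemma planar_nat f : OF f -> exists n : nat, planar f = n%:R.
Proof.
move=> /(OF_symmetric iota galF genF ordF)[e1 [e2 [e3 [d [h1 h2 _ _]]]]].
have E : planar f = (e1 * e1 - 3 * e2)%:~R.
  by rewrite rmorphB !rmorphM /= -h1 -h2 /planar; ring.
have p0 : 0 <= planar f by exact: planar_form_ge0.
exists (absz (e1 * e1 - 3 * e2)%R).
have : (0 <= e1 * e1 - 3 * e2)%R by rewrite -(@ler_int R) -E.
by rewrite E; case: (e1 * e1 - _).
Qed.

Lemma planar_gt0 f : sigma f != f -> 0 < planar f.
Proof.
move=> /(iota_fixedP iota genF ordF)[ab _ _]; rewrite /planar.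
have : iota f - iota (sigma f) != 0 by rewrite subr_eq0.
set p := iota f - _; set q := _ - _ => p0.
have p2 : 0 < p ^+ 2 by rewrite exprn_even_gt0.
have := sqr_ge0 (p / 2 + q); nra.
Qed.

Lemma exists_OF_nonfixed : exists2 f, OF f & sigma f != f.
Proof.
have [f sf] : exists f, sigma f != f.
  apply: contrapT => h; have s1 : sigma = 1%g.
    apply/eqP/gal_eqP => x _; rewrite gal_id; apply/eqP; apply: contrapT => k.
    by apply: h; exists x; apply/negP.
  by move: ordF; rewrite genF s1 cycle1 cards1.
have [d [Od d0 Odf]] := OF_denominator f.
have [sd|sd] := eqVneq (sigma d) d; last by exists d.
exists (d * f) => //; rewrite rmorphM /= sd.
by apply: contra sf => /eqP/(mulfI d0)/eqP.
Qed.

(** Take [al] with least [planar] among the irrational integers. Reducing [f] by [al] and [sigma al]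
    goes below this minimum, so the remainder is a rational integer. *)
Lemma OF_basis_exists : exists al, [/\ OF al, sigma al != al &
  forall f, OF f -> exists n x y : int, f = n%:~R + x%:~R * al + y%:~R * sigma al].
Proof.
pose P (n : nat) := `[< exists f, [/\ OF f, sigma f != f & planar f = n%:R] >].
have exP : exists n, P n.
  have [f Of sf] := exists_OF_nonfixed; have [n fn] := planar_nat Of.
  by exists n; apply/asboolP; exists f.
case: (ex_minnP exP) => m /asboolP[al [Oal sal alm]] mmin.
exists al; split => // f Of.
have [x [y]] := @plane_round R _ _ (iota f - iota (sigma f))
  (iota (sigma f) - iota (sigma (sigma f))) (planar_gt0 sal).
rewrite /= -/(planar al) alm => hxy.
pose g := f - x%:~R * al - y%:~R * sigma al.
have Og : OF g.
  by do 2! (apply: OFB; last by apply: OFM; [exact: OF_int | do ?apply: OF_sigma]).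
have gm : planar g < m%:R.
  rewrite (le_lt_trans _ hxy) // /planar /g !(rmorphB, rmorphM) /= !rmorph_int.
  rewrite !(sigma3 genF ordF); rewrite le_eqVlt; apply/orP; left; apply/eqP; ring.
have sg : sigma g = g.
  apply/eqP; apply: contraTT isT => sg; have [k gk] := planar_nat Og.
  have /mmin : P k by apply/asboolP; exists g.
  by rewrite leqNgt -(ltr_nat R) -gk gm.
have [n gn] := OF_fixed_int galF genF Og sg.
by exists n, x, y; rewrite -gn /g; ring.
Qed.

Lemma planar_comb al (n x y : int) : planar (n%:~R + x%:~R * al + y%:~R * sigma al) =
  planar al * (x%:~R ^+ 2 - x%:~R * y%:~R + y%:~R ^+ 2).
Proof.
by rewrite /planar !(rmorphD, rmorphM) /= !rmorph_int !(sigma3 genF ordF); ring.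
Qed.

Lemma integral_basis_free al (n x y : int) : sigma al != al ->
  n%:~R + x%:~R * al + y%:~R * sigma al = 0 -> [/\ n = 0, x = 0 & y = 0].
Proof.
move=> sal e; have := planar_comb al n x y; rewrite e /planar !rmorph0 !subr0 expr0n.
rewrite /= mulr0 !addr0 => /esym/eqP; rewrite mulf_eq0 (gt_eqF (planar_gt0 sal)) /=.
rewrite -!rmorphXn -rmorphM -rmorphB -rmorphD /= intr_eq0 => /eqP h.
have [x0 y0] : x = 0 /\ y = 0 by clear -h; rewrite !expr2 in h; split; nia.
move: e; rewrite x0 y0 !mul0r !addr0 => /eqP.
by rewrite -(rmorph_int (in_alg F)) fmorph_eq0 intr_eq0 => /eqP.
Qed.

Lemma OF_coordinates : exists (al : F) (k : F -> int * int * int),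
  [/\ OF al, sigma al != al,
      forall n x y : int, OF (n%:~R + x%:~R * al + y%:~R * sigma al),
      forall f, OF f -> f = (k f).1.1%:~R + (k f).1.2%:~R * al + (k f).2%:~R * sigma al
    & forall n x y : int, k (n%:~R + x%:~R * al + y%:~R * sigma al) = (n, x, y)].
Proof.
have [al [Oal sal bas]] := OF_basis_exists.
have basO n x y : OF (n%:~R + x%:~R * al + y%:~R * sigma al).
  by apply: OFD; [apply: OFD|]; last (apply: OFM; [|exact: OF_sigma]);
    try (apply: OFM => //); exact: OF_int.
have [c cP] : exists c : F -> int * int * int, forall f, OF f ->
    f = (c f).1.1%:~R + (c f).1.2%:~R * al + (c f).2%:~R * sigma al.
  have /choice[c cP] : forall f, exists t : int * int * int, OF f ->
      f = t.1.1%:~R + t.1.2%:~R * al + t.2%:~R * sigma al.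
    move=> f; case: (pselect (OF f)) => Of; last by exists (0, 0, 0).
    by have [n [x [y e]]] := bas f Of; exists (n, x, y).
  by exists c.
exists al, c; split=> // n x y.
have := cP _ (basO n x y); case: (c _) => -[n' x'] y' /= e.
have /(integral_basis_free sal)[] :
   (n - n')%:~R + (x - x')%:~R * al + (y - y')%:~R * sigma al = 0.
  transitivity (n%:~R + x%:~R * al + y%:~R * sigma al -
    (n'%:~R + x'%:~R * al + y'%:~R * sigma al)); first by rewrite !intrB; ring.
  by rewrite e subrr.
by move=> /eqP; rewrite subr_eq0 => /eqP-> /eqP; rewrite subr_eq0 => /eqP -> /eqP;
   rewrite subr_eq0 => /eqP ->.
Qed.

End Basis.

(** * Indices of subgroups and norms of ideals *)

Section Index.
Variable F : fieldExtType rat.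
Implicit Types A B C : set F.

Definition subgroup A := A 0 /\ forall x y, A x -> A y -> A (x - y).

(** The index is carried by a type of labels for the cosets: labels can be paired, restricted and
    transported along bijections. Only the values of [phi] on [A] matter. *)
Definition has_index (T : finType) A B := exists phi : F -> T,
  (forall t, exists2 a, A a & phi a = t) /\
  (forall a b, A a -> A b -> (phi a = phi b <-> B (a - b))).

Lemma subgroupN A x : subgroup A -> A x -> A (- x).
Proof. by case=> A0 AB Ax; rewrite -sub0r; exact: AB. Qed.

Lemma subgroupD A x y : subgroup A -> A x -> A y -> A (x + y).
Proof. by move=> sA Ax Ay; rewrite -[y]opprK; apply: sA.2 => //; exact: subgroupN. Qed.

Lemma has_index_card (T : finType) A B : subgroup B -> has_index T A B ->
  subgroup_index A B = #|T|.
Proof.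
move=> sB [phi [phis phiB]]; rewrite /subgroup_index.
have [r rP] := choice (fun t => let: ex_intro2 a Aa pa := phis t in
  ex_intro (fun a => A a /\ phi a = t) a (conj Aa pa)).
pose coset a := [set a + b | b in B] : set F.
have cosetP a b : A a -> A b -> coset a = coset b <-> phi a = phi b.
  move=> Aa Ab; rewrite phiB //; split => [e|Bab].
    have : coset b a by rewrite -e; exists 0; [exact: sB.1 | rewrite addr0].
    by case=> c Bc <-; rewrite addrAC subrr add0r.
  apply/seteqP; split => _ [c Bc <-].
    by exists (a - b + c); [exact: subgroupD | ring].
  exists (b - a + c); last by ring.
  by apply: subgroupD => //; rewrite -opprB; exact: subgroupN.
have -> : [set [set a + b | b in B] | a in A] = [set coset (r t) | t in [set: T]].
  apply/seteqP; split => [_ [a Aa <-]|_ [t _ <-]].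
    exists (phi a) => //; apply/cosetP => //; first exact: (rP _).1.
    exact: (rP _).2.
  by exists (r t) => //; exact: (rP t).1.
have cinj : injective (fun t => coset (r t)).
  by move=> t u /cosetP; rewrite (rP t).2 (rP u).2; apply; apply: (rP _).1.
have fin : finite_set [set coset (r t) | t in [set: T]].
  by apply: finite_image; exact: finite_finset.
have -> : fset_set [set coset (r t) | t in [set: T]] = [fset coset (r t) | t : T]%fset.
  apply/fsetP => X; rewrite in_fset_set //; apply/idP/idP.
    by rewrite inE => -[t _ <-]; apply/imfsetP; exists t.
  by case/imfsetP => t _ ->; rewrite inE; exists t.
by rewrite card_imfset //= -cardE.
Qed.

Lemma has_index_mul (T U : finType) A B C : subgroup A -> subgroup B -> subgroup C ->
  C `<=` B -> B `<=` A -> has_index T A B -> has_index U B C ->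
  has_index (T * U)%type A C.
Proof.
move=> sA sB sC CB BA [phi [phis phiB]] [psi [psis psiC]].
have [r rP] := choice (fun t => let: ex_intro2 a Aa pa := phis t in
  ex_intro (fun a => A a /\ phi a = t) a (conj Aa pa)).
have rA t : A (r t) := (rP t).1.
have rB a : A a -> B (a - r (phi a)).
  by move=> Aa; rewrite -phiB // (rP _).2.
exists (fun a => (phi a, psi (a - r (phi a)))); split.
  move=> [t u]; have [b Bb psib] := psis u.
  have e : phi (r t + b) = t.
    rewrite -[RHS](rP t).2; apply/phiB => //; first by apply: subgroupD => //; exact: BA.
    by rewrite addrAC subrr add0r.
  exists (r t + b); first by apply: subgroupD => //; exact: BA.
  by rewrite e addrAC subrr add0r psib.
move=> a b Aa Ab; split=> [[e epsi]|Cab].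
  have : C ((a - r (phi a)) - (b - r (phi b))) by apply/psiC => //; exact: rB.
  by rewrite e opprB addrA subrK.
have e : phi a = phi b by apply/phiB => //; exact: CB.
congr (_, _) => //; apply/psiC; rewrite ?e.
- by rewrite -e; exact: rB.
- exact: rB.
- by rewrite opprB addrA subrK.
Qed.

Lemma has_index_split (T : finType) A B C :
  subgroup A -> subgroup B -> subgroup C ->
  C `<=` B -> B `<=` A -> has_index T A C ->
  exists U V : finType, [/\ has_index U A B, has_index V B C & #|T| = (#|U| * #|V|)%N].
Proof.
move=> sA sB sC CB BA iAC; have [phi [phis phiC]] := iAC.
(* The set of labels modulo [C] met by the coset [a + B] serves as the label of [a] modulo [B]. *)
pose g a := finset.finset (fun t : T => `[< exists2 a', A a' /\ B (a' - a) & phi a' = t >]).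
have gP a b : A a -> A b -> (g a = g b <-> B (a - b)).
  move=> Aa Ab; split=> [e|Bab].
    have : phi a \in g b.
      rewrite -e inE; apply/asboolP; exists a => //; split => //.
      by rewrite subrr; exact: sB.1.
    rewrite inE => /asboolP[c [Ac Bc] ec].
    have : B (c - a) by apply: CB; apply/phiC.
    by move=> /(sB.2 _ _ Bc); rewrite opprB addrC addrA subrK.
  apply/setP => t; rewrite !inE; apply/asboolP/asboolP => -[c [Ac Bc] <-]; exists c => //; split=> //.
    by have := subgroupD sB Bc Bab; rewrite addrA subrK.
  by have := sB.2 _ _ Bc Bab; rewrite opprB addrA subrK.
pose U : finType := {X : {set T} | `[< exists2 a, A a & X = g a >]}.
pose V : finType := {t : T | `[< exists2 b, B b & phi b = t >]}.
have u0P : `[< exists2 a, A a & g 0 = g a >] by apply/asboolP; exists 0 => //; exact: sA.1.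
have v0P : `[< exists2 b, B b & phi b = phi 0 >] by apply/asboolP; exists 0 => //; exact: sB.1.
pose u0 : U := Sub (g 0) u0P; pose v0 : V := Sub (phi 0) v0P.
have gU a : A a -> val (insubd u0 (g a)) = g a.
  by move=> Aa; rewrite val_insubd ifT //; apply/asboolP; exists a.
have pV b : B b -> val (insubd v0 (phi b)) = phi b.
  by move=> Bb; rewrite val_insubd ifT //; apply/asboolP; exists b.
have iAB : has_index U A B.
  exists (fun a => insubd u0 (g a)); split.
    move=> [X XP]; have /asboolP[a Aa ea] := XP; exists a => //.
    by apply: val_inj; rewrite gU //= ea.
  move=> a b Aa Ab; rewrite -gP //; split => [|-> //].
  by move=> /(congr1 val); rewrite !gU.
have iBC : has_index V B C.
  exists (fun b => insubd v0 (phi b)); split.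
    move=> [t tP]; have /asboolP[b Bb eb] := tP; exists b => //.
    by apply: val_inj; rewrite pV //= eb.
  move=> a b Ba Bb; rewrite -phiC; try exact: BA.
  split => [|-> //].
  by move=> /(congr1 val); rewrite !pV.
exists U, V; split => //.
rewrite -card_prod -(has_index_card sC iAC).
by apply: has_index_card => //; exact: has_index_mul iAB iBC.
Qed.

Lemma has_index_scale (T : finType) A B f : f != 0 -> has_index T A B ->
  has_index T [set f * a | a in A] [set f * b | b in B].
Proof.
move=> f0 [phi [phis phiB]]; exists (fun x => phi (f^-1 * x)); split.
  by move=> t; have [a Aa <-] := phis t; exists (f * a); [exists a | rewrite mulKf].
move=> _ _ [a Aa <-] [b Ab <-]; rewrite !mulKf // phiB // -mulrBr.
by split=> [Bab|[c Bc /(mulfI f0) <- //]]; exists (a - b).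
Qed.

Lemma has_index_uniq (T U : finType) A B : subgroup B ->
  has_index T A B -> has_index U A B -> #|T| = #|U|.
Proof. by move=> sB /(has_index_card sB) <- /(has_index_card sB) <-. Qed.

End Index.

Definition int_mod (m : nat) (k : int) : 'I_m.+1 := inord (absz (k %% m.+1)%Z).

Lemma int_modP m k l : int_mod m k = int_mod m l <-> exists z : int, k - l = m.+1%:Z * z.
Proof.
have bnd a : (absz (a %% m.+1)%Z <= m)%N by lia.
split=> [/(congr1 val)/=|[z e]].
  rewrite /int_mod !inordK ?ltnS ?bnd // => e.
  have := divz_eq k m.+1; have := divz_eq l m.+1 => hl hk.
  exists ((k %/ m.+1)%Z - (l %/ m.+1)%Z); rewrite {1}hk {1}hl.
  have -> : (k %% m.+1)%Z = (l %% m.+1)%Z by lia.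
  ring.
rewrite /int_mod; congr inord; congr absz.
have -> : k = z * m.+1 + l by rewrite -[LHS](subrK l) e mulrC.
by rewrite modzMDl.
Qed.

Lemma int_mod_surj m (i : 'I_m.+1) : int_mod m i = i.
Proof.
by apply: val_inj; rewrite /int_mod /= modz_nat absz_nat modn_small ?inordK.
Qed.

Section IdealNorm.
Variables (R : realType) (F : splittingFieldType rat).
Variables (sigma : gal_of {:F}) (iota : {rmorphism F -> R}).
Hypothesis galF : galois 1 {:F}.
Hypothesis genF : 'Gal({:F} / 1)%g = <[sigma]>%g.
Hypothesis ordF : #|'Gal({:F} / 1)%g| = 3%N.
Local Notation OF := (@ring_of_integers F).
Implicit Types f g : F.

Definition absN f : R := `|iota f * iota (sigma f) * iota (sigma (sigma f))|.

Lemma absNM f g : absN (f * g) = absN f * absN g.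
Proof. by rewrite /absN -normrM; congr `|_|; rewrite !rmorphM /=; ring. Qed.

Lemma absN_gt0 f : f != 0 -> 0 < absN f.
Proof. by move=> f0; rewrite normr_gt0 !mulf_neq0 // !fmorph_eq0. Qed.

Lemma absN_nat (n : nat) : absN n%:R = n%:R ^+ 3.
Proof. by rewrite /absN !rmorph_nat -!natrM normr_nat -natrX !expnS expn0 muln1 mulnA. Qed.

Lemma subgroup_OF : subgroup OF.
Proof. by split; [exact: OF0 | exact: OFB]. Qed.

Lemma subgroup_principal f : subgroup (principal_ideal f).
Proof.
split; first by exists 0; [exact: OF0 | rewrite mulr0].
by move=> _ _ [a Oa <-] [b Ob <-]; exists (a - b); [exact: OFB | rewrite mulrBr].
Qed.

Lemma principal_sub f g : OF g -> principal_ideal (f * g) `<=` principal_ideal f.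
Proof. by move=> Og _ [a Oa <-]; exists (g * a); [exact: OFM | rewrite mulrA]. Qed.

Lemma principal_scale f g : [set f * x | x in principal_ideal g] = principal_ideal (f * g).
Proof.
apply/seteqP; split => [_ [_ [a Oa <-] <-]|_ [a Oa <-]].
  by exists a; rewrite ?mulrA.
by exists (g * a); [exists a | rewrite mulrA].
Qed.

Lemma scale_OF f : [set f * x | x in OF] = principal_ideal f.
Proof. by []. Qed.

Lemma has_index_nat m : has_index ('I_m.+1 * 'I_m.+1 * 'I_m.+1)%type
  OF (principal_ideal m.+1%:R).
Proof.
have [al [c [Oal sal basO cP cE]]] := OF_coordinates iota galF genF ordF.
exists (fun f => (int_mod m (c f).1.1, int_mod m (c f).1.2, int_mod m (c f).2)); split.
  move=> [[i j] k]; exists ((i : int)%:~R + (j : int)%:~R * al + (k : int)%:~R * sigma al).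
    exact: basO.
  by rewrite cE /= !int_mod_surj.
move=> f g /cP -> /cP ->; rewrite !cE /=.
set n := (c f).1.1; set x := (c f).1.2; set y := (c f).2.
set n' := (c g).1.1; set x' := (c g).1.2; set y' := (c g).2.
clearbody n x y n' x' y'.
have mE : m.+1%:R = (m.+1 : int)%:~R :> F by [].
have dE : n%:~R + x%:~R * al + y%:~R * sigma al - (n'%:~R + x'%:~R * al + y'%:~R * sigma al)
  = (n - n')%:~R + (x - x')%:~R * al + (y - y')%:~R * sigma al by rewrite !intrB; ring.
split=> [[/int_modP[zn en] /int_modP[zx ex] /int_modP[zy ey]]|].
  exists (zn%:~R + zx%:~R * al + zy%:~R * sigma al); first exact: basO.
  by rewrite dE en ex ey mE !intrM; ring.
rewrite dE => -[h Oh]; rewrite [h]cP //.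
set zn := (c h).1.1; set zx := (c h).1.2; set zy := (c h).2; clearbody zn zx zy.
have -> : m.+1%:R * (zn%:~R + zx%:~R * al + zy%:~R * sigma al) =
   (m.+1%:Z * zn)%:~R + (m.+1%:Z * zx)%:~R * al + (m.+1%:Z * zy)%:~R * sigma al.
  by rewrite mE !intrM; ring.
move=> /(congr1 c); rewrite !cE => -[en ex ey].
congr (_, _, _); apply/int_modP; [by exists zn|by exists zx|by exists zy].
Qed.

Lemma card_index_nat m : #|{: 'I_m.+1 * 'I_m.+1 * 'I_m.+1}| = (m.+1 ^ 3)%N.
Proof. by rewrite !card_prod card_ord !expnS expn0 muln1 mulnA. Qed.

Lemma has_index_sigma (T : finType) f : has_index T OF (principal_ideal f) ->
  has_index T OF (principal_ideal (sigma f)).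
Proof.
move=> [phi [phis phiP]]; exists (fun x => phi (sigma (sigma x))); split.
  move=> t; have [a Oa <-] := phis t; exists (sigma a); first exact: OF_sigma.
  by rewrite (sigma3 genF ordF).
move=> a b Oa Ob; rewrite phiP; try by do 2!apply: OF_sigma.
rewrite -!rmorphB /=; split=> -[c Oc e].
  exists (sigma c); first exact: OF_sigma.
  by rewrite -rmorphM e /= (sigma3 genF ordF).
exists (sigma (sigma c)); first by do 2!apply: OF_sigma.
by rewrite -e !rmorphM /= (sigma3 genF ordF).
Qed.

(* The index is invariant under [sigma], so its cube is the index of the
   ideal generated by the norm. *)
Lemma has_index_OF f : OF f -> f != 0 -> exists T : finType,
  has_index T OF (principal_ideal f) /\ #|T|%:R = absN f.
Proof.
move=> Of f0; have Of1 := OF_sigma sigma Of; have Of2 := OF_sigma sigma Of1.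
have [k nk] : exists k : nat, k.+1%:R = absN f /\
    principal_ideal (k.+1%:R : F) = principal_ideal (f * sigma f * sigma (sigma f)).
  have [||n hn] := @OF_fixed_int _ _ galF genF (f * sigma f * sigma (sigma f)).
  - by do !apply: OFM.
  - by rewrite !rmorphM /= (sigma3 genF ordF); ring.
  have aE : absN f = `|n%:~R| by rewrite /absN -!rmorphM hn rmorph_int.
  have n0 : n != 0 by rewrite -(@intr_eq0 R) -normr_gt0 -aE absN_gt0.
  exists (absz n).-1; rewrite prednK ?absz_gt0 //; split.
    by rewrite aE -intr_norm -abszE.
  rewrite hn; case: n {hn aE n0} => n //=.
  rewrite NegzE; apply/seteqP; split => _ [a Oa <-]; exists (- a); try exact: OFN.
    by rewrite rmorphN /= mulrNN.
  by rewrite rmorphN /= mulNr mulrN.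
have iN := has_index_nat k; rewrite nk.2 in iN.
have sp := subgroup_principal.
have sub1 : principal_ideal (f * sigma f * sigma (sigma f)) `<=` principal_ideal (f * sigma f).
  exact: principal_sub.
have sub2 : principal_ideal (f * sigma f) `<=` principal_ideal f by exact: principal_sub.
have sub3 : principal_ideal f `<=` OF by move=> _ [a Oa <-]; exact: OFM.
have [T [V [iT iV cT]]] := has_index_split subgroup_OF (sp f) (sp _)
  (subset_trans sub1 sub2) sub3 iN.
exists T; split => //.
have i1 : has_index T (principal_ideal f) (principal_ideal (f * sigma f)).
  by have := has_index_scale f0 (has_index_sigma iT); rewrite principal_scale.
have fs0 : f * sigma f != 0 by rewrite mulf_neq0 // fmorph_eq0.
have i2 : has_index T (principal_ideal (f * sigma f))
    (principal_ideal (f * sigma f * sigma (sigma f))).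
  by have := has_index_scale fs0 (has_index_sigma (has_index_sigma iT));
    rewrite principal_scale.
have iO := has_index_mul subgroup_OF (sp f) (sp _) sub2 sub3 iT i1.
have {}iO := has_index_mul subgroup_OF (sp _) (sp _) sub1 (subset_trans sub2 sub3) iO i2.
have := has_index_uniq (sp _) iO iN; rewrite card_index_nat !card_prod.
move=> cT3; have : (#|T| ^ 3 == k.+1 ^ 3)%N by rewrite -cT3 !expnS expn0 muln1 mulnA.
by rewrite eqn_exp2r // => /eqP ->; rewrite nk.1.
Qed.

Lemma exists_nat_multiple f : f != 0 -> exists m : nat, OF (m.+1%:R / f).
Proof.
move=> f0; have [d [Od d0 Odf]] := OF_denominator f^-1.
have Od1 := OF_sigma sigma Od; have Od2 := OF_sigma sigma Od1.
have [||n hn] := @OF_fixed_int _ _ galF genF (d * sigma d * sigma (sigma d)).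
- by do !apply: OFM.
- by rewrite !rmorphM /= (sigma3 genF ordF); ring.
have n0 : n != 0.
  apply: contraNneq d0 => n0; move: hn; rewrite n0 => /eqP.
  by rewrite !mulf_eq0 !fmorph_eq0 !orbb.
have On : OF (n%:~R / f).
  have -> : n%:~R / f = sigma d * sigma (sigma d) * (d / f) by rewrite -hn; ring.
  by apply: OFM => //; exact: OFM.
exists (absz n).-1; rewrite prednK ?absz_gt0 //.
case: n On {hn n0} => n On //=; have := OFN On.
by rewrite NegzE rmorphN /= mulNr opprK.
Qed.

Lemma subgroup_ideal (I : set F) : fractional_ideal I -> subgroup I.
Proof.
move=> fI; split; first exact: fractional_ideal0.
case: fI => ID IM _ _ x y Ix Iy; apply: ID => //.
by rewrite -mulN1r; apply: IM => //; apply: OFN; exact: OF1.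
Qed.

Lemma has_index_nonempty (T : finType) (A B : set F) : A 0 -> has_index T A B -> (0 < #|T|)%N.
Proof. by move=> A0 [phi _]; apply/card_gt0P; exists (phi 0). Qed.

(** Here [k] is the index [[I : f OF]]. All indices are compared through the common sublattice
    [K = m OF]. With [J = OF n I] one has [[I : J] [J : K] = k [f OF : K]] and [[OF : J] [J : K] =
    m^3 = |N f| [f OF : K]]; the quotient of the two is the claim. *)
Lemma ideal_norm_index (I : set F) f : fractional_ideal I -> I f -> f != 0 -> exists k : nat,
  [/\ (0 < k)%N, ratr (ideal_norm I) * k%:R = absN f & k = 1%N -> I = principal_ideal f].
Proof.
move=> fI If f0; have sI := subgroup_ideal fI.
have [m Om] := exists_nat_multiple f0.
have [ID IM _ [d [Od d0 dI]]] := fI.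
pose K : set F := principal_ideal m.+1%:R.
pose J : set F := OF `&` I.
have sp := subgroup_principal; have sO := subgroup_OF.
have sJ : subgroup J.
  split; first by split; [exact: sO.1|exact: sI.1].
  by move=> x y [Ox Ix] [Oy Iy]; split; [exact: sO.2|exact: sI.2].
have m0 : m.+1%:R != 0 :> F by rewrite -(rmorph_nat (in_alg F)) fmorph_eq0 pnatr_eq0.
have mE : m.+1%:R = f * (m.+1%:R / f) by rewrite mulrC divfK.
have Kf : K `<=` principal_ideal f by rewrite /K mE; exact: principal_sub.
have fIs : principal_ideal f `<=` I.
  by move=> _ [a Oa <-]; rewrite mulrC; exact: IM.
have KO : K `<=` OF.
  by move=> _ [a Oa <-]; apply: OFM => //; exact: (OF_int _ m.+1).
have KJ : K `<=` J by move=> x Kx; split; [exact: KO|exact/fIs/Kf].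
have JO : J `<=` OF by move=> x [].
have JI : J `<=` I by move=> x [].
have Omn : OF (m.+1%:R : F) by exact: (OF_int _ m.+1).
(* Finiteness of [[I : K]] comes from the larger ideal generated by [1/d], whose index over [K] is
   that of [d m OF] in [OF]. *)
have [Td [iTd _]] := has_index_OF (OFM Od Omn) (mulf_neq0 d0 m0).
have {}iTd : has_index Td (principal_ideal d^-1) K.
  have dV0 : d^-1 != 0 by rewrite invr_eq0.
  by have := has_index_scale dV0 iTd; rewrite scale_OF principal_scale mulKf.
have Id : I `<=` principal_ideal d^-1.
  by move=> x Ix; exists (d * x); [exact: dI | rewrite mulKf].
have [_ [TI [_ iIK _]]] := has_index_split (sp _) sI (sp _) (subset_trans Kf fIs) Id iTd.
have [Tk [Te [iIf ifK cke]]] := has_index_split sI (sp _) (sp _) Kf fIs iIK.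
have [Tc [Tb [iIJ iJK ccb]]] := has_index_split sI sJ (sp _) KJ JI iIK.
have [Ta [Tb' [iOJ iJK' cab]]] := has_index_split sO sJ (sp _) KJ JO (has_index_nat m).
rewrite card_index_nat (has_index_uniq (sp _) iJK' iJK) in cab.
have [Tm [iTm cTm]] := has_index_OF Om (mulf_neq0 m0 (invr_neq0 f0)).
have {}iTm : has_index Tm (principal_ideal f) K.
  by have := has_index_scale f0 iTm; rewrite scale_OF principal_scale -mE.
have eE : #|Te|%:R * absN f = m.+1%:R ^+ 3 :> R.
  by rewrite (has_index_uniq (sp _) ifK iTm) cTm -absNM divfK // absN_nat.
exists #|Tk|; split.
- exact: has_index_nonempty sI.1 iIf.
- have Tc0 : #|Tc|%:R != 0 :> R.
    by rewrite pnatr_eq0 -lt0n (has_index_nonempty sI.1 iIJ).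
  have Tb0 : #|Tb|%:R != 0 :> R.
    by rewrite pnatr_eq0 -lt0n (has_index_nonempty sJ.1 iJK).
  have Te0 : #|Te|%:R != 0 :> R.
    by rewrite pnatr_eq0 -lt0n (has_index_nonempty (sp f).1 ifK).
  rewrite /ideal_norm (has_index_card sJ iOJ) (has_index_card sJ iIJ).
  rewrite rmorphM fmorphV /= !ratr_nat.
  have h1 : #|Tc|%:R * #|Tb|%:R = #|Tk|%:R * #|Te|%:R :> R.
    by rewrite -!natrM -cke -ccb.
  have h2 : #|Ta|%:R * #|Tb|%:R = #|Te|%:R * absN f by rewrite eE -natrX cab natrM.
  apply: (mulfI Tc0); apply: (mulfI Tb0); apply: (mulfI Te0).
  transitivity (#|Te|%:R * (#|Ta|%:R * #|Tb|%:R) * #|Tk|%:R : R); first by field.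
  rewrite h2; transitivity (#|Te|%:R * absN f * (#|Tk|%:R * #|Te|%:R)); first by ring.
  by rewrite -h1; ring.
- move=> k1; apply/seteqP; split => // x Ix.
  have [phi [_ phiP]] := iIf.
  rewrite -[x]subr0; apply/phiP => //; first exact: sI.1.
  by move/eqP: k1; rewrite eqn_leq => /andP[/card_le1_eqP h _]; exact: h.
Qed.

End IdealNorm.

(** * Packing by unit cubes *)

Section Cubes.
Variable R : realType.

Lemma exp_pi10_le : expR (- (pi / 10)) <= 3 / 4 :> R.
Proof.
have p := @pi_ge R; have h : 4 / 3 <= expR (pi / 10) :> R.
  by have := @expR_ge_quad R (pi / 10) ltac:(lra); nra.
rewrite expRN -[3 / 4]invrK lef_pV2 ?posrE ?expR_gt0 ?invr_gt0 //.
by rewrite invf_div.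
Qed.

(** Four terms are kept; the others are dominated by a geometric series, as [(4 + i)^2 >= 16 + 8 i]
    and [(3/4)^8 <= 1/8]. *)
Lemma sum_pow_sqr_le M : \sum_(n < M) (3 / 4 : R) ^+ (n * n) <= 2153 / 1000.
Proof.
have geo m : \sum_(k < m) (1 / 8 : R) ^+ k <= 8 / 7.
  suff : \sum_(k < m) (1 / 8 : R) ^+ k = 8 / 7 - 8 / 7 * (1 / 8) ^+ m.
    by move=> ->; have : 0 <= (1 / 8 : R) ^+ m by []; lra.
  elim: m => [|m IH]; first by rewrite big_ord0 expr0; lra.
  by rewrite big_ord_recr /= IH exprS; lra.
have r0 : 0 <= 3 / 4 :> R by [].
apply: (@le_trans _ _ (\sum_(n < 4 + M) (3 / 4 : R) ^+ (n * n))).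
  rewrite -!(big_mkord xpredT (fun n => (3 / 4 : R) ^+ (n * n))).
  rewrite [leRHS](@big_cat_nat _ _ _ M) ?leq_addl //= lerDl.
  by apply: sumr_ge0 => i _; rewrite exprn_ge0.
rewrite big_split_ord /= !big_ord_recr big_ord0 /=.
have : \sum_(i < M) (3 / 4 : R) ^+ ((4 + i) * (4 + i)) <= (3 / 4) ^+ 16 * (8 / 7).
  apply: le_trans (ler_wpM2l (exprn_ge0 16 r0) (geo M)).
  rewrite mulr_sumr; apply: ler_sum => i _.
  have -> : ((4 + i) * (4 + i) = 16 + (8 * i + i * i))%N by lia.
  rewrite exprD ler_wpM2l ?exprn_ge0 // exprD exprM.
  apply: (@le_trans _ _ ((3 / 4) ^+ 8 ^+ i * 1)).
    by rewrite ler_wpM2l ?exprn_ge0 // exprn_ile1 //; lra.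
  by rewrite mulr1 lerXn2r ?nnegrE ?exprn_ge0 //; lra.
set S := \sum_(i < M) _; move=> hS.
rewrite add0r mul0n expr0 mul1n expr1.
have -> : (2 * 2 = 4)%N by []; have -> : (3 * 3 = 9)%N by [].
lra.
Qed.

(** The number is the distance from the origin to the unit interval containing [x], hence a lower
    bound of [|x|]; the boolean tells the side. Each distance thus occurs for exactly two
    intervals. *)
Definition cell (x : R) : bool * nat :=
  match Num.floor x with Posz n => (true, n) | Negz n => (false, n) end.

Lemma cell_dist (x y : R) : cell x = cell y -> `|x - y| < 1.
Proof.
have hx := floor_itv x; have hy := floor_itv y.
rewrite /cell => e; have {}e : Num.floor x = Num.floor y.
  by case: (Num.floor x) (Num.floor y) e => n [] m // [->].
rewrite e in hx; move: hx hy; rewrite intrD; set k := _%:~R.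
by move=> /andP[? ?] /andP[? ?]; rewrite ltr_norml; apply/andP; split; lra.
Qed.

Lemma cell_exp (x : R) : expR (- (pi / 10) * x ^+ 2) <= (3 / 4) ^+ ((cell x).2 * (cell x).2).
Proof.
have hn : (cell x).2%:R ^+ 2 <= x ^+ 2.
  have := floor_itv x; rewrite /cell intrD; case: (Num.floor x) => n /andP[].
    rewrite -pmulrn /= => h _; have n0 : 0 <= n%:R :> R by rewrite ler0n.
    nra.
  rewrite NegzE mulrNz -pmulrn -natr1 /= => _ h.
  have n0 : 0 <= n%:R :> R by rewrite ler0n.
  nra.
set n := (cell x).2 in hn *; apply: le_trans (_ : expR (- (pi / 10) * (n * n)%:R) <= _).
  rewrite ler_expR mulNr mulNr lerN2 natrM -expr2 ler_wpM2l //.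
  by rewrite divr_ge0 ?pi_ge0.
rewrite mulrC expRM_natl lerXn2r ?nnegrE ?expR_ge0 //.
exact: exp_pi10_le.
Qed.

Variables (T : choiceType) (X : set T) (v0 v1 v2 : T -> R).
Let nrm x := v0 x ^+ 2 + v1 x ^+ 2 + v2 x ^+ 2.
Hypothesis sep : forall x y, X x -> X y -> x != y ->
  3 <= (v0 x - v0 y) ^+ 2 + (v1 x - v1 y) ^+ 2 + (v2 x - v2 y) ^+ 2.

(* A half-open unit cube has diameter less than sqrt 3, so that it contains at
   most one point. *)
Lemma esum_cubes : (\esum_(x in X) (expR (- (pi / 10) * nrm x))%:E <= 80%:E)%E.
Proof.
apply: ub_ereal_sup => _ [A [finA AX] <-].
rewrite fsbig_finite //= sumEFin lee_fin.
set s := fset_set A.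
have sX x : x \in s -> X x by move=> xs; apply: AX; have := xs; rewrite in_fset_set // inE.
(* Bounding the cells that occur makes the labels a finite type, over which the majorant is the cube
   of a one-dimensional sum. *)
pose M := \max_(x <- s) maxn (cell (v0 x)).2 (maxn (cell (v1 x)).2 (cell (v2 x)).2).
have Mb x : x \in s -> [/\ ((cell (v0 x)).2 <= M)%N, ((cell (v1 x)).2 <= M)%N
    & ((cell (v2 x)).2 <= M)%N].
  move=> xs; have : (maxn (cell (v0 x)).2 (maxn (cell (v1 x)).2 (cell (v2 x)).2) <= M)%N.
    exact: (leq_bigmax_seq _ xs).
  by rewrite !geq_max => /and3P[].
pose c (b : bool * nat) : bool * 'I_M.+1 := (b.1, inord b.2).
pose phi x := (c (cell (v0 x)), c (cell (v1 x)), c (cell (v2 x))).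
pose h (b : bool * 'I_M.+1) : R := (3 / 4) ^+ (b.2 * b.2).
pose G t := h t.1.1 * h t.1.2 * h t.2.
have h0 b : 0 <= h b by rewrite exprn_ge0.
have inj : {in s &, injective phi}.
  move=> x y xs ys; rewrite /phi => -[e0 f0 e1 f1 e2 f2]; apply/eqP; apply: contrapT => /negP xy.
  have [a0 a1 a2] := Mb x xs; have [b0 b1 b2] := Mb y ys.
  have cE (u w : R) : (cell u).1 = (cell w).1 -> ((cell u).2 <= M)%N -> ((cell w).2 <= M)%N ->
      inord (cell u).2 = inord (cell w).2 :> 'I_M.+1 -> `|u - w| < 1.
    move=> e ub wb /(congr1 val) /=; rewrite !inordK ?ltnS // => e'.
    by apply: cell_dist; move: e e'; case: (cell u) (cell w) => [? ?] [? ?] /= -> ->.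
  have sq (u : R) : `|u| < 1 -> u ^+ 2 < 1.
    by move=> hu; rewrite -(real_normK (num_real u)) expr_lt1.
  have := sep (sX _ xs) (sX _ ys) xy.
  have := sq _ (cE _ _ e0 a0 b0 f0); have := sq _ (cE _ _ e1 a1 b1 f1).
  have := sq _ (cE _ _ e2 a2 b2 f2); lra.
have le1 : \sum_(x <- s) expR (- (pi / 10) * nrm x) <= \sum_(x <- s) G (phi x).
  rewrite big_seq [leRHS]big_seq; apply: ler_sum => x xs.
  have [a0 a1 a2] := Mb x xs.
  rewrite /nrm !mulrDr !expRD /G /h /= !inordK ?ltnS //.
  by do !(apply: ler_pM => //; rewrite ?mulr_ge0 ?expR_ge0 ?exprn_ge0 //); exact: cell_exp.
apply: le_trans le1 _.
have -> : \sum_(x <- s) G (phi x) = \sum_(t <- map phi s) G t by rewrite big_map.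
have us : uniq (map phi s) by rewrite map_inj_in_uniq.
rewrite big_uniq //=.
apply: (@le_trans _ _ (\sum_t G t)).
  rewrite [leRHS](bigID (fun t => t \in map phi s)) /= lerDl.
  by apply: sumr_ge0 => t _; rewrite !mulr_ge0.
have -> : \sum_t G t = (\sum_b h b) ^+ 3.
  rewrite !exprS expr0 mulr1 mulrA.
  rewrite -(pair_bigA _ (fun p b => h p.1 * h p.2 * h b)) /=.
  rewrite -(pair_bigA _ (fun a b => \sum_j h a * h b * h j)) /=.
  rewrite big_distrlr big_distrl /=; apply: eq_bigr => i _.
  rewrite big_distrl /=; apply: eq_bigr => j _; rewrite big_distrr /=; exact: eq_bigr.
have -> : \sum_b h b = 2 * \sum_(n < M.+1) (3 / 4 : R) ^+ (n * n).
  rewrite -(pair_bigA _ (fun (a : bool) (b : 'I_M.+1) => (3 / 4 : R) ^+ (b * b))) /=.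
  by rewrite big_bool /=; ring.
have S0 : 0 <= \sum_(n < M.+1) (3 / 4 : R) ^+ (n * n) by apply: sumr_ge0 => i _; rewrite exprn_ge0.
have := sum_pow_sqr_le M.+1; set S := \sum_(n < _) _ in S0 * => hS.
(* The constant [80] comes from here: this cube is about [79.84]. *)
apply: (@le_trans _ _ ((2 * (2153 / 1000)) ^+ 3)); last by lra.
by rewrite lerXn2r ?nnegrE; lra.
Qed.

End Cubes.

(** * Numerical estimates *)

Section Numerics.
Variable R : realType.
Implicit Types x y a b : R.

Lemma expR_ge_quartic x : 0 <= x ->
  1 + x + x ^+ 2 / 2 + x ^+ 3 / 6 + x ^+ 4 / 24 <= expR x.
Proof.
move=> x0; have := series_exp_le 5 x0; rewrite series_exp_split !big_ord_recr big_ord0 /=.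
by rewrite add0r !addrA.
Qed.

Lemma expR_double_ge x y a b : y = 2 * x -> 0 <= a -> a <= expR x -> b <= a ^+ 2 ->
  b <= expR y.
Proof. by move=> -> a0 ax; rewrite expRM_natl; nra. Qed.

Lemma expR_double_le x y a b : y = 2 * x -> expR x <= a -> a ^+ 2 <= b -> expR y <= b.
Proof. by move=> -> ax; rewrite expRM_natl; have := expR_ge0 x; nra. Qed.

Lemma expRN_le x y a b : 0 < a -> a <= expR x -> x <= y -> 1 <= a * b -> expR (- y) <= b.
Proof.
move=> a0 ax xy ab; have ay : a <= expR y by apply: le_trans ax _; rewrite ler_expR.
have := expR_gt0 y; have := expRxMexpNx_1 y; have := expR_gt0 (- y); nra.
Qed.

Lemma expR_small_le x : 0 < x -> x < 1 -> expR x <= (1 + x) / (1 - x ^+ 2 / 2).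
Proof.
move=> x0 x1; have := expR_le_quad_expR (lexx x) x0.
rewrite ler_pdivlMr; last by nra.
by move: (expR x) => e; lra.
Qed.

(** In this and the following estimates the exponent lies just below [3.13] times a coefficient of
    [pi] needed later. The quartic Taylor polynomial at a sixteenth of it is squared four times,
    with rounding down to keep the numerals short. *)
Lemma exp_466 : 1045 / 10 <= expR (466 / 100) :> R.
Proof.
have h0 : 13380 / 10000 <= expR (466 / 100 / 16) :> R by apply: le_trans (expR_ge_quartic _); lra.
have {h0} h1 : 17902 / 10000 <= expR (466 / 100 / 8) :> R by apply: expR_double_ge h0 _; lra.
have {h1} h2 : 3204 / 1000 <= expR (466 / 100 / 4) :> R by apply: expR_double_ge h1 _; lra.
have {h2} h3 : 10265 / 1000 <= expR (466 / 100 / 2) :> R by apply: expR_double_ge h2 _; lra.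
by apply: expR_double_ge h3 _; lra.
Qed.

Lemma exp_807 : 3130 <= expR (807 / 100) :> R.
Proof.
have h0 : 16556 / 10000 <= expR (807 / 100 / 16) :> R by apply: le_trans (expR_ge_quartic _); lra.
have {h0} h1 : 2741 / 1000 <= expR (807 / 100 / 8) :> R by apply: expR_double_ge h0 _; lra.
have {h1} h2 : 7513 / 1000 <= expR (807 / 100 / 4) :> R by apply: expR_double_ge h1 _; lra.
have {h2} h3 : 5644 / 100 <= expR (807 / 100 / 2) :> R by apply: expR_double_ge h2 _; lra.
by apply: expR_double_ge h3 _; lra.
Qed.

Lemma exp_500 : 147 <= expR (500 / 100) :> R.
Proof.
have h0 : 13668 / 10000 <= expR (500 / 100 / 16) :> R by apply: le_trans (expR_ge_quartic _); lra.
have {h0} h1 : 18681 / 10000 <= expR (500 / 100 / 8) :> R by apply: expR_double_ge h0 _; lra.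
have {h1} h2 : 3489 / 1000 <= expR (500 / 100 / 4) :> R by apply: expR_double_ge h1 _; lra.
have {h2} h3 : 12173 / 1000 <= expR (500 / 100 / 2) :> R by apply: expR_double_ge h2 _; lra.
by apply: expR_double_ge h3 _; lra.
Qed.

Lemma exp_948 : 1291 * 10 <= expR (948 / 100) :> R.
Proof.
have h0 : 18078 / 10000 <= expR (948 / 100 / 16) :> R by apply: le_trans (expR_ge_quartic _); lra.
have {h0} h1 : 3268 / 1000 <= expR (948 / 100 / 8) :> R by apply: expR_double_ge h0 _; lra.
have {h1} h2 : 10679 / 1000 <= expR (948 / 100 / 4) :> R by apply: expR_double_ge h1 _; lra.
have {h2} h3 : 11404 / 100 <= expR (948 / 100 / 2) :> R by apply: expR_double_ge h2 _; lra.
by apply: expR_double_ge h3 _; lra.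
Qed.

Lemma exp_419 : 658 / 10 <= expR (419 / 100) :> R.
Proof.
have h0 : 12993 / 10000 <= expR (419 / 100 / 16) :> R by apply: le_trans (expR_ge_quartic _); lra.
have {h0} h1 : 16881 / 10000 <= expR (419 / 100 / 8) :> R by apply: expR_double_ge h0 _; lra.
have {h1} h2 : 2849 / 1000 <= expR (419 / 100 / 4) :> R by apply: expR_double_ge h1 _; lra.
have {h2} h3 : 8116 / 1000 <= expR (419 / 100 / 2) :> R by apply: expR_double_ge h2 _; lra.
by apply: expR_double_ge h3 _; lra.
Qed.

Lemma exp_663 : 745 <= expR (663 / 100) :> R.
Proof.
have h0 : 15133 / 10000 <= expR (663 / 100 / 16) :> R by apply: le_trans (expR_ge_quartic _); lra.
have {h0} h1 : 2290 / 1000 <= expR (663 / 100 / 8) :> R by apply: expR_double_ge h0 _; lra.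
have {h1} h2 : 5244 / 1000 <= expR (663 / 100 / 4) :> R by apply: expR_double_ge h1 _; lra.
have {h2} h3 : 2749 / 100 <= expR (663 / 100 / 2) :> R by apply: expR_double_ge h2 _; lra.
by apply: expR_double_ge h3 _; lra.
Qed.

Lemma exp_625 : 500 <= expR (625 / 100) :> R.
Proof.
have h0 : 14778 / 10000 <= expR (625 / 100 / 16) :> R by apply: le_trans (expR_ge_quartic _); lra.
have {h0} h1 : 2183 / 1000 <= expR (625 / 100 / 8) :> R by apply: expR_double_ge h0 _; lra.
have {h1} h2 : 4765 / 1000 <= expR (625 / 100 / 4) :> R by apply: expR_double_ge h1 _; lra.
have {h2} h3 : 2270 / 100 <= expR (625 / 100 / 2) :> R by apply: expR_double_ge h2 _; lra.
by apply: expR_double_ge h3 _; lra.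
Qed.

Lemma exp_925 : 1000 * 10 <= expR (925 / 100) :> R.
Proof.
have h0 : 17820 / 10000 <= expR (925 / 100 / 16) :> R by apply: le_trans (expR_ge_quartic _); lra.
have {h0} h1 : 3175 / 1000 <= expR (925 / 100 / 8) :> R by apply: expR_double_ge h0 _; lra.
have {h1} h2 : 10080 / 1000 <= expR (925 / 100 / 4) :> R by apply: expR_double_ge h1 _; lra.
have {h2} h3 : 10160 / 100 <= expR (925 / 100 / 2) :> R by apply: expR_double_ge h2 _; lra.
by apply: expR_double_ge h3 _; lra.
Qed.

End Numerics.

(** * The numerical inequality for [lambda >= 3.02] *)

Section Numerics2.
Variable R : realType.

Lemma inv_pow_bound (y yi lo c : R) : 0 < y -> y * yi = 1 -> lo <= y -> 1 <= lo * c -> 0 < lo ->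
  [/\ 0 <= yi, yi <= c, yi ^+ 2 <= c ^+ 2 & yi ^+ 3 <= c ^+ 3].
Proof.
move=> y0 yyi loy loc lo0.
have yi0 : 0 <= yi by nra.
have c0 : 0 <= c by nra.
have yic : yi <= c by nra.
by split=> //; rewrite lerXn2r.
Qed.

(** The inequality of [mid_numeric] divided by [2 q^3], with [y = e^{-pi mu}]. As [y] decreases, the
    bounds with [t = 3], then with [t = 2], then the trivial bound [lambda] are used, the last one
    first only for [l], then also for [l8]. On each subinterval [y] is estimated at the upper end
    and [yi] at the lower end. *)
Lemma mid_core (y yi A C A2 C2 q t : R) : 0 < y -> y * yi = 1 -> y <= 94 / 100 ->
  0 <= A -> 0 <= C -> 0 <= A2 -> 0 <= C2 ->
  A <= 96 / 10000 -> C <= 32 / 1000 / 100 -> A2 <= 152 / 10000 -> C2 <= 135 / 1000 / 100 ->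
  q <= 1 / 147 -> t <= 31 / 10000 ->
  [\/ y + 2 * (A * yi ^+ 3) + 4 * (q + C * yi ^+ 3) + t < 1,
      y + 2 * (A2 * yi ^+ 2) + 4 * (q + C2 * yi ^+ 2) + t < 1,
      y + 2 * y + 4 * (q + C2 * yi ^+ 2) + t < 1 |
      y + 2 * y + 4 * y + t < 1].
Proof.
move=> y0 yyi y94 A0 C0 A20 C20 hA hC hA2 hC2 hq ht.
have K (lo c : R) : lo <= y -> 1 <= lo * c -> 0 < lo ->
   [/\ A * yi ^+ 3 <= 96 / 10000 * c ^+ 3, C * yi ^+ 3 <= 32 / 1000 / 100 * c ^+ 3,
       A2 * yi ^+ 2 <= 152 / 10000 * c ^+ 2 & C2 * yi ^+ 2 <= 135 / 1000 / 100 * c ^+ 2].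
  move=> h1 h2 h3; have [a b c' d] := inv_pow_bound y0 yyi h1 h2 h3.
  by split; apply: ler_pM => //; rewrite exprn_ge0.
have [h|h] := leP (9 / 10) y.
  have [k1 k2 _ _] := @K (9 / 10) (10 / 9) h ltac:(clear; lra) ltac:(clear; lra).
  by apply: Or41; clear -k1 k2 hq ht y94; lra.
have [h'|h'] := leP (3 / 4) y.
  have [k1 k2 _ _] := @K (3 / 4) (4 / 3) h' ltac:(clear; lra) ltac:(clear; lra).
  by apply: Or41; clear -k1 k2 hq ht h; lra.
clear h; have [h|h] := leP (1 / 2) y.
  have [k1 k2 _ _] := @K (1 / 2) 2 h ltac:(clear; lra) ltac:(clear; lra).
  by apply: Or41; clear -k1 k2 hq ht h'; lra.
clear h'; have [h'|h'] := leP (3 / 10) y.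
  have [_ _ k1 k2] := @K (3 / 10) (10 / 3) h' ltac:(clear; lra) ltac:(clear; lra).
  by apply: Or42; clear -k1 k2 hq ht h; lra.
clear h; have [h|h] := leP (1 / 4) y.
  have [_ _ k1 k2] := @K (1 / 4) 4 h ltac:(clear; lra) ltac:(clear; lra).
  by apply: Or42; clear -k1 k2 hq ht h'; lra.
clear h'; have [h'|h'] := leP (17 / 100) y.
  have [_ _ k1 k2] := @K (17 / 100) (100 / 17) h' ltac:(clear; lra) ltac:(clear; lra).
  by apply: Or43; clear -k2 hq ht h; lra.
clear h; have [h|h] := leP (13 / 100) y.
  have [_ _ k1 k2] := @K (13 / 100) (100 / 13) h ltac:(clear; lra) ltac:(clear; lra).
  by apply: Or43; clear -k2 hq ht h'; lra.
by apply: Or44; clear -h ht; lra.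
Qed.

Lemma mid_numeric (lam : R) : 302 / 100 <= lam -> exists l l8 : R,
  [/\ [\/ l = lam, l = 1349 / 100 - 3 * lam | l = 1034 / 100 - 2 * lam],
      [\/ l8 = lam, l8 = 1458 / 100 - 3 * lam | l8 = 1112 / 100 - 2 * lam] &
   4 * expR (- pi * l) +
   8 * Num.min (expR (- pi * (46 / 10)) + expR (- pi * l8)) (expR (- pi * l)) +
   80 * expR (- pi * (603 / 100)) + 2 * expR (- pi * lam) < 2 * expR (- pi * 3)].
Proof.
move=> hlam; have hp := @pi_ge R.
have [mu lamE] : exists mu, lam = 3 + mu by exists (lam - 3); lra.
have hmu : 2 / 100 <= mu by clear -hlam lamE; lra.
rewrite lamE; set q3 := expR (- pi * 3); have q30 : 0 < q3 by exact: expR_gt0.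
set y := expR (- (pi * mu)); set yi := expR (pi * mu).
have y0 : 0 < y by exact: expR_gt0.
have yyi : y * yi = 1 by rewrite mulrC expRxMexpNx_1.
(* The coefficients are excesses over [3], for instance [1349/100 - 3 (3 + mu) = 3 + 149/100 - 3
   mu]. *)
pose A := expR (- (pi * (149 / 100))) : R; pose C := expR (- (pi * (258 / 100))) : R.
pose A2 := expR (- (pi * (134 / 100))) : R; pose C2 := expR (- (pi * (212 / 100))) : R.
pose q := expR (- (pi * (16 / 10))) : R; pose t := expR (- (pi * (303 / 100))) : R.
have e1 : expR (- pi * (3 + mu)) = q3 * y by rewrite /q3 /y -expRD; congr expR; ring.
have e2 : expR (- pi * (1349 / 100 - 3 * (3 + mu))) = q3 * (A * yi ^+ 3).
  by rewrite /q3 /A /yi -expRM_natl -!expRD; congr expR; lra.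
have e3 : expR (- pi * (1034 / 100 - 2 * (3 + mu))) = q3 * (A2 * yi ^+ 2).
  by rewrite /q3 /A2 /yi -expRM_natl -!expRD; congr expR; lra.
have e4 : expR (- pi * (1458 / 100 - 3 * (3 + mu))) = q3 * (C * yi ^+ 3).
  by rewrite /q3 /C /yi -expRM_natl -!expRD; congr expR; lra.
have e5 : expR (- pi * (1112 / 100 - 2 * (3 + mu))) = q3 * (C2 * yi ^+ 2).
  by rewrite /q3 /C2 /yi -expRM_natl -!expRD; congr expR; lra.
have e6 : expR (- pi * (46 / 10)) = q3 * q by rewrite /q3 /q -expRD; congr expR; lra.
have e7 : expR (- pi * (603 / 100)) = q3 * t by rewrite /q3 /t -expRD; congr expR; lra.
have y94 : y <= 94 / 100.
  have h1 : 1064 / 1000 <= expR (626 / 10000) :> R.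
    by apply: le_trans (expR_ge_quad _); clear; lra.
  apply: (expRN_le _ h1); [by clear; lra| |by clear; lra].
  by clear -hp hmu; nra.
have hA : A <= 96 / 10000.
  by apply: (expRN_le _ (@exp_466 R)); clear -hp; lra.
have hC : C <= 32 / 1000 / 100.
  by apply: (expRN_le _ (@exp_807 R)); clear -hp; lra.
have hA2 : A2 <= 152 / 10000.
  by apply: (expRN_le _ (@exp_419 R)); clear -hp; lra.
have hC2 : C2 <= 135 / 1000 / 100.
  by apply: (expRN_le _ (@exp_663 R)); clear -hp; lra.
have hq : q <= 1 / 147.
  by apply: (expRN_le _ (@exp_500 R)); clear -hp; lra.
have ht : 40 * t <= 31 / 10000.
  suff : t <= 31 / 10000 / 40 by clear; lra.
  by apply: (expRN_le _ (@exp_948 R)); clear -hp; lra.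
have key (L8 L : R) : y + 2 * L + 4 * Num.min (q + L8) L + 40 * t < 1 ->
   4 * (q3 * L) + 8 * Num.min (q3 * q + q3 * L8) (q3 * L) + 80 * (q3 * t) + 2 * (q3 * y) < 2 * q3.
  move=> h; rewrite -mulrDr -minr_pMr ?ltW //; move: h; set m := Num.min _ _.
  clear -q30; nra.
have minl (a b : R) : Num.min a b <= a by rewrite ge_min lexx.
have minr (a b : R) : Num.min a b <= b by rewrite ge_min lexx orbT.
have pos (x : R) : 0 <= expR x by exact: expR_ge0.
case: (mid_core y0 yyi y94 (pos _) (pos _) (pos _) (pos _) hA hC hA2 hC2 hq ht) => h.
- exists (1349 / 100 - 3 * (3 + mu)), (1458 / 100 - 3 * (3 + mu)); split.
  + exact: Or32.
  + exact: Or32.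
  + rewrite e1 e2 e4 e6 e7; apply: key; apply: le_lt_trans h.
    by rewrite lerD2r lerD2l ler_pM2l.
- exists (1034 / 100 - 2 * (3 + mu)), (1112 / 100 - 2 * (3 + mu)); split.
  + exact: Or33.
  + exact: Or33.
  + rewrite e1 e3 e5 e6 e7; apply: key; apply: le_lt_trans h.
    by rewrite lerD2r lerD2l ler_pM2l.
- exists (3 + mu), (1112 / 100 - 2 * (3 + mu)); split.
  + exact: Or31.
  + exact: Or33.
  + rewrite e1 e5 e6 e7; apply: key; apply: le_lt_trans h.
    by rewrite lerD2r lerD2l ler_pM2l.
- exists (3 + mu), (3 + mu); split.
  + exact: Or31.
  + exact: Or31.
  + rewrite e1 e6 e7; apply: key; apply: le_lt_trans h.
    by rewrite lerD2r lerD2l ler_pM2l.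
Qed.

End Numerics2.

(** * One Galois orbit for [lambda <= 3.02] *)

Section Local.
Variable R : realType.

(** From [v^2 + w^2 >= 2 v w = 2 / u] and [u^2 + 2 / u - 3 = (u - 1)^2 (u + 2) / u]. *)
Lemma weight_bounds (u v w : R) : 0 < u -> 0 < v -> 0 < w -> u * v * w = 1 ->
  u ^+ 2 + v ^+ 2 + w ^+ 2 <= 302 / 100 -> 92 / 100 <= u <= 1085 / 1000.
Proof.
move=> u0 v0 w0 uvw hS.
have h : (u - 1) ^+ 2 * (u + 2) <= 2 / 100 * u.
  have h1 : 2 <= u * (v ^+ 2 + w ^+ 2).
    have -> : 2 = u * (2 * (v * w)) by rewrite -[in LHS](mulr1 2) -uvw; ring.
    by rewrite ler_pM2l //; have := sqr_ge0 (v - w); clear; nra.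
  clear -h1 hS u0; nra.
apply/andP; split; rewrite leNgt; apply/negP => hu.
  have [e eE] : exists e, e = 92 / 100 - u by exists (92 / 100 - u).
  have e0 : 0 < e by rewrite eE; clear -hu; lra.
  have e1 : e < 92 / 100 by rewrite eE; clear -u0; lra.
  have ue : u = 92 / 100 - e by rewrite eE; clear; lra.
  have e2 : 0 <= e ^+ 2 * (92 / 100 - e) by rewrite mulr_ge0 ?sqr_ge0 // subr_ge0 ltW.
  by move: h (sqr_ge0 e) e0 e2; rewrite ue; clear; nra.
have [e eE] : exists e, e = u - 1085 / 1000 by exists (u - 1085 / 1000).
have e0 : 0 < e by rewrite eE; clear -hu; lra.
have ue : u = 1085 / 1000 + e by rewrite eE; clear; lra.
have e3 : 0 <= e ^+ 3 by rewrite exprn_ge0 // ltW.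
by move: h (sqr_ge0 e) e0 e3; rewrite ue; clear; nra.
Qed.

Lemma AGM3_pairs (x y z : R) : 0 < x -> 0 < y -> 0 < z -> x * y * z = 1 ->
  3 <= x * y + y * z + z * x.
Proof.
move=> x0 y0 z0 e.
have s0 : 0 < x + y + z by lra.
have h1 : 3 * (x + y + z) <= (x * y + y * z + z * x) ^+ 2.
  have -> : 3 * (x + y + z) = 3 * (x + y + z) * (x * y * z) by rewrite e mulr1.
  have := sqr_ge0 (x * y - y * z); have := sqr_ge0 (y * z - z * x).
  have := sqr_ge0 (z * x - x * y); clear; nra.
have h2 : 3 * (x * y + y * z + z * x) <= (x + y + z) ^+ 2.
  have := sqr_ge0 (x - y); have := sqr_ge0 (y - z); have := sqr_ge0 (z - x).
  clear; nra.
have : 0 < x * y + y * z + z * x by rewrite !addr_gt0 ?mulr_gt0.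
move: h1 h2 s0; move: (x + y + z) (x * y + y * z + z * x) => s p; clear.
move=> h1 h2 s0 p0; rewrite leNgt; apply/negP => p3.
have : s < p by nra.
nra.
Qed.

(** Each [(u + v)^2] is at most [2.17^2 <= 4.725], and the sum of the [(u - v)^2] is [2 (lambda - (u
    v + v w + w u)) <= 2 (lambda - 3)]. So the spread of the squared weights is of the order of
    [sqrt mu]. *)
Lemma weight_spread (u v w : R) : 0 < u -> 0 < v -> 0 < w -> u * v * w = 1 ->
  u ^+ 2 + v ^+ 2 + w ^+ 2 <= 302 / 100 ->
  (u ^+ 2 - v ^+ 2) ^+ 2 + (v ^+ 2 - w ^+ 2) ^+ 2 + (w ^+ 2 - u ^+ 2) ^+ 2
   <= 945 / 100 * (u ^+ 2 + v ^+ 2 + w ^+ 2 - 3).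
Proof.
move=> u0 v0 w0 e hS.
have /andP[_ hu] := weight_bounds u0 v0 w0 e hS.
have /andP[_ hv] : 92 / 100 <= v <= 1085 / 1000.
  by apply: (@weight_bounds v w u) => //; [rewrite -e; ring | clear -hS; lra].
have /andP[_ hw] : 92 / 100 <= w <= 1085 / 1000.
  by apply: (@weight_bounds w u v) => //; [rewrite -e; ring | clear -hS; lra].
have h3 := AGM3_pairs u0 v0 w0 e.
have sq (x y : R) : 0 < x -> 0 < y -> x <= 1085 / 1000 -> y <= 1085 / 1000 ->
    (x ^+ 2 - y ^+ 2) ^+ 2 <= 4725 / 1000 * (x - y) ^+ 2.
  move=> x0 y0 hx hy; rewrite subr_sqr exprMn mulrC ler_wpM2r ?sqr_ge0 //.
  clear -x0 y0 hx hy; nra.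
have := sq u v u0 v0 hu hv; have := sq v w v0 w0 hv hw; have := sq w u w0 u0 hw hu.
clear -h3; nra.
Qed.

(** The linear terms add up to [- pi (d0 + d1 + d2) <= 0] and are dropped; only squares of the
    deviations remain. *)
Lemma orbit_exp_le (S d0 d1 d2 X k : R) : 0 <= d0 + d1 + d2 -> 0 < X -> 1 / 2 <= k ->
  expR X <= 1 + X + k * X ^+ 2 -> - (pi * d0) <= X -> - (pi * d1) <= X -> - (pi * d2) <= X ->
  expR (- pi * (S + d0)) + expR (- pi * (S + d1)) + expR (- pi * (S + d2)) <=
  3 * expR (- pi * S) + expR (- pi * S) * (k * pi ^+ 2 * (d0 ^+ 2 + d1 ^+ 2 + d2 ^+ 2)).
Proof.
move=> hd X0 k2 hX h0 h1 h2.
have sp (d : R) : expR (- pi * (S + d)) = expR (- pi * S) * expR (- (pi * d)).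
  by rewrite -expRD; congr expR; ring.
rewrite !sp.
have := expR_le_quad h0 X0 k2 hX; have := expR_le_quad h1 X0 k2 hX.
have := expR_le_quad h2 X0 k2 hX.
set e0 := expR (- (pi * d0)); set e1 := expR (- (pi * d1)); set e2 := expR (- (pi * d2)).
set E := expR (- pi * S); have E0 : 0 <= E by exact: expR_ge0.
have hpd : 0 <= pi * d0 + pi * d1 + pi * d2 by rewrite -!mulrDr mulr_ge0 ?pi_ge0.
move=> a2 a1 a0.
have -> : E * e0 + E * e1 + E * e2 = E * (e0 + e1 + e2) by ring.
have -> : 3 * E + E * (k * pi ^+ 2 * (d0 ^+ 2 + d1 ^+ 2 + d2 ^+ 2)) =
  E * (3 + k * pi ^+ 2 * (d0 ^+ 2 + d1 ^+ 2 + d2 ^+ 2)) by ring.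
rewrite ler_wpM2l //; clear -a0 a1 a2 hpd; nra.
Qed.

(** The deviations of an orbit split into the spread of the weights times that of the conjugates,
    plus a term in the mean weight which is quadratic in [mu]. *)
Lemma orbit_sqr_sum (a b c x y z : R) :
  3 * ((a * x + b * y + c * z - (x + y + z)) ^+ 2 +
  (a * y + b * z + c * x - (x + y + z)) ^+ 2 +
  (a * z + b * x + c * y - (x + y + z)) ^+ 2) =
  ((x + y + z) ^+ 2 - 3 * (x * y + y * z + z * x)) *
    ((a - b) ^+ 2 + (b - c) ^+ 2 + (c - a) ^+ 2) +
  (x + y + z) ^+ 2 * (a + b + c - 3) ^+ 2.
Proof. ring. Qed.

(** For [T2 = 5]: the norm drops by at most [5 - 4.43 = 0.57], and [3.2 * 0.57 = 1.824]. *)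
Lemma exp_up1 : expR (1824 / 1000) <= 1 + 1824 / 1000 + 105 / 100 * (1824 / 1000) ^+ 2 :> R.
Proof.
have h0 : expR (1824 / 1000 / 16) <= 11213 / 10000 :> R.
  apply: le_trans (expR_small_le _ _) _; [by clear; lra..|].
  by rewrite ler_pdivrMr; clear; lra.
have {h0} h1 : expR (1824 / 1000 / 8) <= 12574 / 10000 :> R by apply: expR_double_le h0 _; lra.
have {h1} h2 : expR (1824 / 1000 / 4) <= 15811 / 10000 :> R by apply: expR_double_le h1 _; lra.
have {h2} h3 : expR (1824 / 1000 / 2) <= 25 / 10 :> R by apply: expR_double_le h2 _; lra.
by apply: expR_double_le h3 _; lra.
Qed.

(** For [T2 <= 7]: the squared weights are at least [0.846], and [3.2 * 0.154 * 7] is just below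
    [3.45]. *)
Lemma exp_up2 : expR (345 / 100) <= 1 + 345 / 100 + 24 / 10 * (345 / 100) ^+ 2 :> R.
Proof.
have h0 : expR (345 / 100 / 32) <= 11143 / 10000 :> R.
  apply: le_trans (expR_small_le _ _) _; [by clear; lra..|].
  by rewrite ler_pdivrMr; clear; lra.
have {h0} h1 : expR (345 / 100 / 16) <= 12417 / 10000 :> R by apply: expR_double_le h0 _; lra.
have {h1} h2 : expR (345 / 100 / 8) <= 1542 / 1000 :> R by apply: expR_double_le h1 _; lra.
have {h2} h3 : expR (345 / 100 / 4) <= 2378 / 1000 :> R by apply: expR_double_le h2 _; lra.
have {h3} h4 : expR (345 / 100 / 2) <= 566 / 100 :> R by apply: expR_double_le h3 _; lra.
by apply: expR_double_le h4 _; lra.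
Qed.

Lemma exp_pi_le : expR (- pi) <= 1 / 20 :> R.
Proof.
have hp := @pi_ge R.
have h0 : 4678 / 1000 <= expR (313 / 100 / 2) :> R.
  by apply: le_trans (expR_ge_quartic _); clear; lra.
have {h0} h1 : 20 <= expR (313 / 100) :> R by apply: expR_double_ge h0 _; clear; lra.
by apply: (expRN_le _ h1) => //; clear; lra.
Qed.

(** Second order loss of an orbit per unit of [mu]: [K5] when [T2 < 8], and [K8] times
    [e^{- pi T2 / 10}] otherwise. The factor [24] exceeds [1.05 (3.15 * 7 + 25 / 150)], and [102]
    exceeds [(1/2) * 3.17 * 64]. *)
Definition K5 : R := 24 * pi ^+ 2 * expR (- pi * 5).
Definition K8 : R := 102 * pi ^+ 2 * expR (- pi * (596 / 100)).

Lemma sqr_le_exp (S : R) : 8 <= S -> S ^+ 2 <= 64 * expR (pi * (746 / 1000 * (S - 8))).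
Proof.
move=> S8; have hp0 := @pi_ge R.
have e1 : S / 8 <= expR (S / 8 - 1) by have := expR_ge1Dx (S / 8 - 1); clear; lra.
have e2 : (S / 8) ^+ 2 <= expR (2 * (S / 8 - 1)).
  rewrite expRM_natl; have := expR_gt0 (S / 8 - 1); move: (expR _) e1 => E e1 E0.
  by rewrite lerXn2r ?nnegrE ?(ltW E0) //; clear -S8; lra.
have e3 : expR (2 * (S / 8 - 1)) <= expR (pi * (746 / 1000 * (S - 8))).
  by rewrite ler_expR; clear -S8 hp0; nra.
by move: e2 e3; move: (expR _) (expR _) => A B; clear; lra.
Qed.

Lemma X8_gt0 (S : R) : 8 <= S -> 0 < pi * (154 / 1000 * S).
Proof. by move=> S8; apply: mulr_gt0; [exact: pi_gt0|lra]. Qed.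

Lemma X8_le (S d : R) : - (154 / 1000) * S <= d -> - (pi * d) <= pi * (154 / 1000 * S).
Proof. by move=> hd; rewrite -mulrN ler_pM2l ?pi_gt0; lra. Qed.

(** As [0.154 + 0.746 = 0.9], a tenth of the exponent survives for summation; [5.968] is
    [8 * 0.746]. *)
Lemma exp_collect (S : R) :
  expR (- pi * S) * expR (pi * (154 / 1000 * S)) * expR (pi * (746 / 1000 * (S - 8))) =
  expR (- pi * (5968 / 1000)) * expR (- (pi / 10) * S).
Proof. by rewrite -!expRD; congr expR; field. Qed.

Lemma K8_const : 1 / 2 * (317 / 100) * 64 <= 102 :> R.
Proof. lra. Qed.

Lemma K8_const0 : 0 <= 1 / 2 * (317 / 100) * 64 :> R.
Proof. lra. Qed.

Lemma exp_5968 : expR (- pi * (5968 / 1000)) <= expR (- pi * (596 / 100)) :> R.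
Proof. by rewrite ler_expR; have := @pi_gt0 R; lra. Qed.

Section Orbit.
Variables a b c x y z mu : R.
Hypotheses (a0 : 846 / 1000 <= a) (b0 : 846 / 1000 <= b) (c0 : 846 / 1000 <= c).
Hypotheses (abc : a + b + c = 3 + mu) (mu0 : 0 <= mu) (mu1 : mu <= 2 / 100).
Hypothesis W : (a - b) ^+ 2 + (b - c) ^+ 2 + (c - a) ^+ 2 <= 945 / 100 * mu.
Hypotheses (x0 : 0 <= x) (y0 : 0 <= y) (z0 : 0 <= z).
(** In the application [a], [b], [c] are the squared weights and [x], [y], [z] the squared
    conjugates of [f]; then [S] is [T2 f] and [Q0], [Q1], [Q2] are the norms of the three
    conjugates. *)
Let S := x + y + z.
Let Q0 := a * x + b * y + c * z.
Let Q1 := a * y + b * z + c * x.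
Let Q2 := a * z + b * x + c * y.

Lemma orbit_sum : 0 <= (Q0 - S) + (Q1 - S) + (Q2 - S).
Proof.
have -> : (Q0 - S) + (Q1 - S) + (Q2 - S) = mu * S.
  have muE : mu = a + b + c - 3 by rewrite abc; ring.
  by rewrite muE /Q0 /Q1 /Q2 /S; ring.
by rewrite mulr_ge0 // /S !addr_ge0.
Qed.

(** The identity [orbit_sqr_sum] divided by [3]: [9.45 / 3 = 3.15], and [mu^2 <= mu / 50] produces
    [S^2 / 150]. *)
Lemma orbit_sqr_le (B : R) : S ^+ 2 - 3 * (x * y + y * z + z * x) <= B -> 0 <= B ->
  (Q0 - S) ^+ 2 + (Q1 - S) ^+ 2 + (Q2 - S) ^+ 2 <=
  (315 / 100 * B + S ^+ 2 / 150) * mu.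
Proof.
move=> hB B0; have := orbit_sqr_sum a b c x y z; rewrite -/S -/Q0 -/Q1 -/Q2.
have -> : a + b + c - 3 = mu by rewrite abc; ring.
set D := _ + _ + (Q2 - S) ^+ 2; move: hB.
have : 0 <= S ^+ 2 - 3 * (x * y + y * z + z * x).
  have := sqr_ge0 (x - y); have := sqr_ge0 (y - z); have := sqr_ge0 (z - x).
  by rewrite /S; nra.
move: (S ^+ 2 - _) => V V0 VB.
have h1 : V * ((a - b) ^+ 2 + (b - c) ^+ 2 + (c - a) ^+ 2) <= B * (945 / 100 * mu).
  by apply: ler_pM => //; rewrite !addr_ge0 ?sqr_ge0.
have h2 : S ^+ 2 * mu ^+ 2 <= S ^+ 2 * (2 / 100 * mu).
  by rewrite ler_wpM2l ?sqr_ge0 // expr2 ler_wpM2r.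
move=> e; lra.
Qed.

Lemma orbit_lower : [/\ - (154 / 1000) * S <= Q0 - S,
  - (154 / 1000) * S <= Q1 - S & - (154 / 1000) * S <= Q2 - S].
Proof.
have m (w t : R) : 846 / 1000 <= w -> 0 <= t -> 846 / 1000 * t <= w * t.
  by move=> hw ht; rewrite ler_wpM2r.
rewrite /Q0 /Q1 /Q2 /S; split.
- by have := m _ _ a0 x0; have := m _ _ b0 y0; have := m _ _ c0 z0; lra.
- by have := m _ _ a0 y0; have := m _ _ b0 z0; have := m _ _ c0 x0; lra.
- by have := m _ _ a0 z0; have := m _ _ b0 x0; have := m _ _ c0 y0; lra.
Qed.

Lemma orbit_shift (Q : R) : Q = S + (Q - S). Proof. by rewrite addrC subrK. Qed.

Let E3 := expR (- pi * Q0) + expR (- pi * Q1) + expR (- pi * Q2).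

Lemma orbit5 : S = 5 -> 6 <= x * y + y * z + z * x ->
  443 / 100 <= Q0 -> 443 / 100 <= Q1 -> 443 / 100 <= Q2 ->
  E3 <= 3 * expR (- pi * S) + mu * K5.
Proof.
move=> S5 hd h0 h1 h2; have hp := @pi_le R; have hp0 := @pi_ge0 R.
rewrite /E3 (orbit_shift Q0) (orbit_shift Q1) (orbit_shift Q2).
have X (Q : R) : 443 / 100 <= Q -> - (pi * (Q - S)) <= 1824 / 1000.
  by move=> hQ; rewrite S5; move: hQ hp hp0; nra.
apply: le_trans (orbit_exp_le _ orbit_sum _ _ exp_up1 (X _ h0) (X _ h1) (X _ h2)) _;
  [by lra..|].
rewrite lerD2l /K5.
have hV : S ^+ 2 - 3 * (x * y + y * z + z * x) <= 7 by rewrite S5; move: hd; lra.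
have := orbit_sqr_le hV ltac:(lra); set D := _ + _ + (Q2 - S) ^+ 2.
rewrite S5; set E := expR (- pi * 5) => hD.
have E0 : 0 <= E by exact: expR_ge0.
have -> : mu * (24 * pi ^+ 2 * E) = E * pi ^+ 2 * (24 * mu) by ring.
have -> : E * (105 / 100 * pi ^+ 2 * D) = E * pi ^+ 2 * (105 / 100 * D) by ring.
rewrite ler_wpM2l ?mulr_ge0 ?sqr_ge0 //; move: hD mu0; lra.
Qed.

Lemma xyz_ge0 : 0 <= x * y + y * z + z * x. Proof. by rewrite !addr_ge0 ?mulr_ge0. Qed.

Lemma orbit67 : 6 <= S -> S <= 7 -> E3 <= 3 * expR (- pi * S) + mu * K5.
Proof.
move=> S6 S7; have hp := @pi_le R; have hp0 := @pi_ge R; have [h0 h1 h2] := orbit_lower.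
rewrite /E3 (orbit_shift Q0) (orbit_shift Q1) (orbit_shift Q2).
have X (d : R) : - (154 / 1000) * S <= d -> - (pi * d) <= 345 / 100.
  move=> hd; have : - d <= 1078 / 1000 by move: hd S7; lra.
  by move: hp hp0; nra.
apply: le_trans (orbit_exp_le _ orbit_sum _ _ exp_up2 (X _ h0) (X _ h1) (X _ h2)) _;
  [by lra..|].
rewrite lerD2l /K5.
have hV : S ^+ 2 - 3 * (x * y + y * z + z * x) <= S ^+ 2 by have := xyz_ge0; lra.
have := orbit_sqr_le hV (sqr_ge0 S); set D := _ + _ + (Q2 - S) ^+ 2 => hD.
have hD' : D <= 155 * mu.
  apply: le_trans hD _; rewrite ler_wpM2r //.
  have : S ^+ 2 <= 49 by move: S6 S7; nra.
  by lra.
(* The extra unit in [S] gains a factor [20], which brings the constant [2.4 * 155] down below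
   [24]. *)
have hE : expR (- pi * S) <= expR (- pi * 5) * (1 / 20).
  apply: (@le_trans _ _ (expR (- pi * 5) * expR (- pi))).
    by rewrite -expRD ler_expR; move: S6 hp0; nra.
  by rewrite ler_wpM2l ?expR_ge0 ?exp_pi_le.
set E := expR (- pi * S) in hE *; set E5 := expR (- pi * 5) in hE *.
have E0 : 0 <= E by exact: expR_ge0.
apply: (@le_trans _ _ (E * (24 / 10 * pi ^+ 2 * (155 * mu)))).
  by rewrite ler_wpM2l // ler_wpM2l // mulr_ge0 // sqr_ge0.
have -> : E * (24 / 10 * pi ^+ 2 * (155 * mu)) = pi ^+ 2 * mu * (372 * E) by field.
have -> : mu * (24 * pi ^+ 2 * E5) = pi ^+ 2 * mu * (24 * E5) by ring.
rewrite ler_wpM2l ?mulr_ge0 ?sqr_ge0 //; move: hE E0; lra.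
Qed.

Lemma orbit8 : 8 <= S -> E3 <= 3 * expR (- pi * S) + mu * (K8 * expR (- (pi / 10) * S)).
Proof.
move=> S8; have hp0 := @pi_ge R; have [h0 h1 h2] := orbit_lower.
rewrite /E3 (orbit_shift Q0) (orbit_shift Q1) (orbit_shift Q2).
have pp := @pi_gt0 R; pose X : R := pi * (154 / 1000 * S).
have X0 : 0 < X := X8_gt0 S8.
have XQ (d : R) : - (154 / 1000) * S <= d -> - (pi * d) <= X.
  by move=> hd; exact: X8_le.
have k2 : 1 / 2 <= expR X / 2.
  by have := expR_ge1Dx X; move: X0; lra.
apply: le_trans (orbit_exp_le _ orbit_sum X0 k2 (expR_le_quad_expR (lexx X) X0)
  (XQ _ h0) (XQ _ h1) (XQ _ h2)) _.
rewrite lerD2l /K8.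
have hV : S ^+ 2 - 3 * (x * y + y * z + z * x) <= S ^+ 2 by have := xyz_ge0; lra.
have := orbit_sqr_le hV (sqr_ge0 S); set D := _ + _ + (Q2 - S) ^+ 2 => hD.
have {}hD : D <= 317 / 100 * S ^+ 2 * mu.
  by apply: le_trans hD _; rewrite ler_wpM2r //; have := sqr_ge0 S; lra.
have hS := sqr_le_exp S8.
set E := expR (- pi * S); have E0 : 0 <= E by exact: expR_ge0.
apply: (@le_trans _ _ (E * (expR X / 2 * pi ^+ 2 * (317 / 100 *
    (64 * expR (pi * (746 / 1000 * (S - 8)))) * mu)))).
  apply: ler_wpM2l; first exact: E0.
  apply: ler_wpM2l; first by rewrite mulr_ge0 ?sqr_ge0 // divr_ge0 ?expR_ge0.
  apply: le_trans hD _; apply: ler_wpM2r; first exact: mu0.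
  by apply: ler_wpM2l; [apply: divr_ge0; exact: ler0n | exact: hS].
have -> : E * (expR X / 2 * pi ^+ 2 * (317 / 100 *
    (64 * expR (pi * (746 / 1000 * (S - 8)))) * mu)) =
   1 / 2 * (317 / 100) * 64 * (pi ^+ 2 * mu * (E * expR X * expR (pi * (746 / 1000 * (S - 8))))).
  by ring.
rewrite exp_collect.
have -> : mu * (102 * pi ^+ 2 * expR (- pi * (596 / 100)) * expR (- (pi / 10) * S)) =
   102 * (pi ^+ 2 * mu * (expR (- pi * (596 / 100)) * expR (- (pi / 10) * S))) by ring.
apply: ler_pM.
- exact: K8_const0.
- apply: mulr_ge0; first by apply: mulr_ge0; [exact: sqr_ge0 | exact: mu0].
  by apply: mulr_ge0; exact: expR_ge0.
- exact: K8_const.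
- apply: ler_wpM2l; first by apply: mulr_ge0; [exact: sqr_ge0 | exact: mu0].
  by apply: ler_wpM2r; [exact: expR_ge0 | exact: exp_5968].
Qed.

End Orbit.

(** The gain is tripled because orbit sums count every vector three times. Divided by [q^3], the
    left side is below [15 mu] and the right side at least [18 mu]. *)
Lemma local_numeric (mu : R) : 0 < mu -> mu <= 2 / 100 ->
  mu * (12 * K5 + 80 * K8) < 6 * (expR (- pi * 3) - expR (- pi * (3 + mu))).
Proof.
move=> mu0 mu1; have hp := @pi_ge R; have hp' := @pi_le R.
set q3 := expR (- pi * 3); have q30 : 0 < q3 by exact: expR_gt0.
have e5 : expR (- pi * 5) = q3 * expR (- (pi * 2)) by rewrite -expRD; congr expR; lra.
have e8 : expR (- pi * (596 / 100)) = q3 * expR (- (pi * (296 / 100))).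
  by rewrite -expRD; congr expR; lra.
have em : expR (- pi * (3 + mu)) = q3 * expR (- (pi * mu)) by rewrite -expRD; congr expR; lra.
have h5 : expR (- (pi * 2)) <= 1 / 500 :> R.
  by apply: (expRN_le _ (@exp_625 R)); clear -hp; lra.
have h8 : expR (- (pi * (296 / 100))) <= 1 / (1000 * 10) :> R.
  by apply: (expRN_le _ (@exp_925 R)); clear -hp; lra.
have pm0 : 0 <= pi * mu by rewrite mulr_ge0 ?pi_ge0 ?ltW.
have hm : 3 * mu <= 1 - expR (- (pi * mu)).
  have := @expR_le_quad_le0 R (- (pi * mu)); rewrite oppr_le0 pm0 => /(_ isT).
  have pm1 : pi * mu <= 32 / 10 * (2 / 100) by apply: ler_pM hp' mu1; [exact: pi_ge0 | exact: ltW].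
  have pm2 : 313 / 100 * mu <= pi * mu by rewrite ler_pM2r.
  move: (expR _) pm0 pm1 pm2; move: (pi * mu) => P E P0 P1 P2.
  by rewrite sqrrN => h; have h' : P ^+ 2 <= 64 / 1000 * P; [by clear -P0 P1; nra | clear -h h' P2 mu0; lra].
have p2 : pi ^+ 2 <= 1024 / 100 :> R by clear -hp hp'; nra.
rewrite /K5 /K8 e5 e8 em.
set A := expR (- (pi * 2)) in h5 *; set B := expR (- (pi * (296 / 100))) in h8 *.
set C := expR (- (pi * mu)) in hm *.
have A0 : 0 <= A by exact: expR_ge0.
have B0 : 0 <= B by exact: expR_ge0.
have pA : pi ^+ 2 * A <= 1024 / 100 * (1 / 500) by apply: ler_pM => //; exact: sqr_ge0.
have pB : pi ^+ 2 * B <= 1024 / 100 * (1 / (1000 * 10)) by apply: ler_pM => //; exact: sqr_ge0.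
have -> : mu * (12 * (24 * pi ^+ 2 * (q3 * A)) + 80 * (102 * pi ^+ 2 * (q3 * B))) =
   q3 * (mu * (288 * (pi ^+ 2 * A) + 8160 * (pi ^+ 2 * B))) by ring.
have -> : 6 * (q3 - q3 * C) = q3 * (6 * (1 - C)) by ring.
rewrite ltr_pM2l //.
apply: lt_le_trans (_ : mu * 18 <= _); last by clear -hm; lra.
by rewrite ltr_pM2l //; clear -pA pB; lra.
Qed.

End Local.

(** * Weighted norms *)

Lemma weighted_AGM3 (R : realFieldType) (a b c p q r : R) :
  0 < a -> 0 < b -> 0 < c -> a * b * c = 1 -> 0 <= p -> 0 <= q -> 0 <= r ->
  27 * (p * q * r) <= (a * p + b * q + c * r) ^+ 3.
Proof.
move=> a0 b0 c0 abc p0 q0 r0.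
have := AGM3 (mulr_ge0 (ltW a0) p0) (mulr_ge0 (ltW b0) q0) (mulr_ge0 (ltW c0) r0).
have -> : a * p * (b * q) * (c * r) = (a * b * c) * (p * q * r) by ring.
by rewrite abc mul1r.
Qed.

Lemma le_of_cube (R : realFieldType) (k P X : R) :
  0 <= X -> k ^+ 3 <= 27 * P -> 27 * P <= X ^+ 3 -> k <= X.
Proof.
move=> X0 kP PX; rewrite leNgt; apply/negP => Xk.
have : X ^+ 3 < k ^+ 3 by rewrite ltrXn2r // ?nnegrE // ltW // (le_lt_trans X0).
by rewrite ltNge (le_trans kP PX).
Qed.

(** The integers are least values of [t^3 + t^2 T2 + t T2d + N2]: from [(T2, T2d, N2) = (5, 6, 1)]
    come [91] at [t = 3] and [41] at [t = 2]; from [(8, 5, 1)] come [115] and [51]. The last one is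
    [5 * 6 - 1]. *)
Lemma cube_constants (R : realFieldType) : [/\ (1349 / 100) ^+ 3 <= 27 * 91 :> R,
  (1034 / 100) ^+ 3 <= 27 * 41 :> R, (1458 / 100) ^+ 3 <= 27 * 115 :> R,
  (1112 / 100) ^+ 3 <= 27 * 51 :> R & (92 / 10) ^+ 3 <= 27 * 29 :> R].
Proof. split; lra. Qed.

Section Bounds.
Variables (R : realType) (F : splittingFieldType rat).
Variables (sigma : gal_of {:F}) (iota : {rmorphism F -> R}).
Hypothesis galF : galois 1 {:F}.
Hypothesis genF : 'Gal({:F} / 1)%g = <[sigma]>%g.
Hypothesis ordF : #|'Gal({:F} / 1)%g| = 3%N.
Local Notation OF := (@ring_of_integers F).
Implicit Types f g : F.
Local Notation T2 := (sumsq sigma iota).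
Local Notation T2d := (sumsq_dual sigma iota).
Local Notation N2 := (sqnorm sigma iota).

Definition wnorm (a b c : R) f : R :=
  a * iota f ^+ 2 + b * iota (sigma f) ^+ 2 + c * iota (sigma (sigma f)) ^+ 2.

Local Notation wq := wnorm.

Lemma T2_le_of_lt f (n : nat) : OF f -> T2 f < n.+1%:R -> T2 f <= n%:R.
Proof.
move=> /(T2_int iota galF genF ordF)[k ->].
rewrite -[n.+1%:R]/((n.+1 : int)%:~R) -[n%:R]/((n : int)%:~R) ltr_int ler_int; lia.
Qed.

Lemma nonfixed_cases f : OF f -> sigma f != f ->
  [/\ 1 <= N2 f, 5 <= T2 f, 5 <= T2d f & (T2 f = 5 /\ 6 <= T2d f) \/ 6 <= T2 f].
Proof.
move=> Of sf; have T5 := T2_ge5 iota galF genF ordF Of sf.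
have Td5 := T2d_ge5 iota galF genF ordF Of sf.
have f0 : f != 0 by apply: contraNneq sf => ->; rewrite rmorph0.
split=> //.
  have [n n1 ->] := N2_ge1 iota galF genF ordF Of f0.
  by rewrite -[1]/(1%:~R) ler_int; nia.
have [h|h] := leP 6 (T2 f); [by right | left].
split; last by apply: T2d_ge6 => //.
by apply/eqP; rewrite eq_le T5 andbT (T2_le_of_lt (n := 5)).
Qed.

Lemma prod_shift f (t : R) : (t + iota f ^+ 2) * (t + iota (sigma f) ^+ 2) *
  (t + iota (sigma (sigma f)) ^+ 2) = t ^+ 3 + t ^+ 2 * T2 f + t * T2d f + N2 f.
Proof. by rewrite (T2dE iota genF ordF) /sumsq /sqnorm; ring. Qed.

Variables a b c : R.
Hypotheses (a0 : 0 < a) (b0 : 0 < b) (c0 : 0 < c) (abc : a * b * c = 1).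
Local Notation Q := (wq a b c).
Local Notation lam := (a + b + c).

Lemma wq_ge0 f : 0 <= Q f.
Proof. by rewrite /wnorm !addr_ge0 // mulr_ge0 ?sqr_ge0 // ltW. Qed.

(** The weighted inequality of the means for the three numbers [t + x^2], with [x] running over the
    conjugates: the weighted sum is [t lam + Q f], and the product brings in [T2] and [T2d] besides
    the norm. *)
Lemma wq_AGM f (t : R) : 0 <= t ->
  27 * (t ^+ 3 + t ^+ 2 * T2 f + t * T2d f + N2 f) <= (t * lam + Q f) ^+ 3.
Proof.
move=> t0; rewrite -prod_shift.
have := weighted_AGM3 a0 b0 c0 abc (addr_ge0 t0 (sqr_ge0 (iota f)))
  (addr_ge0 t0 (sqr_ge0 (iota (sigma f)))) (addr_ge0 t0 (sqr_ge0 (iota (sigma (sigma f))))).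
by move/le_trans; apply; rewrite /wnorm le_eqVlt; apply/orP; left; apply/eqP; ring.
Qed.

Lemma wq_bound f (t k P : R) : 0 <= t -> k ^+ 3 <= 27 * P ->
  P <= t ^+ 3 + t ^+ 2 * T2 f + t * T2d f + N2 f -> k - t * lam <= Q f.
Proof.
move=> t0 kP hP; rewrite lerBlDl.
apply: (@le_of_cube _ _ (t ^+ 3 + t ^+ 2 * T2 f + t * T2d f + N2 f)).
- by rewrite addr_ge0 ?wq_ge0 // mulr_ge0 // !addr_ge0 // ltW.
- by apply: le_trans kP _; rewrite ler_pM2l.
- exact: wq_AGM.
Qed.

Lemma wq_bound3 f : OF f -> sigma f != f -> 1349 / 100 - 3 * lam <= Q f.
Proof.
move=> Of sf; have [hN h5 hd hc] := nonfixed_cases Of sf; have [kP _ _ _ _] := cube_constants R.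
by apply: wq_bound kP _ => //; case: hc => [[-> h6]|h6]; lra.
Qed.

Lemma wq_bound2 f : OF f -> sigma f != f -> 1034 / 100 - 2 * lam <= Q f.
Proof.
move=> Of sf; have [hN h5 hd hc] := nonfixed_cases Of sf; have [_ kP _ _ _] := cube_constants R.
by apply: wq_bound kP _ => //; case: hc => [[-> h6]|h6]; lra.
Qed.

Lemma wq_bound3_8 f : OF f -> sigma f != f -> 8 <= T2 f -> 1458 / 100 - 3 * lam <= Q f.
Proof.
move=> Of sf h8; have [hN _ hd _] := nonfixed_cases Of sf; have [_ _ kP _ _] := cube_constants R.
by apply: wq_bound kP _ => //; lra.
Qed.

Lemma wq_bound2_8 f : OF f -> sigma f != f -> 8 <= T2 f -> 1112 / 100 - 2 * lam <= Q f.
Proof.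
move=> Of sf h8; have [hN _ hd _] := nonfixed_cases Of sf; have [_ _ _ kP _] := cube_constants R.
by apply: wq_bound kP _ => //; lra.
Qed.

Lemma wq_ge3 f : OF f -> f != 0 -> 3 <= Q f.
Proof.
move=> Of f0; have [n n1 hN] := N2_ge1 iota galF genF ordF Of f0.
apply: (@le_of_cube _ _ (N2 f)); first exact: wq_ge0.
  have : 1 <= N2 f by rewrite hN -[1]/(1%:~R) ler_int; nia.
  lra.
by have := @wq_AGM f 0 (lexx 0); rewrite !expr0n /= !mul0r !add0r.
Qed.

(** For norm [1] or [-1] the product [T2 T2d] is at least [30]; otherwise [T2 T2d >= 9 N2] and
    [N2 >= 4] give [32]. *)
Lemma T2_T2d_N2 f : OF f -> sigma f != f -> 29 <= T2 f * T2d f - N2 f.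
Proof.
move=> Of sf; have [hN h5 hd hc] := nonfixed_cases Of sf.
have f0 : f != 0 by apply: contraNneq sf => ->; rewrite rmorph0.
have [n n1 nE] := N2_ge1 iota galF genF ordF Of f0.
have h9 : 9 * N2 f <= T2 f * T2d f.
  rewrite (T2dE iota genF ordF) /sumsq /sqnorm.
  set x := iota f; set y := iota (sigma f); set z := iota (sigma (sigma f)).
  have h (u v w : R) : 0 <= u ^+ 2 * (v ^+ 2 - w ^+ 2) ^+ 2 by rewrite mulr_ge0 ?sqr_ge0.
  have := h x y z; have := h y z x; have := h z x y; lra.
have [n2|n2] := leP 2 n.
  have n4 : 4 <= n * n by clear -n2; nia.
  have : 4 <= N2 f by rewrite nE -[4]/(4%:~R) ler_int.
  lra.
have n1' : n = 1 by clear -n1 n2; lia.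
by rewrite n1' in nE; rewrite nE; case: hc => [[-> h6]|h6]; nra.
Qed.

Lemma sigma_nonfixed f : sigma f != f -> sigma (sigma f) != sigma f.
Proof. by rewrite (inj_eq (fmorph_inj sigma)). Qed.

(** The means are applied to the sums of two squared conjugates: their product is [T2 T2d - N2],
    their weighted sum is [Q f + Q (sigma f)]. *)
Lemma wq_pair f : OF f -> sigma f != f -> 92 / 10 <= Q f + Q (sigma f).
Proof.
move=> Of sf; have [_ _ _ _ kP] := cube_constants R.
apply: (@le_of_cube _ _ (T2 f * T2d f - N2 f)); first by rewrite addr_ge0 ?wq_ge0.
  by apply: le_trans kP _; rewrite ler_pM2l // T2_T2d_N2.
have s2 g h : 0 <= iota g ^+ 2 + iota h ^+ 2 by rewrite addr_ge0 ?sqr_ge0.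
have := weighted_AGM3 a0 b0 c0 abc (s2 f (sigma f)) (s2 (sigma f) (sigma (sigma f)))
  (s2 (sigma (sigma f)) f).
set L := 27 * _; set r := _ ^+ 3; have -> : L = 27 * (T2 f * T2d f - N2 f).
  by rewrite /L (T2dE iota genF ordF) /sumsq /sqnorm; ring.
move/le_trans; apply; rewrite /r /wnorm !(sigma3 genF ordF).
by rewrite le_eqVlt; apply/orP; left; apply/eqP; ring.
Qed.

Lemma wq_parallelogram f g : Q (f + g) + Q (f - g) = 2 * Q f + 2 * Q g.
Proof. by rewrite /wnorm !(rmorphD, rmorphB) /=; ring. Qed.

Lemma wqN f : Q (- f) = Q f.
Proof. by rewrite /wnorm !rmorphN /= !sqrrN. Qed.

Lemma wq_int (n : int) : Q n%:~R = n%:~R ^+ 2 * lam.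
Proof. by rewrite /wnorm !rmorph_int; ring. Qed.

End Bounds.

(** * Residue classes modulo 2 *)

Definition oddz (k : int) : bool := odd (absz k).

Lemma oddzP k : exists m : int, k = m + m + (oddz k)%:Z.
Proof.
exists (k %/ 2)%Z; have := divz_eq k 2; rewrite /oddz.
by case: k => n /=; lia.
Qed.

Lemma oddz2 m (b : bool) : oddz (m + m + b%:Z) = b.
Proof. by rewrite /oddz; case: b; lia. Qed.

Lemma oddzD k l : oddz (k + l) = oddz k (+) oddz l.
Proof.
have [m em] := oddzP k; have [n en] := oddzP l.
rewrite {1}em {1}en; move: (oddz k) (oddz l) => [] [].
- by rewrite -[RHS](oddz2 (m + n + 1)); congr oddz; rewrite /=; lia.
- by rewrite -[RHS](oddz2 (m + n)); congr oddz; rewrite /=; lia.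
- by rewrite -[RHS](oddz2 (m + n)); congr oddz; rewrite /=; lia.
- by rewrite -[RHS](oddz2 (m + n)); congr oddz; rewrite /=; lia.
Qed.

Lemma oddzN k : oddz (- k) = oddz k.
Proof. by rewrite /oddz abszN. Qed.

Lemma oddzM k l : oddz (k * l) = oddz k && oddz l.
Proof. by rewrite /oddz abszM oddM. Qed.

Section Classes.
Variables (R : realType) (F : splittingFieldType rat).
Variables (sigma : gal_of {:F}) (iota : {rmorphism F -> R}).
Hypothesis galF : galois 1 {:F}.
Hypothesis genF : 'Gal({:F} / 1)%g = <[sigma]>%g.
Hypothesis ordF : #|'Gal({:F} / 1)%g| = 3%N.
Local Notation OF := (@ring_of_integers F).
Implicit Types f g : F.

(* Coordinates on the residue ring modulo 2: the parity of the trace and the parities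
   of the two nonconstant coordinates. *)
Lemma classes_exist : exists cls : F -> bool * (bool * bool),
 [/\ forall f g, OF f -> OF g -> cls f = cls g -> exists2 h, OF h & f - g = h + h,
     forall f, OF f -> (cls f).2 = (false, false) ->
       exists2 h, OF h & f = h + h \/ f = 1 + (h + h) &
     forall f, OF f ->
       cls (sigma f) = ((cls f).1, ((cls f).2.2, (cls f).2.1 (+) (cls f).2.2))].
Proof.
have [al [k [Oal sal basO kP kE]]] := OF_coordinates iota galF genF ordF.
have [t tE] : exists t : int, al + sigma al + sigma (sigma al) = t%:~R.
  apply: (OF_fixed_int galF genF).
    by do !apply: OFD => //; do ?apply: OF_sigma.
  by rewrite !rmorphD /= (sigma3 genF ordF); ring.
pose cls f := (oddz ((k f).1.1 + t * ((k f).1.2 + (k f).2)),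
  (oddz (k f).1.2, oddz (k f).2)).
exists cls; split.
- move=> f g Of Og; rewrite /cls => -[e1 e2 e3].
  rewrite (kP f Of) (kP g Og).
  move: e1 e2 e3; case: (k f) => -[n x] y; case: (k g) => -[n' x'] y' /= e1 e2 e3.
  have e1' : oddz n = oddz n'.
    by move: e1; rewrite !(oddzD, oddzM) e2 e3; move: (oddz n) (oddz n') (_ && _) => [] [] [].
  have [m em] := oddzP n; have [m' em'] := oddzP n'.
  have [p ep] := oddzP x; have [p' ep'] := oddzP x'.
  have [q eq] := oddzP y; have [q' eq'] := oddzP y'.
  exists ((m - m')%:~R + (p - p')%:~R * al + (q - q')%:~R * sigma al); first exact: basO.
  rewrite em em' ep ep' eq eq' e1' e2 e3 !intrD !intrN; ring.
- move=> f Of; rewrite /cls /= => -[ex ey]; rewrite (kP f Of).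
  move: ex ey; case: (k f) => -[n x] y /= ex ey.
  have [m em] := oddzP n; have [p ep] := oddzP x; have [q eq] := oddzP y.
  exists (m%:~R + p%:~R * al + q%:~R * sigma al); first exact: basO.
  rewrite em ep eq ex ey !intrD; case: (oddz n); [right|left]; rewrite /=; ring.
- move=> f Of; rewrite /cls {1 2 3 4 5}(kP f Of).
  case: (k f) => -[n x] y /=.
  have -> : sigma (n%:~R + x%:~R * al + y%:~R * sigma al) =
     (n + t * y)%:~R + (- y)%:~R * al + (x - y)%:~R * sigma al.
    rewrite !(rmorphD, rmorphM, rmorphN) /= !rmorph_int -tE; ring.
  rewrite kE /= !(oddzD, oddzN, oddzM).
  by move: (oddz n) (oddz t) (oddz x) (oddz y) => [] [] [] [].
Qed.

End Classes.

(** * Sums over short vectors *)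

Section Esum.
Variables (R : realType) (T : choiceType).
Implicit Types (X Y : set T) (g h : T -> R).

Lemma esum_le_finite X g (B : R) :
  (forall s : {fset T}, (forall x, x \in s -> X x) -> \sum_(x <- s) g x <= B) ->
  (\esum_(x in X) (g x)%:E <= B%:E)%E.
Proof.
move=> h; apply: ub_ereal_sup => _ [A [finA AX] <-].
rewrite fsbig_finite //= sumEFin lee_fin; apply: h => x.
by rewrite in_fset_set // inE => /AX.
Qed.

Lemma finite_le_esum X g (B : R) (s : {fset T}) :
  (forall x, x \in s -> X x) -> (\esum_(x in X) (g x)%:E <= B%:E)%E ->
  \sum_(x <- s) g x <= B.
Proof.
move=> sX; apply: contraTT; rewrite -!ltNge => hB.
apply: (@lt_le_trans _ _ (\sum_(x <- s) g x)%:E); first by rewrite lte_fin.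
apply: esum_ge; exists [set` s]; first by split => //; exact: finite_fset.
rewrite fsbig_finite ?set_fsetK; last exact: finite_fset.
by rewrite sumEFin.
Qed.

Lemma esum_le_scale X Y g h (k B : R) : Y `<=` X -> 0 <= k ->
  (forall x, Y x -> h x <= k * g x) -> (\esum_(x in X) (g x)%:E <= B%:E)%E ->
  (\esum_(x in Y) (h x)%:E <= (k * B)%:E)%E.
Proof.
move=> YX k0 hg gB; apply: esum_le_finite => s sY.
apply: (@le_trans _ _ (k * \sum_(x <- s) g x)).
  by rewrite mulr_sumr big_seq [leRHS]big_seq; apply: ler_sum => x /sY /hg.
by rewrite ler_wpM2l // (finite_le_esum _ gB) // => x /sY /YX.
Qed.

Lemma esum_EFinP X g (B : R) : (forall x, X x -> 0 <= g x) ->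
  (\esum_(x in X) (g x)%:E <= B%:E)%E ->
  exists2 r : R, 0 <= r <= B & \esum_(x in X) (g x)%:E = r%:E.
Proof.
move=> g0 gB; have : (0 <= \esum_(x in X) (g x)%:E)%E.
  by apply: esum_ge0 => x /g0; rewrite lee_fin.
move: gB; case: (\esum_(x in X) _) => [r| |] //.
by rewrite !lee_fin => rB r0; exists r; rewrite ?r0.
Qed.

End Esum.

Lemma esum_sign_classes (R : realType) (F : zmodType) (C : finType) (cls : F -> C)
  (X : set F) (g : F -> R) (M : C -> R) :
  (forall f, X f -> g f <= M (cls f)) -> (forall c, 0 <= M c) ->
  (forall f f', X f -> X f' -> cls f = cls f' -> f' = f \/ f' = - f) ->
  (\esum_(f in X) (g f)%:E <= (\sum_c 2 * M c)%:E)%E.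
Proof.
move=> gM M0 inj; apply: esum_le_finite => s sX.
apply: (@le_trans _ _ (\sum_(f <- s) M (cls f))).
  by rewrite big_seq [leRHS]big_seq; apply: ler_sum => f /sX /gM.
rewrite (partition_big cls predT) //=; apply: ler_sum => c _.
rewrite (eq_bigr (fun _ => M c)); last by move=> f /eqP ->.
rewrite big_const_seq iter_addr_0 -[M c *+ _]mulr_natl ler_wpM2r //.
rewrite ler_nat -size_filter.
case E : [seq f <- s | cls f == c] => [//|v t].
have vs : v \in s /\ cls v = c.
  have : v \in [seq f <- s | cls f == c] by rewrite E mem_head.
  by rewrite mem_filter => /andP[/eqP].
have -> : size (v :: t) = size [seq f <- s | cls f == c] by rewrite E.
apply: (@uniq_leq_size _ _ [:: v; - v]); first by rewrite filter_uniq ?fset_uniq.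
move=> f; rewrite mem_filter => /andP[/eqP fc fs].
have [|->|->] := inj v f (sX _ vs.1) (sX _ fs); first by rewrite fc vs.2.
  by rewrite mem_head.
by rewrite !inE eqxx orbT.
Qed.

Lemma sum_bool3 (R : realType) (G : bool * (bool * bool) -> R) :
  \sum_c G c = \sum_(b : bool) (G (b, (false, false)) + G (b, (true, false)) +
     G (b, (false, true)) + G (b, (true, true))).
Proof.
have -> : \sum_c G c = \sum_(b : bool) \sum_(p : bool * bool) G (b, p).
  by rewrite pair_bigA; apply: eq_bigr => -[].
apply: eq_bigr => b _.
have -> : \sum_(p : bool * bool) G (b, p) = \sum_(x : bool) \sum_(y : bool) G (b, (x, y)).
  by rewrite pair_bigA; apply: eq_bigr => -[].
rewrite !big_bool /=.
ring.
Qed.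

(** * Series over the irrational integers *)

Section Sums.
Variables (R : realType) (F : splittingFieldType rat).
Variables (sigma : gal_of {:F}) (iota : {rmorphism F -> R}).
Hypothesis galF : galois 1 {:F}.
Hypothesis genF : 'Gal({:F} / 1)%g = <[sigma]>%g.
Hypothesis ordF : #|'Gal({:F} / 1)%g| = 3%N.
Local Notation OF := (@ring_of_integers F).
Implicit Types f g h : F.
Local Notation T2 := (sumsq sigma iota).
Local Notation T2d := (sumsq_dual sigma iota).
Local Notation wq := (wnorm sigma iota).

Definition irrational_integers : set F := [set f | OF f /\ sigma f != f].

Local Notation NF := irrational_integers.

Lemma T2_wq f : T2 f = wq 1 1 1 f.
Proof. by rewrite /sumsq /wnorm !mul1r. Qed.

Lemma T2_sigma f : T2 (sigma f) = T2 f.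
Proof. by rewrite /sumsq (sigma3 genF ordF); ring. Qed.

Lemma NF_sigma f : NF f -> NF (sigma f).
Proof. by case=> Of sf; split; [exact: OF_sigma | exact: sigma_nonfixed]. Qed.

Lemma nonzero_NF f : NF f -> f != 0.
Proof. by case=> _; apply: contraNneq => ->; rewrite rmorph0. Qed.

Lemma esum_tenth (I : set F) (u v w : R) :
  (forall f g, I f -> I g -> I (f - g)) ->
  (forall f, I f -> f != 0 -> 3 <= wq (u ^+ 2) (v ^+ 2) (w ^+ 2) f) ->
  (\esum_(f in I) (expR (- (pi / 10) * wq (u ^+ 2) (v ^+ 2) (w ^+ 2) f))%:E <= 80%:E)%E.
Proof.
move=> IB I3.
have := @esum_cubes R F I (fun f => u * iota f) (fun f => v * iota (sigma f))
  (fun f => w * iota (sigma (sigma f))).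
rewrite /= (_ : (fun f => _) = (fun f => (expR (- (pi / 10) * wq (u ^+ 2) (v ^+ 2) (w ^+ 2) f))%:E)); last first.
  by apply/funext => f; rewrite /wnorm !exprMn.
apply=> f g If Ig fg; have := I3 _ (IB _ _ If Ig); rewrite subr_eq0 fg => /(_ isT).
by rewrite /wnorm !rmorphB /= -!exprMn !mulrBr.
Qed.

Lemma exp_tenth (N t : R) : N <= t ->
  expR (- pi * t) <= expR (- pi * (9 / 10 * N)) * expR (- (pi / 10) * t).
Proof.
move=> Nt; rewrite -expRD ler_expR.
have -> : - pi * t = - pi * (9 / 10 * t) + - (pi / 10) * t by field.
by rewrite lerD2r !mulNr lerN2 ler_wpM2l ?pi_ge0 // ler_wpM2l.
Qed.

Lemma esum_tail (I X : set F) (u v w N : R) :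
  (forall f g, I f -> I g -> I (f - g)) ->
  (forall f, I f -> f != 0 -> 3 <= wq (u ^+ 2) (v ^+ 2) (w ^+ 2) f) ->
  X `<=` I -> (forall f, X f -> N <= wq (u ^+ 2) (v ^+ 2) (w ^+ 2) f) ->
  (\esum_(f in X) (expR (- pi * wq (u ^+ 2) (v ^+ 2) (w ^+ 2) f))%:E
    <= (expR (- pi * (9 / 10 * N)) * 80)%:E)%E.
Proof.
move=> IB I3 XI XN; apply: esum_le_scale XI (expR_ge0 _) _ (esum_tenth IB I3).
by move=> f Xf; apply: exp_tenth; exact: XN.
Qed.

Section Weights.
Variables a b c lam0 m : R.
Hypotheses (a0 : 0 < a) (b0 : 0 < b) (c0 : 0 < c) (abc : a * b * c = 1).
Local Notation Q := (wq a b c).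
Hypothesis short : forall f, OF f -> f != 0 -> lam0 <= Q f.
Hypothesis shortN : forall f, NF f -> m <= lam0 + Q f.

Variable cls : F -> bool * (bool * bool).
Hypothesis cls_double : forall f g, OF f -> OF g -> cls f = cls g ->
  exists2 h, OF h & f - g = h + h.
Hypothesis cls_zero : forall f, OF f -> (cls f).2 = (false, false) ->
  exists2 h, OF h & f = h + h \/ f = 1 + (h + h).

(** Write [f = k + h], [g = k - h]. Unless [g] is [f] or [-f], both are nonzero, and one of them is
    irrational because [f] is; the parallelogram law then gives [Q f + Q g >= 2 m]. *)
Lemma same_class f g : NF f -> NF g -> cls f = cls g -> Q f < m -> Q g < m ->
  g = f \/ g = - f.
Proof.
move=> Nf Ng fg fm gm; have [h Oh fgh] := cls_double Nf.1 Ng.1 fg.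
have [-> |gf] := eqVneq g f; first by left.
have [-> |gf'] := eqVneq g (- f); first by right.
exfalso; pose k := g + h.
have fE : f = k + h by rewrite /k -[f](subrK g) fgh; ring.
have gE : g = k - h by rewrite /k; ring.
have Ok : OF k by apply: OFD => //; exact: Ng.1.
have h0 : h != 0 by apply: contraNneq gf => h0; rewrite gE fE h0 subr0 addr0.
have k0 : k != 0 by apply: contraNneq gf' => k0; rewrite gE fE k0 sub0r add0r.
have par := wq_parallelogram sigma iota a b c k h; rewrite -fE -gE in par.
have [Nk|Nh] : NF k \/ NF h.
  have [sk|sk] := eqVneq (sigma k) k; last by left.
  have [sh|sh] := eqVneq (sigma h) h; last by right.
  by case: Nf => _; rewrite fE rmorphD /= sk sh eqxx.
- by have := shortN Nk; have := short Oh h0; lra.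
- by have := shortN Nh; have := short Ok k0; lra.
Qed.

(** Such an [f] would be [2 h] or [(1 + h) + h] with [h] irrational. In the second case
    [(1 + h) - h = 1], and the parallelogram law gives [Q f >= 4 l - lambda]. *)
Lemma zero_class f (l B : R) : (forall h, NF h -> l <= Q h) -> 0 <= l ->
  B <= 4 * l - (a + b + c) -> NF f -> Q f < B -> (cls f).2 != (false, false).
Proof.
move=> hl l0 hB Nf fB; apply/eqP => /(cls_zero Nf.1)[h Oh hE].
have Nh : NF h.
  split=> //; have [_ sf] := Nf; apply: contraNneq sf => sh.
  by case: hE => ->; rewrite !rmorphD /= ?rmorph1 sh.
have lh := hl _ Nh; case: hE => fE.
  have e : Q f = 4 * Q h by rewrite fE /wnorm !rmorphD /=; ring.
  have s0 : 0 < a + b + c by rewrite !addr_gt0.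
  by move: fB lh hB s0; rewrite e; move: (a + b + c) (Q h) => s q; lra.
have Nh1 : NF (1 + h).
  split; first by apply: OFD => //; exact: OF1.
  by rewrite rmorphD rmorph1 /= (inj_eq (addrI _)); exact: Nh.2.
have lh1 := hl _ Nh1.
have e : Q f + (a + b + c) = 2 * Q (1 + h) + 2 * Q h.
  by rewrite fE /wnorm !rmorphD !rmorph1 /=; ring.
by move: fB lh lh1 hB e; move: (a + b + c) (Q h) (Q (1 + h)) (Q f) => s q p t; lra.
Qed.

End Weights.

Lemma T2_same_class cls f g :
  (forall f g, OF f -> OF g -> cls f = cls g :> bool * (bool * bool) ->
     exists2 h, OF h & f - g = h + h) ->
  NF f -> NF g -> cls f = cls g -> T2 f < 8 -> T2 g < 8 -> g = f \/ g = - f.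
Proof.
(* With all weights [1] the threshold is [3 + 5 = 8]: shortest vector plus shortest irrational
   one. *)
move=> cd Nf Ng fg; rewrite !T2_wq; apply: (@same_class _ _ _ 3 _ _ _ cls cd) => //.
- by move=> h Oh h0; apply: wq_ge3 => //; rewrite ?mulr1 ?ltr01.
- move=> h [Oh sh]; rewrite -T2_wq.
  by have := T2_ge5 iota galF genF ordF Oh sh; lra.
Qed.

Section MidRange.
Variables u v w : R.
Hypotheses (u0 : 0 < u) (v0 : 0 < v) (w0 : 0 < w) (uvw : u * v * w = 1).
Local Notation Q := (wq (u ^+ 2) (v ^+ 2) (w ^+ 2)).
Local Notation lam := (u ^+ 2 + v ^+ 2 + w ^+ 2).

Let a0 : 0 < u ^+ 2. Proof. exact: exprn_gt0. Qed.
Let b0 : 0 < v ^+ 2. Proof. exact: exprn_gt0. Qed.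
Let c0 : 0 < w ^+ 2. Proof. exact: exprn_gt0. Qed.
Let abc : u ^+ 2 * v ^+ 2 * w ^+ 2 = 1.
Proof. by rewrite -!exprMn uvw expr1n. Qed.

Lemma OF_ge3 f : OF f -> f != 0 -> 3 <= Q f.
Proof. by move=> Of f0; apply: wq_ge3. Qed.

Lemma lam_ge3 : 3 <= lam.
Proof.
have := OF_ge3 (@OF1 F) (oner_neq0 F).
by rewrite /wnorm !rmorph1 expr1n !mulr1.
Qed.

Hypothesis short : forall f, OF f -> f != 0 -> lam <= Q f.

Lemma NF_bound3 f : NF f -> 1349 / 100 - 3 * lam <= Q f.
Proof. by case=> Of sf; apply: wq_bound3. Qed.

Lemma NF_bound2 f : NF f -> 1034 / 100 - 2 * lam <= Q f.
Proof. by case=> Of sf; apply: wq_bound2. Qed.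

Lemma NF_bound3_8 f : NF f -> 8 <= T2 f -> 1458 / 100 - 3 * lam <= Q f.
Proof. by case=> Of sf; apply: wq_bound3_8. Qed.

Lemma NF_bound2_8 f : NF f -> 8 <= T2 f -> 1112 / 100 - 2 * lam <= Q f.
Proof. by case=> Of sf; apply: wq_bound2_8. Qed.

Lemma NF_short f : NF f -> lam <= Q f.
Proof. by move=> Nf; apply: short; [exact: Nf.1 | exact: nonzero_NF]. Qed.

Lemma NF_pair f : NF f -> 92 / 10 <= Q f + Q (sigma f).
Proof. by case=> Of sf; apply: wq_pair. Qed.

Lemma NF_67 f : NF f -> 67 / 10 <= lam + Q f.
Proof.
move=> Nf; have := NF_bound3 Nf; have := NF_short Nf.
(* Above [3.36] one has [2 lam >= 6.72]; below it, [13.49 - 2 lam > 6.77]. *)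
move: lam (Q f) => l q h1 h2; have [h|h] := leP (336 / 100) l; lra.
Qed.

(* Short vectors lie in the six nonzero classes modulo 2 other than the class of 1,
   one pair in each; for either parity of the trace, the three classes form
   one Galois orbit, so that two of them cannot both contain a very short vector. *)
Lemma NF_mid_sum (l l8 : R) : (forall f, NF f -> l <= Q f) ->
  (forall f, NF f -> 8 <= T2 f -> l8 <= Q f) ->
  (\esum_(f in NF) (expR (- pi * Q f))%:E <=
   (4 * expR (- pi * l) +
   8 * Num.min (expR (- pi * (46 / 10)) + expR (- pi * l8)) (expR (- pi * l)) +
   80 * expR (- pi * (603 / 100)))%:E)%E.
Proof.
move=> hl hl8; have [cls [cd cz cs]] := classes_exist iota galF genF ordF.
pose E : set F := [set f | Q f < 67 / 10].
have mono (x y : R) : x <= y -> expR (- pi * y) <= expR (- pi * x).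
  by move=> xy; rewrite ler_expR !mulNr lerN2 ler_wpM2l ?pi_ge0.
rewrite (esumID E); last by move=> f _; rewrite lee_fin expR_ge0.
set L := expR (- pi * l); set B := Num.min _ L.
have L0 : 0 <= L by exact: expR_ge0.
have B0 : 0 <= B by rewrite /B le_min L0 addr_ge0 ?expR_ge0.
have BL : B <= L by rewrite /B ge_min lexx orbT.
rewrite EFinD; apply: leeD; last first.
  have -> : 80 * expR (- pi * (603 / 100)) = expR (- pi * (9 / 10 * (67 / 10))) * 80 :> R.
    by rewrite [LHS]mulrC; congr (expR (- pi * _) * _); field.
  apply: (@esum_tail OF) => //.
  - by move=> f g Of Og; exact: OFB.
  - exact: OF_ge3.
  - by move=> f [[]].
  - by move=> f [_ /negP]; rewrite -leNgt.
(* The condition [T2 f < 8] makes [T2_same_class] applicable to conjugates, and [4.6] is half the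
   constant of [wq_pair]. *)
pose bad f := [/\ NF f, T2 f < 8 & Q f < 46 / 10].
pose badc p := `[< exists2 f, bad f & cls f = p >].
pose M p := if p.2 == (false, false) then 0 else if badc p then L else B.
have nz f : (NF `&` E) f -> (cls f).2 != (false, false).
  case=> Nf fE; apply: (@zero_class (u ^+ 2) (v ^+ 2) (w ^+ 2) a0 b0 c0 cls cz f lam (67 / 10)) => //.
  - exact: NF_short.
  - by have := lam_ge3; lra.
  - by have := lam_ge3; lra.
have M0 p : 0 <= M p by rewrite /M; case: ifP => // _; case: ifP.
have gM f : (NF `&` E) f -> expR (- pi * Q f) <= M (cls f).
  move=> NEf; rewrite /M (negPf (nz f NEf)); have Nf := NEf.1.
  have fL : expR (- pi * Q f) <= L by apply: mono; exact: hl.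
  case: ifPn => // /asboolPn nb; rewrite /B le_min fL andbT.
  have [f8|f8] := leP 8 (T2 f).
    apply: le_trans (mono _ _ (hl8 _ Nf f8)) _; rewrite lerDr; exact: expR_ge0.
  have [f46|f46] := leP (46 / 10) (Q f).
    apply: le_trans (mono _ _ f46) _; rewrite lerDl; exact: expR_ge0.
  by case: nb; exists f.
have inj f f' : (NF `&` E) f -> (NF `&` E) f' -> cls f = cls f' -> f' = f \/ f' = - f.
  move=> [Nf fE] [Nf' fE'] ff'.
  apply: (@same_class (u ^+ 2) (v ^+ 2) (w ^+ 2) lam (67 / 10) _ _ cls cd) => //.
  exact: NF_67.
apply: le_trans (esum_sign_classes gM M0 inj) _; rewrite lee_fin.
have orbit2 f g : bad f -> bad g -> cls g = cls (sigma f) -> False.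
  move=> [Nf f8 f46] [Ng g8 g46] gf.
  have [|gE|gE] := T2_same_class cd (NF_sigma Nf) Ng (esym gf) _ g8.
  - by rewrite T2_sigma.
  - by have := NF_pair Nf; rewrite -gE; lra.
  - by have := NF_pair Nf; rewrite -(wqN _ _ _ _ _ (sigma f)) -gE; lra.
have cyc (p : bool) (x y x' y' : bool) : badc (p, (x, y)) -> badc (p, (x', y')) ->
   (x', y') = (y, x (+) y) -> False.
  move=> /asboolP[f bf fc] /asboolP[g bg gc] e; apply: (orbit2 f g bf bg).
  by rewrite gc e cs ?fc //; case: bf => -[].
rewrite sum_bool3 big_bool /=.
have key p : 2 * M (p, (false, false)) + 2 * M (p, (true, false)) + 2 * M (p, (false, true))
   + 2 * M (p, (true, true)) <= 2 * L + 4 * B.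
  have h1 : ~~ (badc (p, (true, false)) && badc (p, (false, true))).
    by apply/negP => /andP[x y]; exact: (cyc _ _ _ _ _ x y erefl).
  have h2 : ~~ (badc (p, (false, true)) && badc (p, (true, true))).
    by apply/negP => /andP[x y]; exact: (cyc _ _ _ _ _ x y erefl).
  have h3 : ~~ (badc (p, (true, true)) && badc (p, (true, false))).
    by apply/negP => /andP[x y]; exact: (cyc _ _ _ _ _ x y erefl).
  rewrite /M /=; move: h1 h2 h3 BL B0.
  move: (badc _) (badc _) (badc _) => [] [] [] //= _ _ _ BL1 B01; lra.
have := key true; have := key false; lra.
Qed.

Lemma NF_mid : 302 / 100 <= lam -> exists2 r : R,
  r < 2 * (expR (- pi * 3) - expR (- pi * lam)) &
  (\esum_(f in NF) (expR (- pi * Q f))%:E <= r%:E)%E.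
Proof.
move=> hlam; have [l [l8 [hl hl8 hlt]]] := mid_numeric hlam.
eexists; last first.
  apply: (@NF_mid_sum l l8).
  - move=> f Nf; case: hl => ->; [exact: NF_short|exact: NF_bound3|exact: NF_bound2].
  - move=> f Nf f8; case: hl8 => ->; [exact: NF_short|exact: NF_bound3_8|exact: NF_bound2_8].
by move: hlt; set m := Num.min _ _; lra.
Qed.

End MidRange.

Lemma esum_NF_sigma (g : F -> \bar R) :
  \esum_(f in NF) g (sigma f) = \esum_(f in NF) g f.
Proof.
apply: esym; apply: (reindex_esum NF NF (fun f => sigma f)).
split.
- by move=> f /NF_sigma.
- by move=> f h _ _; exact: fmorph_inj.
- move=> f Nf; exists (sigma (sigma f)); first by do 2!apply: NF_sigma.
  exact: sigma3 genF ordF f.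
Qed.

(** * Comparison with the trivial divisor for [lambda <= 3.02] *)

Section LocalRange.
Variables u v w : R.
Hypotheses (u0 : 0 < u) (v0 : 0 < v) (w0 : 0 < w) (uvw : u * v * w = 1).
Local Notation Q := (wq (u ^+ 2) (v ^+ 2) (w ^+ 2)).
Local Notation lam := (u ^+ 2 + v ^+ 2 + w ^+ 2).
Hypotheses (lam3 : 3 < lam) (lam302 : lam <= 302 / 100).
Let mu := lam - 3.

Definition excess f : R :=
  if T2 f < 8 then K5 R else K8 R * expR (- (pi / 10) * T2 f).

Lemma K5_ge0 : 0 <= K5 R.
Proof. by rewrite /K5 !mulr_ge0 ?sqr_ge0 ?expR_ge0 ?pi_ge0. Qed.

Lemma K8_ge0 : 0 <= K8 R.
Proof. by rewrite /K8 !mulr_ge0 ?sqr_ge0 ?expR_ge0 ?pi_ge0. Qed.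

Lemma excess_ge0 f : 0 <= excess f.
Proof.
rewrite /excess; case: ifP => _; first exact: K5_ge0.
by apply: mulr_ge0; [exact: K8_ge0 | exact: expR_ge0].
Qed.

Lemma orbit_excess f : NF f ->
  expR (- pi * Q f) + expR (- pi * Q (sigma f)) + expR (- pi * Q (sigma (sigma f))) <=
  3 * expR (- pi * T2 f) + mu * excess f.
Proof.
move=> Nf; have [Of sf] := Nf.
have [_ h5 hd hc] := nonfixed_cases iota galF genF ordF Of sf.
have bnd (x y z : R) : 0 < x -> 0 < y -> 0 < z -> x * y * z = 1 ->
    x ^+ 2 + y ^+ 2 + z ^+ 2 <= 302 / 100 -> 846 / 1000 <= x ^+ 2.
  move=> x0 y0 z0 e h; have /andP[hx _] := weight_bounds x0 y0 z0 e h.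
  apply: (@le_trans _ _ ((92 / 100) ^+ 2)); first lra.
  by apply: lerXn2r => //; rewrite nnegrE ?ltW.
have ba : 846 / 1000 <= u ^+ 2 by exact: bnd uvw lam302.
have bb : 846 / 1000 <= v ^+ 2.
  by apply: (bnd v w u) => //; [rewrite -uvw; ring | rewrite addrC addrA].
have bc : 846 / 1000 <= w ^+ 2.
  by apply: (bnd w u v) => //; [rewrite -uvw; ring | rewrite -addrA addrC].
have lamE : lam = 3 + mu by rewrite /mu [RHS]addrC subrK.
have mu0 : 0 <= mu by rewrite /mu subr_ge0 ltW.
have mu1 : mu <= 2 / 100 by rewrite /mu; move: lam302; lra.
have hW := weight_spread u0 v0 w0 uvw lam302.
have Q0E : Q f = u ^+ 2 * iota f ^+ 2 + v ^+ 2 * iota (sigma f) ^+ 2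
  + w ^+ 2 * iota (sigma (sigma f)) ^+ 2 by [].
have Q1E : Q (sigma f) = u ^+ 2 * iota (sigma f) ^+ 2 + v ^+ 2 * iota (sigma (sigma f)) ^+ 2
  + w ^+ 2 * iota f ^+ 2 by rewrite /wnorm (sigma3 genF ordF).
have Q2E : Q (sigma (sigma f)) = u ^+ 2 * iota (sigma (sigma f)) ^+ 2 + v ^+ 2 * iota f ^+ 2
  + w ^+ 2 * iota (sigma f) ^+ 2 by rewrite /wnorm !(sigma3 genF ordF).
(* The value is [13.49 - 3 * 3.02]. *)
have q443 h : NF h -> 443 / 100 <= Q h.
  by move=> Nh; have := NF_bound3 u0 v0 w0 uvw Nh; move: lam302; move: lam (Q h) => x y; lra.
have q0 := q443 _ Nf; have q1 := q443 _ (NF_sigma Nf).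
have q2 := q443 _ (NF_sigma (NF_sigma Nf)).
have tdE : T2d f = iota f ^+ 2 * iota (sigma f) ^+ 2 +
    iota (sigma f) ^+ 2 * iota (sigma (sigma f)) ^+ 2 +
    iota (sigma (sigma f)) ^+ 2 * iota f ^+ 2.
  by rewrite (T2dE iota genF ordF) !exprMn.
rewrite Q0E in q0; rewrite Q1E in q1; rewrite Q2E in q2.
rewrite /excess Q0E Q1E Q2E; have [f8|f8] := ltP (T2 f) 8; last first.
  exact: (orbit8 ba bb bc lamE mu0 mu1 hW (sqr_ge0 _) (sqr_ge0 _) (sqr_ge0 _) f8).
case: hc => [[t5 td6]|t6].
  rewrite tdE in td6.
  exact: (orbit5 lamE mu0 mu1 hW (sqr_ge0 _) (sqr_ge0 _) (sqr_ge0 _) t5 td6 q0 q1 q2).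
have t7 : T2 f <= 7 by apply: (T2_le_of_lt galF genF ordF (n := 7)).
exact: (orbit67 ba bb bc lamE mu0 mu1 hW (sqr_ge0 _) (sqr_ge0 _) (sqr_ge0 _) t6 t7).
Qed.

(** At most one pair with [T2 < 8] lies in each of six classes modulo 2, hence [12]; the other
    vectors fall under the cube bound [80] with weights [1]. *)
Lemma esum_excess : (\esum_(f in NF) (excess f)%:E <= (12 * K5 R + 80 * K8 R)%:E)%E.
Proof.
have [cls [cd cz cs]] := classes_exist iota galF genF ordF.
rewrite (esumID [set f | T2 f < 8]); last by move=> f _; rewrite lee_fin excess_ge0.
have one3 f : OF f -> f != 0 -> 3 <= wq (1 ^+ 2) (1 ^+ 2) (1 ^+ 2) f.
  by move=> Of f0; apply: wq_ge3 => //; rewrite ?expr1n ?mulr1 ?ltr01.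
rewrite EFinD; apply: leeD; last first.
  rewrite [80 * _]mulrC.
  apply: esum_le_scale (esum_tenth _ one3); last by move=> f h; exact: OFB.
  - by move=> f [[]].
  - exact: K8_ge0.
  - by move=> f [_ /negP f8]; rewrite /excess (negPf f8) !expr1n -T2_wq.
pose M (p : bool * (bool * bool)) := if p.2 == (false, false) then 0 else K5 R.
have nz f : (NF `&` [set f | T2 f < 8]) f -> (cls f).2 != (false, false).
  case=> Nf /= f8; rewrite T2_wq in f8.
  apply: (@zero_class 1 1 1 ltr01 ltr01 ltr01 cls cz f 5 8) => //.
  - by move=> h [Oh sh]; rewrite -T2_wq; exact: T2_ge5.
  - lra.
apply: le_trans (esum_sign_classes (cls := cls) (M := M) _ _ _) _.
- move=> f Nf; rewrite /M (negPf (nz f Nf)) /excess ifT //; exact: Nf.2.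
- by move=> p; rewrite /M; case: ifP => // _; exact: K5_ge0.
- by move=> f f' [Nf f8] [Nf' f8'] e; exact: (T2_same_class cd Nf Nf' e f8 f8').
by rewrite lee_fin sum_bool3 big_bool /M /=; lra.
Qed.

Lemma NF_local : exists2 r : R, r < 2 * (expR (- pi * 3) - expR (- pi * lam)) &
  (\esum_(f in NF) (expR (- pi * Q f))%:E <=
   \esum_(f in NF) (expR (- pi * T2 f))%:E + r%:E)%E.
Proof.
have mu0 : 0 < mu by rewrite /mu subr_gt0.
have mu1 : mu <= 2 / 100 by rewrite /mu; move: lam302; lra.
have num := local_numeric mu0 mu1.
have lamE : lam = 3 + mu by rewrite /mu [RHS]addrC subrK.
exists (mu * (12 * K5 R + 80 * K8 R) / 3).
  by rewrite lamE; move: num; move: (mu * _) (expR _ - expR _) => x y; lra.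
have finite (a b c : R) : 0 < a -> 0 < b -> 0 < c -> a * b * c = 1 ->
   exists2 t : R, 0 <= t <= expR (- pi * (9 / 10 * 3)) * 80 &
    \esum_(f in NF) (expR (- pi * wq (a ^+ 2) (b ^+ 2) (c ^+ 2) f))%:E = t%:E.
  move=> a0 b0 c0 abc; have q3 := OF_ge3 a0 b0 c0 abc.
  apply: esum_EFinP; first by move=> f _; exact: expR_ge0.
  apply: (@esum_tail OF _ a b c 3) => //.
  - by move=> f g Of Og; exact: OFB.
  - by move=> f [].
  - by move=> f Nf; apply: q3; [exact: Nf.1|exact: nonzero_NF].
have [x _ xE] := finite u v w u0 v0 w0 uvw.
have [y _ yE] := finite 1 1 1 ltr01 ltr01 ltr01 ltac:(by rewrite !mulr1).
have {}yE : \esum_(f in NF) (expR (- pi * T2 f))%:E = y%:E.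
  by rewrite -yE; apply: eq_esum => f _; rewrite T2_wq !expr1n.
rewrite xE yE -EFinD lee_fin.
suff : x + x + x <= y + y + y + mu * (12 * K5 R + 80 * K8 R).
  by move: (mu * _) => z; lra.
rewrite -lee_fin !EFinD -xE -yE.
(* Two of the three copies of the series are moved by [sigma] and by its square, so that each term
   becomes an orbit sum. *)
rewrite -{2}(esum_NF_sigma (fun f => (expR (- pi * Q f))%:E)).
rewrite -{2}(esum_NF_sigma (fun f => (expR (- pi * Q f))%:E)).
rewrite -{2}(esum_NF_sigma (fun f => (expR (- pi * Q (sigma f)))%:E)).
rewrite -!esumD; try by move=> f _; rewrite ?adde_ge0 ?lee_fin ?expR_ge0.
apply: (@le_trans _ _ (\esum_(f in NF) ((expR (- pi * T2 f))%:E + (expR (- pi * T2 f))%:E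
   + (expR (- pi * T2 f))%:E + (mu * excess f)%:E)%E)).
  apply: le_esum => f Nf; rewrite -!EFinD lee_fin.
  have := orbit_excess Nf; move: (expR (- pi * T2 f)) => t.
  by move: (mu * _) (expR _) (expR _) (expR _) => x1 x2 x3 x4; lra.
rewrite esumD; last first.
- by move=> f _; rewrite lee_fin mulr_ge0 ?excess_ge0 // ltW.
- by move=> f _; rewrite !adde_ge0 ?lee_fin ?expR_ge0.
apply: leeD => //.
by apply: esum_le_scale esum_excess => //; exact: ltW.
Qed.

End LocalRange.


End Sums.

(** * The maximum of the size function *)

Lemma weight_eq1 (R : realType) (u v w : R) : 0 < u -> 0 < v -> 0 < w -> u * v * w = 1 ->
  u ^+ 2 + v ^+ 2 + w ^+ 2 = 3 -> u = 1.
Proof.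
move=> u0 v0 w0 uvw hS.
have h : (u - 1) ^+ 2 * (u + 2) <= 0.
  have h1 : 2 <= u * (v ^+ 2 + w ^+ 2).
    have -> : 2 = u * (2 * (v * w)) by rewrite -[in LHS](mulr1 2) -uvw; ring.
    by rewrite ler_pM2l //; have := sqr_ge0 (v - w); clear; nra.
  have h2 : v ^+ 2 + w ^+ 2 = 3 - u ^+ 2 by rewrite -hS; ring.
  by rewrite h2 in h1; clear -h1; nra.
have u2 : 0 < u + 2 by rewrite addr_gt0.
have : (u - 1) ^+ 2 == 0.
  by rewrite eq_le sqr_ge0 andbT -(pmulr_lle0 _ u2).
by rewrite sqrf_eq0 subr_eq0 => /eqP.
Qed.

Lemma exists_min_seq (T : eqType) (R : realType) (g : T -> R) (x : T) (s : seq T) : x \in s ->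
  exists2 y, y \in s & forall z, z \in s -> g y <= g z.
Proof.
elim: s x => // a s IH x _; case: s IH => [|b s] IH.
  by exists a; rewrite ?mem_head // => z; rewrite inE => /eqP ->.
have [y ys ymin] := IH b (mem_head _ _).
have [ay|ya] := leP (g a) (g y).
  exists a; first exact: mem_head.
  by move=> z; rewrite inE => /orP[/eqP -> //|/ymin]; exact: le_trans.
exists y; first by rewrite inE ys orbT.
by move=> z; rewrite inE => /orP[/eqP ->|/ymin //]; exact: ltW.
Qed.

Lemma exp_396 (R : realType) : 40 < expR (396 / 100) :> R.
Proof.
have h0 : 268 / 100 <= expR (396 / 100 / 4) :> R.
  by apply: le_trans (expR_ge_quartic _); lra.
have {h0} h1 : 718 / 100 <= expR (396 / 100 / 2) :> R by apply: expR_double_ge h0 _; lra.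
by apply: (@lt_le_trans _ _ 41); [lra | apply: expR_double_ge h1 _; lra].
Qed.

(** The threshold [4.74] is large enough for this tail and still below the cube root of
    [27 * 2^2 = 108], the bound for index at least [2]. *)
Lemma far_numeric (R : realType) :
  expR (- pi * (9 / 10 * (474 / 100))) * 80 < 2 * expR (- pi * 3) :> R.
Proof.
have hp := @pi_ge R.
have -> : expR (- pi * (9 / 10 * (474 / 100))) = expR (- pi * 3) * expR (- (pi * (1266 / 1000))) :> R.
  by rewrite -expRD; congr expR; field.
have : expR (- (pi * (1266 / 1000))) < 1 / 40 :> R.
  rewrite expRN div1r ltf_pV2 ?posrE ?expR_gt0 //.
  by apply: lt_le_trans (@exp_396 R) _; rewrite ler_expR; lra.
have := expR_gt0 (- pi * 3 : R); move: (expR _) (expR _) => x y; nra.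
Qed.

Section Final.
Variables (R : realType) (F : splittingFieldType rat).
Variables (sigma : gal_of {:F}) (iota : {rmorphism F -> R}).
Hypothesis galF : galois 1 {:F}.
Hypothesis genF : 'Gal({:F} / 1)%g = <[sigma]>%g.
Hypothesis ordF : #|'Gal({:F} / 1)%g| = 3%N.
Local Notation OF := (@ring_of_integers F).
Implicit Types f g h : F.
Local Notation T2 := (sumsq sigma iota).
Local Notation wq := (wnorm sigma iota).
Local Notation NF := (irrational_integers sigma).

Definition ZF : set F := OF `&` ~` [set f | sigma f != f].

Lemma one_neqN1 : (1 : F) != -1.
Proof. by rewrite -subr_eq0 opprK -[1 + 1]/(2%:R) -(rmorph_nat (in_alg F)) fmorph_eq0 pnatr_eq0. Qed.

Lemma esum_pm1 (S : set F) (g : F -> R) : S 1 -> S (-1) -> 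
  ((g 1 + g (-1))%:E <= \esum_(f in S) (g f)%:E)%E.
Proof.
move=> S1 SN1; apply: esum_ge; exists [set` [fset 1; -1]%fset].
  split; first exact: finite_fset.
  by move=> f /=; rewrite !inE => /orP[/eqP -> //|/eqP ->].
rewrite fsbig_finite ?set_fsetK; last exact: finite_fset.
by rewrite big_fsetU1 ?inE ?one_neqN1 //= big_seq_fset1 EFinD.
Qed.

Lemma ZF_int f : ZF f -> exists n : int, f = n%:~R.
Proof. by case=> Of /negP/negPn/eqP sf; exact: (OF_fixed_int galF genF). Qed.

Lemma ZF1 : ZF 1.
Proof. by split; [exact: OF1 | rewrite /= rmorph1 eqxx]. Qed.

Lemma ZFN1 : ZF (-1).
Proof. by split; [apply: OFN; exact: OF1 | rewrite /= rmorphN rmorph1 eqxx]. Qed.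

(** A rational integer [n] has norm [n^2 lambda >= 3 n^2], so no term exceeds that of the trivial
    divisor; only the gain at [1] and [-1] is kept. *)
Lemma ZF_sum (a b c : R) : 3 <= a + b + c ->
  (\esum_(f in ZF) (expR (- pi * wq a b c f))%:E +
   (2 * (expR (- pi * 3) - expR (- pi * (a + b + c))))%:E <=
   \esum_(f in ZF) (expR (- pi * T2 f))%:E)%E.
Proof.
move=> lam3; set d := expR _ - _.
pose dl f : R := if (f == 1) || (f == -1) then d else 0.
have mono (x y : R) : x <= y -> expR (- pi * y) <= expR (- pi * x).
  by move=> xy; rewrite ler_expR !mulNr lerN2 ler_wpM2l ?pi_ge0.
have d0 : 0 <= d by rewrite subr_ge0 mono.
have dl0 f : 0 <= dl f by rewrite /dl; case: ifP.
apply: (@le_trans _ _ (\esum_(f in ZF) (expR (- pi * wq a b c f))%:E + \esum_(f in ZF) (dl f)%:E)%E).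
  apply: leeD => //; have := esum_pm1 dl ZF1 ZFN1.
  by rewrite /dl !eqxx orbT /= (_ : d + d = 2 * d) //; ring.
rewrite -esumD; try by move=> f _; rewrite lee_fin ?expR_ge0.
apply: le_esum => f Zf; rewrite -EFinD lee_fin T2_wq.
have wq1 (x y z : R) : wq x y z 1 = x + y + z by rewrite /wnorm !rmorph1 expr1n !mulr1.
rewrite /dl; case: ifP => [/orP[]/eqP ->|_].
- by rewrite !wq1 /d addrC subrK (_ : 1 + 1 + 1 = 3 :> R) //; ring.
- by rewrite !wqN !wq1 /d addrC subrK (_ : 1 + 1 + 1 = 3 :> R) //; ring.
have [n ->] := ZF_int Zf; rewrite addr0; apply: mono; rewrite !wq_int.
by rewrite ler_wpM2l ?sqr_ge0 // (_ : 1 + 1 + 1 = 3 :> R) //; ring.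
Qed.

Lemma esum_OF_split (g : F -> R) : (forall f, 0 <= g f) ->
  (\esum_(f in OF) (g f)%:E = \esum_(f in NF) (g f)%:E + \esum_(f in ZF) (g f)%:E)%E.
Proof.
move=> g0; rewrite (esumID [set f | sigma f != f]) //.
by move=> f _; rewrite lee_fin.
Qed.

Section Weights.
Variables u v w : R.
Hypotheses (u0 : 0 < u) (v0 : 0 < v) (w0 : 0 < w) (uvw : u * v * w = 1).
Local Notation Q := (wq (u ^+ 2) (v ^+ 2) (w ^+ 2)).
Local Notation lam := (u ^+ 2 + v ^+ 2 + w ^+ 2).

Lemma esum_OF_finite (X : set F) : X `<=` OF -> exists r : R,
  \esum_(f in X) (expR (- pi * Q f))%:E = r%:E.
Proof.
move=> XO; have q3 := OF_ge3 iota galF genF ordF u0 v0 w0 uvw.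
have [|r _ ->] := @esum_EFinP R F X (fun f => expR (- pi * Q f))
  (expR (- pi * (9 / 10 * 0)) * 80) (fun _ _ => expR_ge0 _); last by exists r.
apply: (@esum_tail _ _ _ _ OF X u v w 0) => //.
- by move=> f g Of Og; exact: OFB.
- by move=> f _; apply: wq_ge0; rewrite exprn_gt0.
Qed.

Lemma esum_OF_lt : (forall f, OF f -> f != 0 -> lam <= Q f) -> lam != 3 ->
  (\esum_(f in OF) (expR (- pi * Q f))%:E < \esum_(f in OF) (expR (- pi * T2 f))%:E)%E.
Proof.
move=> short l3; have lam3 := lam_ge3 iota galF genF ordF u0 v0 w0 uvw.
have lam3' : 3 < lam by rewrite lt_neqAle eq_sym l3.
have [r rlt rle] : exists2 r : R, r < 2 * (expR (- pi * 3) - expR (- pi * lam)) &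
  (\esum_(f in NF) (expR (- pi * Q f))%:E <=
   \esum_(f in NF) (expR (- pi * T2 f))%:E + r%:E)%E.
  have [h|h] := leP (302 / 100) lam.
    have [r rlt rle] := NF_mid galF genF ordF u0 v0 w0 uvw short h.
    exists r => //; apply: le_trans rle _; rewrite leeDr //.
    by apply: esum_ge0 => f _; rewrite lee_fin expR_ge0.
  by apply: NF_local => //; exact: ltW.
rewrite !esum_OF_split; try by move=> f; exact: expR_ge0.
have Zle := ZF_sum lam3.
have [x1 e1] : exists x, \esum_(f in NF) (expR (- pi * Q f))%:E = x%:E.
  by apply: esum_OF_finite => f [].
have [x2 e2] : exists x, \esum_(f in ZF) (expR (- pi * Q f))%:E = x%:E.
  by apply: esum_OF_finite => f [].
rewrite e1 e2 in rle Zle *.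
have n0 (X : set F) : (0 <= \esum_(f in X) (expR (- pi * T2 f))%:E)%E.
  by apply: esum_ge0 => f _; rewrite lee_fin expR_ge0.
move: rle Zle (n0 NF) (n0 ZF).
(* If a series of the trivial divisor were infinite, the strict inequality would be immediate. *)
case: (\esum_(f in NF) _) => [y1| |] //; case: (\esum_(f in ZF) _) => [y2| |] //.
  by rewrite -!EFinD !lee_fin lte_fin; lra.
by move=> *; rewrite addeC //= ltry.
by move=> *; rewrite /= ltry.
by move=> *; rewrite /= ltry.
Qed.

End Weights.

Lemma normsqE (x : 'rV[R]_3) f : normsq sigma iota x f =
  wq (x 0 0 ^+ 2) (x 0 1 ^+ 2) (x 0 2%:R ^+ 2) f.
Proof.
rewrite /normsq !big_ord_recl big_ord0 addr0 addrA /Phi !mxE /=.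
rewrite !(galois_expE sigma) /= /wnorm.
have -> : lift ord0 ord0 = 1 :> 'I_3 by apply: val_inj.
by have -> : lift ord0 (lift ord0 ord0) = 2%:R :> 'I_3 by apply: val_inj.
Qed.

Lemma PhiE f : [/\ Phi sigma iota f 0 0 = iota f, Phi sigma iota f 0 1 = iota (sigma f) &
  Phi sigma iota f 0 2%:R = iota (sigma (sigma f))].
Proof. by rewrite !mxE !(galois_expE sigma). Qed.

Lemma vec_normE (x : 'rV[R]_3) : vec_norm x = x 0 0 * x 0 1 * x 0 2%:R.
Proof.
rewrite /vec_norm !big_ord_recl big_ord0 mulr1 mulrA.
have -> : lift ord0 ord0 = 1 :> 'I_3 by apply: val_inj.
by have -> : lift ord0 (lift ord0 ord0) = 2%:R :> 'I_3 by apply: val_inj.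
Qed.

Lemma k0E (D : divisor R F) : k0 sigma iota D = fine (\esum_(f in div_ideal D)
  (expR (- pi * wq (div_vec D 0 0 ^+ 2) (div_vec D 0 1 ^+ 2) (div_vec D 0 2%:R ^+ 2) f))%:E).
Proof. by rewrite /k0; congr fine; apply: eq_esum => f _; rewrite normsqE. Qed.

Lemma k0_trivial : (k0 sigma iota (trivial_divisor R F))%:E =
  \esum_(f in OF) (expR (- pi * T2 f))%:E.
Proof.
rewrite k0E /= !mxE.
have [r rE] := esum_OF_finite ltr01 ltr01 ltr01
  (etrans (mulr1 _) (mulr1 1)) (@subset_refl _ OF).
rewrite rE /= -rE; apply: eq_esum => f _.
by rewrite T2_wq !expr1n.
Qed.

(** Degree [0] means [N(u) N(I) = 1], which turns [ideal_norm_index] into [N(u) |N f| =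
    [I : f OF]]. *)
Lemma degree0_norm (D : divisor0 R F) f : div_ideal (val D) f -> f != 0 ->
  exists k : nat, [/\ (0 < k)%N, vec_norm (div_vec (val D)) * absN sigma iota f = k%:R &
    k = 1%N -> div_ideal (val D) = principal_ideal f].
Proof.
move=> If f0.
have [k [k0 kE kI]] := ideal_norm_index iota galF genF ordF (div_idealP (val D)) If f0.
exists k; split => //.
have vn0 : 0 < vec_norm (div_vec (val D)) by apply: prodr_gt0 => i _; exact: div_vecP.
have nI0 : 0 < ratr (ideal_norm (div_ideal (val D))) :> R.
  have : 0 < ratr (ideal_norm (div_ideal (val D))) * k%:R :> R by rewrite kE absN_gt0.
  by rewrite pmulr_lgt0 // ltr0n.
have p0 := mulr_gt0 vn0 nI0.
have := valP D; rewrite /= /degree (ln_eq0 p0) => /eqP e.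
by rewrite -kE mulrA e mul1r.
Qed.

(** * Far and near divisors of degree 0 *)

Section Divisor.
Variable D : divisor0 R F.
Let I := div_ideal (val D).
Let x0 := div_vec (val D) 0 0.
Let x1 := div_vec (val D) 0 1.
Let x2 := div_vec (val D) 0 2%:R.
Local Notation Q := (wq (x0 ^+ 2) (x1 ^+ 2) (x2 ^+ 2)).

Let IB f g : I f -> I g -> I (f - g).
Proof. exact: (subgroup_ideal (div_idealP (val D))).2. Qed.

Lemma wq_index f (k : nat) : vec_norm (div_vec (val D)) * absN sigma iota f = k%:R ->
  27 * k%:R ^+ 2 <= Q f ^+ 3.
Proof.
rewrite vec_normE => <-.
have := AGM3 (sqr_ge0 (x0 * iota f)) (sqr_ge0 (x1 * iota (sigma f)))
  (sqr_ge0 (x2 * iota (sigma (sigma f)))).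
rewrite !exprMn /wnorm /absN real_normK ?num_real //.
by congr (_ <= _); rewrite -/x0 -/x1 -/x2; ring.
Qed.

Lemma ideal_ge3 f : I f -> f != 0 -> 3 <= Q f.
Proof.
move=> If f0; have [k [k0 kE _]] := degree0_norm If f0.
have Q0 : 0 <= Q f by apply: addr_ge0; first apply: addr_ge0; rewrite mulr_ge0 ?sqr_ge0.
apply: (@le_of_cube _ _ (k%:R ^+ 2)) (wq_index kE) => //.
have : 1 <= k%:R :> R by rewrite ler1n.
by move: (k%:R) => z; nra.
Qed.

Lemma ideal_principal f : I f -> f != 0 -> Q f < 474 / 100 ->
  I = principal_ideal f /\ vec_norm (div_vec (val D)) * absN sigma iota f = 1.
Proof.
move=> If f0 Qf; have [k [k0 kE kI]] := degree0_norm If f0.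
suff k1 : k = 1%N by split; [exact: kI | rewrite kE k1].
apply/eqP; rewrite eqn_leq k0 andbT leqNgt; apply/negP => k2.
have Q0 : 0 <= Q f by apply: addr_ge0; first apply: addr_ge0; rewrite mulr_ge0 ?sqr_ge0.
have : 474 / 100 <= Q f.
  apply: (@le_of_cube _ _ (k%:R ^+ 2)) (wq_index kE) => //.
  have : 2 <= k%:R :> R by rewrite ler_nat.
  by move: (k%:R) => z; nra.
by rewrite leNgt Qf.
Qed.

Lemma esum_ideal_finite : exists2 r : R, 0 < r & \esum_(f in I) (expR (- pi * Q f))%:E = r%:E.
Proof.
have [|r _ rE] := @esum_EFinP R F I (fun f => expR (- pi * Q f))
  (expR (- pi * (9 / 10 * 0)) * 80) (fun _ _ => expR_ge0 _).
  apply: (@esum_tail _ _ _ _ I I x0 x1 x2 0) => //; first exact: ideal_ge3.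
  by move=> f _; apply: addr_ge0; first apply: addr_ge0; rewrite mulr_ge0 ?sqr_ge0.
exists r => //; rewrite -lte_fin -rE.
apply: (@lt_le_trans _ _ (expR (- pi * Q 0))%:E); first by rewrite lte_fin expR_gt0.
apply: esum_ge; exists [set 0].
  by split=> // f ->; exact: fractional_ideal0 (div_idealP (val D)).
by rewrite fsbig_set1.
Qed.

Lemma exists_shortest f0 (B : R) : I f0 -> f0 != 0 -> Q f0 < B ->
  exists f, [/\ I f, f != 0, Q f < B & forall g, I g -> g != 0 -> Q f <= Q g].
Proof.
move=> If0 f00 Qf0; pose A := [set f | [/\ I f, f != 0 & Q f < B]].
have finA : finite_set A.
  apply: contrapT => /infinite_set_fset infA.
  have e0 : 0 < expR (- (pi / 10) * B) by exact: expR_gt0.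
  (* Each vector with [Q < B] adds at least [expR (- (pi / 10) * B)] to a series bounded by [80], so
     this many vectors are too many. *)
  have [s sA] := infA (Num.truncn (80 / expR (- (pi / 10) * B))).+1.
  have := truncnS_gt (80 / expR (- (pi / 10) * B)); rewrite ltr_pdivrMr //.
  set n := (Num.truncn _).+1 => hn ns.
  have le80 : \sum_(f <- s) expR (- (pi / 10) * Q f) <= 80.
    apply: (@finite_le_esum R F I) (esum_tenth IB ideal_ge3) => f fs.
    by have [] : A f by exact: sA.
  have : n%:R * expR (- (pi / 10) * B) <= \sum_(f <- s) expR (- (pi / 10) * Q f).
    apply: (@le_trans _ _ (\sum_(f <- s) expR (- (pi / 10) * B))).
      rewrite big_const_seq count_predT iter_addr_0 -[leRHS]mulr_natl ler_pM2r //.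
      by rewrite ler_nat.
    rewrite big_seq [leRHS]big_seq; apply: ler_sum => f fs.
    have [_ _ fB] : A f by exact: sA.
    by rewrite ler_expR !mulNr lerN2 ler_wpM2l ?divr_ge0 ?pi_ge0 // ltW.
  by move=> /le_trans /(_ le80); rewrite leNgt hn.
have f0A : f0 \in fset_set A by rewrite in_fset_set // inE.
have [f fA fmin] := exists_min_seq Q f0A.
have [If fn0 fB] : A f by have := fA; rewrite in_fset_set // inE.
exists f; split=> // g Ig gn0.
have [gB|] := ltP (Q g) B; last by move=> h; apply: ltW; exact: lt_le_trans fB h.
by apply: fmin; rewrite in_fset_set // inE.
Qed.

Lemma k0_lt_far : (forall f, I f -> f != 0 -> 474 / 100 <= Q f) ->
  k0 sigma iota (val D) < k0 sigma iota (trivial_divisor R F).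
Proof.
move=> far; have [r r0 rE] := esum_ideal_finite.
rewrite -lte_fin k0_trivial k0E -/I -/x0 -/x1 -/x2 rE /= -rE.
rewrite (esumID [set 0]); last by move=> f _; rewrite lee_fin expR_ge0.
have -> : I `&` [set 0] = [set 0].
  apply/seteqP; split=> [f []//|f ->]; split=> //.
  exact: fractional_ideal0 (div_idealP (val D)).
rewrite esum_set1; last by rewrite lee_fin expR_ge0.
have wq0 (a b c : R) : wq a b c 0 = 0 by rewrite /wnorm !rmorph0 expr0n /= !mulr0 !addr0.
rewrite wq0 mulr0 expR0.
apply: (@le_lt_trans _ _ (1 + (expR (- pi * (9 / 10 * (474 / 100))) * 80)%:E)%E).
  apply: leeD => //; apply: (@esum_tail _ _ _ _ I) => //.
  - exact: ideal_ge3.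
  - by move=> f [If /eqP fn0]; apply: far.
apply: (@lt_le_trans _ _ (1 + (2 * expR (- pi * 3))%:E)%E).
  by rewrite -!EFinD lte_fin ltrD2l far_numeric.
rewrite (esumID [set 0]); last by move=> f _; rewrite lee_fin expR_ge0.
have -> : OF `&` [set 0] = [set 0].
  by apply/seteqP; split=> [f []//|f ->]; split=> //; exact: OF0.
rewrite esum_set1; last by rewrite lee_fin expR_ge0.
rewrite T2_wq wq0 mulr0 expR0; apply: leeD => //.
have T21 : T2 1 = 3 by rewrite /sumsq !rmorph1 expr1n; ring.
have T2N1 : T2 (-1) = 3 by rewrite T2_wq wqN -T2_wq.
have := @esum_pm1 (OF `&` ~` [set 0]) (fun f => expR (- pi * T2 f)).
rewrite T21 T2N1 (_ : _ + _ = 2 * expR (- pi * 3)); last by ring.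
apply.
- by split; [exact: OF1 | exact/eqP/oner_neq0].
- by split; [apply: OFN; exact: OF1 | apply/eqP; rewrite oppr_eq0 oner_neq0].
Qed.

Lemma k0_lt_near f : I f -> f != 0 -> Q f < 474 / 100 ->
  (forall g, I g -> g != 0 -> Q f <= Q g) ->
  pic_class sigma iota D = pic_class sigma iota (D0 R F) \/
  k0 sigma iota (val D) < k0 sigma iota (trivial_divisor R F).
Proof.
move=> If f0 Qf fmin; have [IE vE] := ideal_principal If f0 Qf.
have xp i : 0 < div_vec (val D) 0 i by exact: div_vecP.
pose u := x0 * `|iota f|; pose v := x1 * `|iota (sigma f)|.
pose w := x2 * `|iota (sigma (sigma f))|.
have u0 : 0 < u by rewrite mulr_gt0 ?xp // normr_gt0 !fmorph_eq0.
have v0 : 0 < v by rewrite mulr_gt0 ?xp // normr_gt0 !fmorph_eq0.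
have w0 : 0 < w by rewrite mulr_gt0 ?xp // normr_gt0 !fmorph_eq0.
have uvw : u * v * w = 1.
  by rewrite -vE vec_normE /absN !normrM /u /v /w -/x0 -/x1 -/x2; ring.
have QE g : Q (f * g) = wq (u ^+ 2) (v ^+ 2) (w ^+ 2) g.
  rewrite /wnorm !rmorphM /= /u /v /w !exprMn !real_normK ?num_real //; ring.
have lamE : u ^+ 2 + v ^+ 2 + w ^+ 2 = Q f.
  by rewrite -[in RHS](mulr1 f) QE /wnorm !rmorph1 expr1n !mulr1.
have [l3|l3] := eqVneq (u ^+ 2 + v ^+ 2 + w ^+ 2) 3; [left|right].
  have u1 : u = 1 by exact: weight_eq1 l3.
  have v1 : v = 1.
    by apply: (@weight_eq1 _ v w u) => //; [rewrite -uvw; ring | rewrite -l3; ring].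
  have w1 : w = 1.
    by apply: (@weight_eq1 _ w u v) => //; [rewrite -uvw; ring | rewrite -l3; ring].
  (* When [lambda = 3] all weights [x_i |sigma^i f|] equal [1], so adding the principal divisor of
     [f] to [D] gives the trivial divisor. *)
  apply/pic_classP; exists f, f0; apply/div_add_principalP; split.
    rewrite /= -/I IE; apply/seteqP; split=> [g Og|_ [_ [g Og <-] <-]].
      by exists (f * g); [exists g | rewrite mulKf].
    by rewrite mulKf.
  have [p0 p1 p2] := PhiE f.
  apply/rowP => i; rewrite [LHS]mxE [RHS]mxE.
  have : i = 0 \/ i = 1 \/ i = 2%:R.
    case: i => [[|[|[|//]]]] p; [left|right;left|right;right]; exact: val_inj.
  case=> [->|[->|->]]; rewrite ?p0 ?p1 ?p2; exact: esym.
have [r r0 rE] := esum_ideal_finite.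
rewrite -lte_fin k0_trivial k0E -/I -/x0 -/x1 -/x2 rE /= -rE.
rewrite IE (reindex_esum OF _ (fun g => f * g)); last first.
  split; [by move=> g Og; exists g | | by []].
  by move=> g h _ _; exact: mulfI.
rewrite (eq_esum (b := fun g => (expR (- pi * wq (u ^+ 2) (v ^+ 2) (w ^+ 2) g))%:E)); last first.
  by move=> g _; rewrite QE.
apply: esum_OF_lt => // g Og g0; rewrite lamE -QE; apply: fmin; last by rewrite mulf_neq0.
by rewrite IE; exists g.
Qed.

Lemma k0_lt : pic_class sigma iota D = pic_class sigma iota (D0 R F) \/
  k0 sigma iota (val D) < k0 sigma iota (trivial_divisor R F).
Proof.
have [[f [If f0 Qf]]|far] := pselect (exists f, [/\ I f, f != 0 & Q f < 474 / 100]).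
  have [g [Ig g0 Qg gmin]] := exists_shortest If f0 Qf.
  exact: k0_lt_near Ig g0 Qg gmin.
right; apply: k0_lt_far => f If f0; rewrite leNgt; apply/negP => Qf.
by apply: far; exists f.
Qed.

Lemma k0_gt0 : 0 < k0 sigma iota (val D).
Proof. by have [r r0 rE] := esum_ideal_finite; rewrite k0E -/I -/x0 -/x1 -/x2 rE. Qed.

End Divisor.
End Final.

Theorem theorem1p1 (R : realType) (F : splittingFieldType rat)
  (sigma : gal_of {:F}) (iota : {rmorphism F -> R})
  (galF : galois 1 {:F})
  (genF : 'Gal({:F} / 1)%g = <[sigma]>%g)
  (ordF : #|'Gal({:F} / 1)%g| = 3%N) :
  (forall c : Pic0 sigma iota,
     h0_Pic0 c <= h0_Pic0 (pic_class sigma iota (D0 R F))) /\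
  (forall c : Pic0 sigma iota,
     h0_Pic0 c = h0_Pic0 (pic_class sigma iota (D0 R F)) ->
     c = pic_class sigma iota (D0 R F)).
Proof.
have key (c : Pic0 sigma iota) : c = pic_class sigma iota (D0 R F) \/
    h0_Pic0 c < h0_Pic0 (pic_class sigma iota (D0 R F)).
  have cE : c = pic_class sigma iota (repr c) by rewrite /pic_class reprK.
  have [e|lt] := k0_lt iota galF genF ordF (repr c); first by left; rewrite {1}cE e.
  right; rewrite h0_Pic0E /h0_Pic0 /h0 ltr_ln ?posrE //.
  - exact: k0_gt0 iota galF genF ordF (repr c).
  - exact: k0_gt0 iota galF genF ordF (D0 R F).
split=> c; have [->//|lt] := key c; first exact: ltW.
by move=> e; rewrite e ltxx in lt.
Qed.
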